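(* Let $(A(n))_{n\ge1}$ be an i.i.d. sequence of random $(\max,+)$ operators on $\mathbb R^d$ with the memory loss property, and let $X^0$ be any $\mathbb R^d$-valued random variable independent of $(A(n))$. If $\max_{i,j}A(1)_{ij}$ and $\min_j\max_iA(1)_{ij}$ have finite second moments, then there exists $\sigma^2\ge0$ (not depending on $X^0$) such that (i) $\frac{x(n,X^0)-n\gamma\mathbf 1}{\sqrt n}$ converges weakly to a random vector whose coordinates are all equal and have law $\mathcal N(0,\sigma^2)$; (ii) $\sigma^2=\lim_n\frac1n\int\big(\max_{i,j}(A(n)\cdots A(1))_{ij}-n\gamma\big)^2d\mathbb P$.
   Context: $\mathbb R_{\max}=\mathbb R\cup\{-\infty\}$. A $d\times d$ matrix $A$ with entries in $\mathbb R_{\max}$ and no row identically $-\infty$ defines a $(\max,+)$ operator on $\mathbb R^d$ by $(Ax)_i=\max_j(A_{ij}+x_j)$; composition corresponds to the $(\max,+)$ matrix product $(AB)_{ij}=\max_p(A_{ip}+B_{pj})$. Such operators are topical: isotone and $A(x+a\mathbf 1)=Ax+a\mathbf 1$, $\mathbf 1=(1,\dots,1)'$. Let $\bar x$ be the class of $x$ modulo $\mathbb R\mathbf 1$. An operator $A$ has rank 1 if $\overline{Ax}$ does not depend on $x\in\mathbb R^d$; the sequence has the memory loss property if some $A(N)\cdots A(1)$ has rank 1 with positive probability. $x(0,X^0)=X^0$, $x(n,X^0)=A(n)x(n-1,X^0)$; $\gamma$ is the Lyapunov exponent ($x(n,X^0)/n\to\gamma\mathbf 1$ a.s.). *)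

(* Defs.v *)
From HB Require Import structures.
From mathcomp Require Import all_boot all_order all_algebra.
From mathcomp Require Import all_classical all_reals all_analysis measurable_realfun lebesgue_measure normal_distribution.
Set Implicit Arguments. Unset Strict Implicit. Unset Printing Implicit Defensive.
Import Order.TTheory GRing.Theory Num.Theory.
Import numFieldNormedType.Exports.
Local Open Scope classical_set_scope.
Local Open Scope ring_scope.

Section MaxPlus.
Context {R : realType} {d : nat}.
Local Open Scope ereal_scope.

(* A d x d matrix with entries in R_max = R ∪ {-oo}; encoded in \bar R. *)
Definition mp_op := 'I_d -> 'I_d -> \bar R.

Definition is_mp_op (A : mp_op) : Prop :=
  (forall i j, A i j != +oo) /\ (forall i, exists j, A i j != -oo).

Definition mp_mul (A B : mp_op) : mp_op :=
  fun i j => \big[maxe/-oo]_(p < d) (A i p + B p j).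

Definition mp_one : mp_op := fun i j => if i == j then 0 else -oo.

Definition mp_apply (A : mp_op) (x : 'I_d -> R) : 'I_d -> R :=
  fun i => fine (\big[maxe/-oo]_(j < d) (A i j + (x j)%:E)).

Definition mp_rank1 (A : mp_op) : Prop :=
  forall x y : 'I_d -> R, exists c : R, forall i,
    mp_apply A x i = (mp_apply A y i + c)%R.

Definition mp_maxentry (A : mp_op) : \bar R :=
  \big[maxe/-oo]_(i < d) \big[maxe/-oo]_(j < d) A i j.

Definition mp_minmax (A : mp_op) : \bar R :=
  \big[mine/+oo]_(j < d) \big[maxe/-oo]_(i < d) A i j.

(* A(n) ... A(1), with A(0) unused *)
Fixpoint mp_prod {T} (A : nat -> T -> mp_op) (n : nat) (w : T) : mp_op :=
  match n with
  | 0 => mp_one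
  | k.+1 => mp_mul (A k.+1 w) (mp_prod A k w)
  end.

Fixpoint mp_traj {T} (A : nat -> T -> mp_op) (X0 : T -> 'I_d -> R)
    (n : nat) (w : T) : 'I_d -> R :=
  match n with
  | 0 => X0 w
  | k.+1 => mp_apply (A k.+1 w) (mp_traj A X0 k w)
  end.

Definition mp_op_sigma : set (set mp_op) :=
  <<s [set S | exists i j (B : set (\bar R)), measurable B /\
        S = [set M : mp_op | B (M i j)]] >>.

Definition vec_sigma : set (set ('I_d -> R)) :=
  <<s [set S | exists i (B : set R), measurable B /\
        S = [set x : 'I_d -> R | B (x i)]] >>.
End MaxPlus.

Definition sigma_of {T U : Type} (X : T -> U) (G : set (set U)) : set (set T) :=
  [set E | exists2 S, G S & E = X @^-1` S].

Definition mutual_indep {dT} {T : measurableType dT} {R : realType}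
    (P : probability T R) (F : nat -> set (set T)) : Prop :=
  forall (s : seq nat) (E : nat -> set T), uniq s ->
    (forall n, n \in s -> F n (E n)) ->
    P [set w | forall n, n \in s -> E n w] = \big[*%E/1%E]_(n <- s) P (E n).

(* E[g(Z)] for Z ~ N(0, s2); N(0,0) is the Dirac mass at 0 *)
Definition gauss_expect {R : realType} (s2 : R) (g : R -> R) : \bar R :=
  if s2 == 0 then (g 0)%:E
  else (\int[lebesgue_measure]_x (g x * normal_pdf 0 (Num.sqrt s2) x)%:E)%E.

(* Main.v *)
(** Let [X_n] be the largest entry of [A(n) ... A(1)]. The subadditivity defect
    [X_n + X_m o shift^n - X_(n+m)] no longer changes with [m] once
    [A(n+m) ... A(n+1)] has rank 1. The probability that this has not happened after [m]
    steps decays geometrically, and the [m]-th increment of the defect is dominated by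
    the entries of a matrix independent of that event, so the defect is bounded in [L^2]
    uniformly in [n] and [m].

    Consequently [X_n] is approximated by a sum of [n / b] independent blocks of length [b];
    the centred error is orthogonal across the two halves of the blocks, hence grows only
    like the square root of their number and is, after division by [sqrt n], of order
    [1 / sqrt b] uniformly in [n]. It follows that the normalized standard deviation of
    [X_n] is Cauchy, that [E X_n = n gamma + O(1)], and, by Lindeberg replacement of the
    blocks, that [X_n] satisfies the central limit theorem.

    Once the last [m] factors have rank 1, the differences between [X_n] and the coordinates
    of the trajectory from 0 depend on these factors only; they are therefore tight. *)
Require Import Defs.
From HB Require Import structures.
From mathcomp Require Import all_boot all_order all_algebra.
From mathcomp Require Import all_classical all_reals all_analysis measurable_realfun lebesgue_measure normal_distribution.
From mathcomp Require Import ring lra zify.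
Set Implicit Arguments. Unset Strict Implicit. Unset Printing Implicit Defensive.
Import Order.TTheory GRing.Theory Num.Theory.
Import numFieldNormedType.Exports.
Local Open Scope classical_set_scope.
Local Open Scope ring_scope.

(** * Square-integrable random variables *)

Section L2space.
Context {R : realType} {dT} {T : measurableType dT} (P : probability T R).
Implicit Types X Y Z : T -> R.

(** With second moments only, the move of the defect cannot be separated from the event of not
    having rank 1 by Hoelder's inequality. Independence does it instead: the event concerns
    operators preceding the one that moves the defect, so the [L^2] norm of the move is of order
    [sqrt (p_m)], still summable. Both moment hypotheses act through [Qb]: the largest entry bounds
    an increment of [X_n] from above, the least column maximum from below.

    Centring decides the rate. Each gluing of blocks shifts the mean by [O(1)], so uncentred errors
    grow linearly in the number of blocks; this suffices for the means, where one divides by that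
    number. Only the centred errors of two halves are orthogonal, and these give the square root.

    Lindeberg replacement is run on functions having a uniform second-order expansion, a class
    stable under Gaussian averaging. Bounded continuous functions of the vector are reached from it
    by Gaussian smoothing and Lipschitz minorants. As [X_n] starts from the zero vector, [sigma2]
    does not see [X0]. *)

Definition L1 X := P.-integrable setT (EFin \o X).
Definition Ex X : R := Rintegral P setT X.

Lemma L1_measurable X : L1 X -> measurable_fun setT X.
Proof. by move=> /measurable_int /measurable_EFinP. Qed.

Lemma L1_le X Y : measurable_fun setT X -> L1 Y ->
  (forall w, `|X w| <= Y w) -> L1 X.
Proof.
move=> mX iY XY; apply: le_integrable iY => //; first exact/measurable_EFinP.
by move=> w _ /=; rewrite lee_fin (le_trans (XY w))// ler_norm.
Qed.

Lemma L1_cst (r : R) : L1 (fun=> r).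
Proof. exact: finite_measure_integrable_cst. Qed.

Lemma L1_bounded X M : measurable_fun setT X -> (forall w, `|X w| <= M) -> L1 X.
Proof. by move=> mX XM; apply: L1_le (L1_cst M) _. Qed.

Lemma L1D X Y : L1 X -> L1 Y -> L1 (fun w => X w + Y w).
Proof. by move=> iX iY; have := integrableD measurableT iX iY. Qed.

Lemma L1B X Y : L1 X -> L1 Y -> L1 (fun w => X w - Y w).
Proof. by move=> iX iY; have := integrableB measurableT iX iY. Qed.

Lemma L1Z (a : R) X : L1 X -> L1 (fun w => a * X w).
Proof. by move=> iX; have := integrableZl measurableT a iX. Qed.

Lemma L1_abs X : L1 X -> L1 (fun w => `|X w|).
Proof. by move=> iX; have := integrable_abse iX. Qed.

Lemma L1_sum n (X : nat -> T -> R) : (forall i, L1 (X i)) ->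
  L1 (fun w => \sum_(i < n) X i w).
Proof.
move=> iX; elim: n => [|n IH].
  by under [X in L1 X]eq_fun do rewrite big_ord0; exact: L1_cst.
by under [X in L1 X]eq_fun do rewrite big_ord_recr; exact: L1D.
Qed.

Lemma ExD X Y : L1 X -> L1 Y -> Ex (fun w => X w + Y w) = Ex X + Ex Y.
Proof. exact: RintegralD. Qed.

Lemma ExB X Y : L1 X -> L1 Y -> Ex (fun w => X w - Y w) = Ex X - Ex Y.
Proof. exact: RintegralB. Qed.

Lemma ExZ (a : R) X : L1 X -> Ex (fun w => a * X w) = a * Ex X.
Proof. exact: RintegralZl. Qed.

Lemma Ex_cst (r : R) : Ex (fun=> r) = r.
Proof. by rewrite /Ex Rintegral_cst//= probability_setT mulr1. Qed.

Lemma Ex_sum n (X : nat -> T -> R) : (forall i, L1 (X i)) ->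
  Ex (fun w => \sum_(i < n) X i w) = \sum_(i < n) Ex (X i).
Proof.
move=> iX; elim: n => [|n IH].
  rewrite big_ord0 -[RHS](Ex_cst 0).
  by congr Ex; apply/funext => w; rewrite big_ord0.
rewrite big_ord_recr/= -IH -ExD//; last exact: L1_sum.
by congr Ex; apply/funext => w; rewrite big_ord_recr.
Qed.

Lemma Ex_le X Y : L1 X -> L1 Y -> (forall w, X w <= Y w) -> Ex X <= Ex Y.
Proof. by move=> iX iY XY; exact: le_Rintegral. Qed.

Lemma Ex_ge0 X : (forall w, 0 <= X w) -> 0 <= Ex X.
Proof. by move=> X0; exact: Rintegral_ge0. Qed.

Lemma Ex_abs X : L1 X -> `|Ex X| <= Ex (fun w => `|X w|).
Proof. exact: le_normr_Rintegral. Qed.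

Lemma EFin_Ex X : L1 X -> (\int[P]_w (X w)%:E)%E = (Ex X)%:E.
Proof. by move=> iX; rewrite /Ex /Rintegral fineK//; exact: integrable_fin_num. Qed.

Definition L2 X := measurable_fun setT X /\ L1 (fun w => X w ^+ 2).

Lemma L2_mul X Y : L2 X -> L2 Y -> L1 (fun w => X w * Y w).
Proof.
move=> [mX iX] [mY iY].
apply: (@L1_le _ (fun w => X w ^+ 2 + Y w ^+ 2)); [exact: measurable_funM|exact: L1D|].
move=> w; rewrite normrM -[X w ^+ 2]real_normK ?num_real// -[Y w ^+ 2]real_normK ?num_real//.
nra.
Qed.

Lemma L2_cst (r : R) : L2 (fun=> r).
Proof. by split; [exact: measurable_cst|exact: L1_cst]. Qed.

Lemma L2_L1 X : L2 X -> L1 X.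
Proof.
move=> iX; have := L2_mul iX (L2_cst 1).
by congr (L1 _); apply/funext => w; rewrite mulr1.
Qed.

Lemma L2D X Y : L2 X -> L2 Y -> L2 (fun w => X w + Y w).
Proof.
move=> iX iY; split; first by apply: measurable_funD; [case: iX|case: iY].
have -> : (fun w => (X w + Y w) ^+ 2) =
    (fun w => (X w ^+ 2 + Y w ^+ 2) + 2 * (X w * Y w)).
  by apply/funext => w; ring.
apply: L1D; last by apply: L1Z; exact: L2_mul.
by apply: L1D; [case: iX|case: iY].
Qed.

Lemma L2Z (a : R) X : L2 X -> L2 (fun w => a * X w).
Proof.
move=> [mX iX]; split; first exact: measurable_funM.
have -> : (fun w => (a * X w) ^+ 2) = (fun w => a ^+ 2 * X w ^+ 2).
  by apply/funext => w; ring.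
exact: L1Z.
Qed.

Lemma L2B X Y : L2 X -> L2 Y -> L2 (fun w => X w - Y w).
Proof.
move=> iX iY; have := L2D iX (L2Z (-1) iY).
by congr (L2 _); apply/funext => w; rewrite mulN1r.
Qed.

Lemma L2_sum n (X : nat -> T -> R) : (forall i, L2 (X i)) ->
  L2 (fun w => \sum_(i < n) X i w).
Proof.
move=> iX; elim: n => [|n IH].
  by under [X in L2 X]eq_fun do rewrite big_ord0; exact: L2_cst.
by under [X in L2 X]eq_fun do rewrite big_ord_recr; exact: L2D.
Qed.

Definition nrm X := Num.sqrt (Ex (fun w => X w ^+ 2)).

Lemma nrm_ge0 X : 0 <= nrm X. Proof. exact: sqrtr_ge0. Qed.

Lemma nrmE X : nrm X ^+ 2 = Ex (fun w => X w ^+ 2).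
Proof. by rewrite sqr_sqrtr// Ex_ge0// => w; rewrite sqr_ge0. Qed.

Lemma nrmZ (a : R) X : L2 X -> nrm (fun w => a * X w) = `|a| * nrm X.
Proof.
move=> [mX iX]; rewrite /nrm -sqrtr_sqr -sqrtrM ?sqr_ge0// -ExZ//.
by congr (Num.sqrt (Ex _)); apply/funext => w; rewrite exprMn.
Qed.

Lemma nrm_cst (r : R) : nrm (fun=> r) = `|r|.
Proof. by rewrite /nrm Ex_cst sqrtr_sqr. Qed.

Lemma ExD_sqr X Y : L2 X -> L2 Y ->
  nrm (fun w => X w + Y w) ^+ 2 = nrm X ^+ 2 + nrm Y ^+ 2 + 2 * Ex (fun w => X w * Y w).
Proof.
move=> iX iY; rewrite !nrmE -ExZ; last exact: L2_mul.
rewrite -ExD; [|by case: iX|by case: iY].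
rewrite -ExD; last 2 first.
- by apply: L1D; [case: iX|case: iY].
- by apply: L1Z; exact: L2_mul.
by congr Ex; apply/funext => w; ring.
Qed.

(** The form [nrm (t X + s Y) ^+ 2] is nonnegative. With [x], [y] the two norms, its values at
    [(y, x)] and [(y, - x)] give the two signs after division by [2 x y]. *)
Lemma cauchy_schwarz X Y : L2 X -> L2 Y -> `|Ex (fun w => X w * Y w)| <= nrm X * nrm Y.
Proof.
move=> iX iY.
have key (t s : R) : 0 <= t ^+ 2 * nrm X ^+ 2 + s ^+ 2 * nrm Y ^+ 2 +
    2 * (t * s * Ex (fun w => X w * Y w)).
  have := sqr_ge0 (nrm (fun w => t * X w + s * Y w)).
  rewrite ExD_sqr ?nrmZ//; [|exact: L2Z|exact: L2Z].
  rewrite !exprMn !real_normK ?num_real// -(ExZ (t * s)); last exact: L2_mul.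
  by congr (_ <= _ + _ * Ex _); apply/funext => w; ring.
have [x0 y0] := (nrm_ge0 X, nrm_ge0 Y).
set e := Ex _ in key *; move: (nrm X) (nrm Y) x0 y0 key => x y x0 y0 key.
have [x00|xn0] := eqVneq x 0.
  suff -> : e = 0 by rewrite x00 mul0r normr0.
  apply/eqP/contraT => en0.
  (* If [x = 0], the form is affine in [t]; this [t] would give it the value [-1]. *)
  have := key (- (y ^+ 2 + 1) / (2 * e)) 1; rewrite x00.
  have -> : 2 * (- (y ^+ 2 + 1) / (2 * e) * 1 * e) = - (y ^+ 2 + 1) by field.
  by rewrite expr0n/= mulr0 expr1n mul1r; lra.
have [y00|yn0] := eqVneq y 0.
  suff -> : e = 0 by rewrite y00 mulr0 normr0.
  apply/eqP/contraT => en0.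
  have := key 1 (- (x ^+ 2 + 1) / (2 * e)); rewrite y00.
  have -> : 2 * (1 * (- (x ^+ 2 + 1) / (2 * e)) * e) = - (x ^+ 2 + 1) by field.
  by rewrite expr0n/= mulr0 expr1n mul1r; lra.
have xy : 0 < 2 * (x * y) by rewrite !mulr_gt0// lt_def ?xn0 ?yn0.
rewrite ler_norml; apply/andP; split; rewrite -(ler_pM2l xy).
  have := key y x; rewrite (_ : _ + _ = 2 * (x * y) * e - 2 * (x * y) * - (x * y)).
    by rewrite subr_ge0.
  by ring.
have := key y (- x); rewrite (_ : _ + _ = 2 * (x * y) * (x * y) - 2 * (x * y) * e).
  by rewrite subr_ge0.
by ring.
Qed.

Lemma nrmD X Y : L2 X -> L2 Y -> nrm (fun w => X w + Y w) <= nrm X + nrm Y.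
Proof.
move=> iX iY; rewrite -(@ler_pXn2r _ 2)// ?nnegrE ?addr_ge0 ?nrm_ge0//.
rewrite ExD_sqr//; have := cauchy_schwarz iX iY; rewrite ler_norml => /andP[_].
nra.
Qed.

Lemma nrmB X Y : L2 X -> L2 Y -> nrm (fun w => X w - Y w) <= nrm X + nrm Y.
Proof.
move=> iX iY; have := nrmD iX (L2Z (-1) iY); rewrite nrmZ// normrN normr1 mul1r.
by congr (nrm _ <= _); apply/funext => w; rewrite mulN1r.
Qed.

Lemma nrm_pythagoras X Y : L2 X -> L2 Y -> Ex (fun w => X w * Y w) = 0 ->
  nrm (fun w => X w + Y w) ^+ 2 = nrm X ^+ 2 + nrm Y ^+ 2.
Proof. by move=> iX iY XY; rewrite ExD_sqr// XY mulr0 addr0. Qed.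

Lemma Ex_abs_le_nrm X : L2 X -> Ex (fun w => `|X w|) <= nrm X.
Proof.
move=> [mX iX]; have iX' : L2 (fun w => `|X w|).
  split; first exact: measurableT_comp.
  by under [X in L1 X]eq_fun do rewrite real_normK ?num_real//.
have := cauchy_schwarz iX' (L2_cst 1); rewrite nrm_cst normr1 mulr1.
have -> : nrm (fun w => `|X w|) = nrm X.
  by congr (Num.sqrt (Ex _)); apply/funext => w; rewrite real_normK ?num_real.
apply: le_trans; rewrite (le_trans _ (ler_norm _))//.
by rewrite le_eqVlt; apply/orP; left; apply/eqP; congr Ex; apply/funext => w; rewrite mulr1.
Qed.

Lemma Ex_le_nrm X : L2 X -> `|Ex X| <= nrm X.
Proof.
move=> iX; apply: le_trans (Ex_abs_le_nrm iX).
by apply: Ex_abs; exact: L2_L1.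
Qed.

Definition ctr X := fun w => X w - Ex X.

Lemma L2_ctr X : L2 X -> L2 (ctr X).
Proof. by move=> iX; apply: L2B => //; exact: L2_cst. Qed.

Lemma Ex_ctr X : L1 X -> Ex (ctr X) = 0.
Proof. by move=> iX; rewrite ExB ?Ex_cst ?subrr//; exact: L1_cst. Qed.

Lemma nrm_shift X (c : R) : L2 X -> Ex X = 0 ->
  nrm (fun w => X w + c) ^+ 2 = nrm X ^+ 2 + c ^+ 2.
Proof.
move=> iX X0; rewrite ExD_sqr//; last exact: L2_cst.
have -> : Ex (fun w => X w * c) = 0.
  rewrite -[RHS](mulr0 c) -X0 -ExZ; last exact: L2_L1.
  by congr Ex; apply/funext => w; rewrite mulrC.
by rewrite nrm_cst real_normK ?num_real// mulr0 addr0.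
Qed.

Lemma nrm_ctr X : L2 X -> nrm (ctr X) <= nrm X.
Proof.
move=> iX; rewrite -(@ler_pXn2r _ 2)// ?nnegrE ?nrm_ge0//.
have -> : nrm X ^+ 2 = nrm (ctr X) ^+ 2 + Ex X ^+ 2.
  rewrite -nrm_shift//; [|exact: L2_ctr|by apply: Ex_ctr; exact: L2_L1].
  by congr (nrm _ ^+ 2); apply/funext => w; rewrite /ctr subrK.
by rewrite lerDl sqr_ge0.
Qed.

End L2space.

(** * The normal distribution *)

Section normal_integral.
Context {R : realType}.
Notation mu := (@lebesgue_measure R).
Implicit Types (m s a b x : R).
Import HBNNSimple.

Lemma integral_normal_prob_nnsfun m s (g : {nnsfun (measurableTypeR R) >-> R}) :
  (\int[normal_prob m s]_x (g x)%:E =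
   \int[mu]_x ((g x)%:E * (normal_pdf m s x)%:E))%E.
Proof.
have mpdf : measurable_fun setT (fun x : measurableTypeR R => (normal_pdf m s x)%:E).
  by apply/measurable_EFinP; exact: measurable_normal_pdf.
transitivity (\sum_(r \in range g)
    \int[normal_prob m s]_x (r * \1_(g @^-1` [set r]) x)%:E)%E.
  under eq_integral do rewrite fimfunE -fsumEFin//.
  rewrite ge0_integral_fsum//.
  - by move=> y; exact/measurable_EFinP/measurable_funM.
  - by move=> y x _; rewrite nnfun_muleindic_ge0.
transitivity (\sum_(r \in range g)
    \int[mu]_x ((r * \1_(g @^-1` [set r]) x)%:E * (normal_pdf m s x)%:E))%E; last first.
  rewrite -ge0_integral_fsum//.
  - apply: eq_integral => x _; rewrite [in RHS]fimfunE -fsumEFin//.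
    rewrite ge0_mule_fsuml// => r.
    by rewrite nnfun_muleindic_ge0.
  - by move=> y; apply: emeasurable_funM => //; exact/measurable_EFinP/measurable_funM.
  - by move=> y x _; rewrite mule_ge0 ?nnfun_muleindic_ge0// lee_fin normal_pdf_ge0.
apply: eq_fsbigr => r /[!inE] -[x0 _ <-{r}].
have g0 : 0 <= g x0 by [].
have mg : measurable (g @^-1` [set g x0]) by [].
under eq_integral do rewrite EFinM.
under [RHS]eq_integral do rewrite EFinM -muleA.
rewrite !ge0_integralZl//.
- rewrite integral_indic// setIT; congr (_ * _)%E.
  transitivity (\int[mu]_(x in g @^-1` [set g x0]) (normal_pdf m s x)%:E)%E; first by [].
  rewrite [LHS]integral_mkcond epatch_indic; apply: eq_integral => x _.
  by rewrite muleC.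
- by apply: emeasurable_funM => //; exact/measurable_EFinP.
- by move=> x _; rewrite mule_ge0// lee_fin normal_pdf_ge0.
- exact/measurable_EFinP.
Qed.

(** Both sides are continuous along the increasing simple approximations of [f], so the case of
    simple functions passes to the limit by monotone convergence. *)
Lemma integral_normal_prob m s (f : measurableTypeR R -> \bar R) : measurable_fun setT f ->
  (forall x, 0 <= f x)%E ->
  (\int[normal_prob m s]_x f x = \int[mu]_x (f x * (normal_pdf m s x)%:E))%E.
Proof.
move=> mf f0.
have mpdf : measurable_fun setT (fun x : measurableTypeR R => (normal_pdf m s x)%:E).
  by apply/measurable_EFinP; exact: measurable_normal_pdf.
pose f_ := nnsfun_approx measurableT mf.
transitivity (limn (fun n => \int[normal_prob m s]_x (f_ n x)%:E)%E).
  rewrite -monotone_convergence//.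
  - by apply: eq_integral => x _; apply/esym/cvg_lim => //; exact: cvg_nnsfun_approx.
  - by move=> n; exact/measurable_EFinP.
  - by move=> n x _; rewrite lee_fin.
  - by move=> x _ j k jk; rewrite lee_fin; exact/lefP/nd_nnsfun_approx.
under eq_fun do rewrite integral_normal_prob_nnsfun.
rewrite -monotone_convergence//.
- apply: eq_integral => x _; apply/cvg_lim => //.
  apply: cvgeZr => //; exact: cvg_nnsfun_approx.
- by move=> n; apply: emeasurable_funM => //; exact/measurable_EFinP.
- by move=> n x _; rewrite mule_ge0// lee_fin// normal_pdf_ge0.
- move=> x _ j k jk; rewrite lee_wpmul2r ?lee_fin ?normal_pdf_ge0//.
  exact/lefP/nd_nnsfun_approx.
Qed.

End normal_integral.

(** * Moments of the standard normal law *)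

Section normal_moments.
Context {R : realType}.
Notation mu := (@lebesgue_measure R).
Implicit Types (m s a b x : R).

Definition stdnormal : probability (measurableTypeR R) R := normal_prob 0 1.

Lemma normal_pdfS m s x : 0 < s ->
  normal_pdf m s x = s^-1 * ((Num.sqrt (pi *+ 2))^-1 * expR (- (x - m) ^+ 2 / (2 * s ^+ 2))).
Proof.
move=> s0; rewrite normal_pdfE ?gt_eqF// /normal_peak /normal_fun -mulrnAr.
rewrite sqrtrM ?sqr_ge0// sqrtr_sqr gtr0_norm// invfM -mulrA.
by rewrite -(mulr_natl (s ^+ 2) 2) mulNr.
Qed.

(** The density of N(m, s^2) with respect to N(0, 1). That it has mean 1 under N(0, 1) replaces
    explicit integrations below. *)
Definition normal_ratio m s x : R := s^-1 * expR (x ^+ 2 / 2 - (x - m) ^+ 2 / (2 * s ^+ 2)).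

Lemma normal_ratioE m s x : 0 < s ->
  normal_ratio m s x * normal_pdf 0 1 x = normal_pdf m s x.
Proof.
move=> s0; rewrite !normal_pdfS// /normal_ratio invr1 mul1r subr0 expr1n mulr1.
rewrite -!mulrA; congr (_ * _); rewrite mulrCA -expRD; congr (_ * expR _).
by field; rewrite gt_eqF.
Qed.

Lemma measurable_normal_ratio m s : measurable_fun setT (normal_ratio m s : measurableTypeR R -> R).
Proof.
apply: measurable_funM => //; apply: measurableT_comp => //.
apply: measurable_funB; apply: measurable_funM => //; apply: measurable_funX => //.
by apply: measurable_funB.
Qed.

Lemma normal_ratio_ge0 m s x : 0 < s -> 0 <= normal_ratio m s x.
Proof. by move=> s0; rewrite mulr_ge0 ?expR_ge0// invr_ge0 ltW. Qed.

Lemma integral_normal_ratio m s : 0 < s ->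
  (\int[stdnormal]_x (normal_ratio m s x)%:E = 1)%E.
Proof.
move=> s0; rewrite integral_normal_prob.
- rewrite -[RHS](integral_normal_pdf m s); apply: eq_integral => x _.
  by rewrite -EFinM normal_ratioE.
- by apply/measurable_EFinP; apply: measurable_normal_ratio.
- by move=> x; rewrite lee_fin; apply: normal_ratio_ge0.
Qed.

Lemma L1_normal_ratio m s : 0 < s -> L1 stdnormal (normal_ratio m s).
Proof.
move=> s0; apply/integrableP; split.
  by apply/measurable_EFinP; apply: measurable_normal_ratio.
under eq_integral do rewrite /= ger0_norm ?normal_ratio_ge0//.
by rewrite integral_normal_ratio// ltry.
Qed.

Lemma Ex_normal_ratio m s : 0 < s -> Ex stdnormal (normal_ratio m s) = 1.
Proof. by move=> s0; rewrite /Ex /Rintegral integral_normal_ratio. Qed.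

(** For variance 2 the ratio is a multiple of [expR (x ^+ 2 / 4)], the square of
    [expR (x ^+ 2 / 8) >= 1 + x ^+ 2 / 8], so it dominates a polynomial of degree 4. The constant 33
    is merely sufficient. *)
Lemma stdnormal_cube_bound x : `|x| ^+ 3 <= 33 * Num.sqrt 2 * normal_ratio 0 (Num.sqrt 2) x.
Proof.
have s2 : 0 < Num.sqrt 2 :> R by rewrite sqrtr_gt0.
rewrite /normal_ratio subr0 sqr_sqrtr// -mulrA mulVKf ?gt_eqF//.
have -> : x ^+ 2 / 2 - x ^+ 2 / (2 * 2) = x ^+ 2 / 4 by field.
have y0 : 0 <= x ^+ 2 / 4 by rewrite divr_ge0 ?sqr_ge0.
have := expR_ge1Dx (x ^+ 2 / 8); have := expR_ge0 (x ^+ 2 / 8).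
have -> : x ^+ 2 / 4 = x ^+ 2 / 8 + x ^+ 2 / 8 by field.
rewrite expRD; set e := expR _ => e0 he.
have x2 : x ^+ 2 = `|x| ^+ 2 by rewrite real_normK ?num_real.
move: he; rewrite x2; have := normr_ge0 x; move: `|x| => y {}y0 he.
have he2 : (1 + y ^+ 2 / 8) ^+ 2 <= e * e.
  by rewrite -expr2 lerXn2r// ?nnegrE ?addr_ge0 ?divr_ge0 ?sqr_ge0.
apply: le_trans (_ : 33 * (1 + y ^+ 2 / 8) ^+ 2 <= _); last by rewrite ler_pM2l.
have := sqr_ge0 (y ^+ 2 - y); have := sqr_ge0 (y - 1); have := sqr_ge0 (y ^+ 2).
nra.
Qed.

Lemma L1_stdnormal_cube : L1 stdnormal (fun x => `|x| ^+ 3).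
Proof.
have s2 : 0 < Num.sqrt 2 :> R by rewrite sqrtr_gt0.
apply: (@L1_le _ _ _ stdnormal _ (fun x => 33 * Num.sqrt 2 * normal_ratio 0 (Num.sqrt 2) x)).
- by apply: measurable_funX => //; exact: measurableT_comp.
- by apply: L1Z; exact: L1_normal_ratio.
- by move=> x; rewrite ger0_norm ?exprn_ge0// stdnormal_cube_bound.
Qed.

Lemma L2_stdnormal : L2 stdnormal (fun x => x).
Proof.
split; first exact: measurable_id.
apply: (@L1_le _ _ _ stdnormal _ (fun x => 1 + `|x| ^+ 3)).
- exact: measurable_funX.
- by apply: L1D; [exact: L1_cst|exact: L1_stdnormal_cube].
- move=> x; rewrite normrX; have := normr_ge0 x; move: `|x| => y y0.
  have [y1|/ltW y1] := leP y 1; first by rewrite ler_wpDr ?exprn_ge0// exprn_ile1.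
  by rewrite ler_wpDl// ler_weXn2l.
Qed.

(* The pdf of N(m, s^2) has mass 1, i.e. E[normal_ratio m s] = 1; together with
   exp t >= 1 + t this pins down the first two moments as (m, s) -> (0, 1). *)
Lemma Ex_stdnormal_id : Ex stdnormal (fun x => x) = 0.
Proof.
have key m : m * Ex stdnormal (fun x => x) <= m ^+ 2 / 2.
  have i1 := L2_L1 L2_stdnormal.
  have aux x : m * x + (1 - m ^+ 2 / 2) <= normal_ratio m 1 x.
    rewrite /normal_ratio invr1 mul1r expr1n mulr1.
    have -> : m * x + (1 - m ^+ 2 / 2) = 1 + (x ^+ 2 / 2 - (x - m) ^+ 2 / 2) by field.
    exact: expR_ge1Dx.
  have : Ex stdnormal (fun x => m * x + (1 - m ^+ 2 / 2)) <= 1.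
    rewrite -[leRHS](@Ex_normal_ratio m 1)//; apply: Ex_le.
    - by apply: L1D; [exact: L1Z|exact: L1_cst].
    - exact: L1_normal_ratio.
    - exact: aux.
  rewrite ExD; [|exact: L1Z|exact: L1_cst].
  by rewrite ExZ// Ex_cst; lra.
apply/eqP; set e := Ex _ _ in key *.
(* With [m] equal to the mean itself, [e ^+ 2 <= e ^+ 2 / 2]. *)
have h1 := key e; have e2 := sqr_ge0 e.
rewrite -sqrf_eq0; apply/eqP; lra.
Qed.

Lemma Ex_stdnormal_sqr : Ex stdnormal (fun x => x ^+ 2) = 1.
Proof.
have [_ i2] := L2_stdnormal.
set c := Ex _ _.
have c0 : 0 <= c by apply: Ex_ge0 => x; rewrite sqr_ge0.
have key s : 0 < s -> (s ^+ 2 - 1) * c <= 2 * s ^+ 2 * (s - 1).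
  move=> s0.
  have aux x : s^-1 * ((1 - (s ^+ 2)^-1) / 2) * x ^+ 2 + s^-1 <= normal_ratio 0 s x.
    rewrite /normal_ratio subr0.
    have -> : s^-1 * ((1 - (s ^+ 2)^-1) / 2) * x ^+ 2 + s^-1 =
       s^-1 * (1 + (x ^+ 2 / 2 - x ^+ 2 / (2 * s ^+ 2))).
      by field; rewrite gt_eqF.
    by rewrite ler_pM2l ?invr_gt0// expR_ge1Dx.
  have : Ex stdnormal (fun x => s^-1 * ((1 - (s ^+ 2)^-1) / 2) * x ^+ 2 + s^-1) <= 1.
    rewrite -[leRHS](@Ex_normal_ratio 0 s)//; apply: Ex_le.
    - by apply: L1D; [exact: L1Z|exact: L1_cst].
    - exact: L1_normal_ratio.
    - exact: aux.
  rewrite ExD; [|exact: L1Z|exact: L1_cst].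
  rewrite ExZ// Ex_cst -/c => h.
  have : 2 * s ^+ 3 * (s^-1 * ((1 - (s ^+ 2)^-1) / 2) * c + s^-1) <= 2 * s ^+ 3 * 1.
    by rewrite ler_pM2l// mulr_gt0// exprn_gt0.
  have -> : 2 * s ^+ 3 * (s^-1 * ((1 - (s ^+ 2)^-1) / 2) * c + s^-1) =
    (s ^+ 2 - 1) * c + 2 * s ^+ 2 by field; rewrite gt_eqF.
  by rewrite expr2 exprS expr2; lra.
(* Dividing [key s] by [s - 1] bounds [c] from above for [s] slightly larger than 1 and from below
   for [s] slightly smaller; for a large tolerance [e], [s = 2] or [c >= 0] is enough. *)
apply/eqP; rewrite eq_le; apply/andP; split; apply/ler_addgt0Pr => e e0.
  have [e1|e1] := leP e 4.
    have d0 : 0 < e / 4 by lra.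
    have := key (1 + e / 4); move: d0; set d := e / 4 => d0 /(_ ltac:(lra)).
    have -> : 2 * (1 + d) ^+ 2 * (1 + d - 1) = d * (2 * (1 + d) ^+ 2) by ring.
    have -> : ((1 + d) ^+ 2 - 1) * c = d * ((2 + d) * c) by ring.
    rewrite ler_pM2l// => h; have d1 : d <= 1 by rewrite /d; lra.
    have -> : e = 4 * d by rewrite /d; lra.
    by nra.
  have := key 2 ltac:(lra); lra.
have [e1|e1] := leP e 1; last by lra.
have := key (1 - e / 2); have : 0 < e / 2 by lra.
have de : e = 2 * (e / 2) by lra.
rewrite [in X in _ -> _ -> X]de; set d := e / 2 => d0 /(_ ltac:(rewrite /d; lra)).
have -> : 2 * (1 - d) ^+ 2 * (1 - d - 1) = d * - (2 * (1 - d) ^+ 2) by ring.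
have -> : ((1 - d) ^+ 2 - 1) * c = d * - ((2 - d) * c) by ring.
rewrite ler_pM2l// lerN2 => h; have d1 : d <= 1 / 2 by rewrite /d; lra.
by nra.
Qed.

End normal_moments.

(** * Convolution of normal laws *)

Section normal_convolution.
Context {R : realType}.
Notation mu := (@lebesgue_measure R).
Implicit Types (m s a b x : R) (h : R -> R).

Lemma normal_affine m a h : 0 < a -> continuous h -> (forall x, 0 <= h x) ->
  (\int[@stdnormal R]_z (h (a * z + m))%:E = \int[mu]_y (h y * normal_pdf m a y)%:E)%E.
Proof.
move=> a0 ch h0.
pose F : R^o -> R^o := fun z => a * z + m.
have dF : (F^`())%classic = cst a.
  apply/funext => z; rewrite /F derive1E deriveD// deriveM// derive_cst derive_id.
  by rewrite derive_cst scaler0 addr0 /= /GRing.scale/= mulr1 addr0.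
have cF : continuous F by move=> z; apply: differentiable_continuous; apply/derivable1_diffP.
have cpdf : continuous (normal_pdf m a) by apply: continuous_normal_pdf; rewrite gt_eqF.
rewrite (@increasing_ge0_integration_by_substitutionT _ F).
- rewrite integral_normal_prob.
  + apply: eq_integral => z _; rewrite dF -EFinM /= !fctE/=; congr EFin.
    rewrite /F -mulrA; congr (_ * _).
    rewrite !normal_pdfS// invr1 mul1r [RHS]mulrC mulVKf ?gt_eqF//.
    by congr (_ * expR _); field; rewrite gt_eqF.
  + apply/measurable_EFinP; apply: continuous_measurable_fun => z.
    by apply: (continuous_comp (cF z)); exact: ch.
  + by move=> z; rewrite lee_fin.
- by move=> x y xy; rewrite /F ltrD2r ltr_pM2l.
- by rewrite dF => x; exact: cvg_cst.
- by rewrite dF; exact: is_cvg_cst.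
- by rewrite dF; exact: is_cvg_cst.
- by move=> x; rewrite /F.
- apply: cvg_comp (cvg_addrr_Ny m).
  exact: (gt0_cvgMrNy a0 cvg_id).
- apply: cvg_comp (cvg_addrr m).
  exact: (gt0_cvgMry a0 cvg_id).
- by move=> x; apply: cvgM; [exact: ch|exact: cpdf].
- by move=> x; rewrite mulr_ge0// normal_pdf_ge0.
Qed.

(* completing the square in [w] *)
Lemma normal_pdf_mul a b (c := Num.sqrt (a ^+ 2 + b ^+ 2)) (y w : R) : 0 < a ->
  normal_pdf (b * w) a y * normal_pdf 0 1 w =
  normal_pdf 0 c y * normal_pdf (b * y / c ^+ 2) (a / c) w.
Proof.
move=> a0; have c20 : 0 < a ^+ 2 + b ^+ 2 by have := exprn_gt0 2 a0; have := sqr_ge0 b; lra.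
have c0 : 0 < c by rewrite sqrtr_gt0.
have c2 : c ^+ 2 = a ^+ 2 + b ^+ 2 by rewrite sqr_sqrtr ?ltW.
rewrite !normal_pdfS ?divr_gt0//.
set k := (Num.sqrt _)^-1.
rewrite mulrACA [RHS]mulrACA; congr (_ * _); first by field; rewrite !gt_eqF.
rewrite mulrACA [RHS]mulrACA; congr (_ * _).
rewrite -!expRD; congr expR; rewrite expr_div_n c2.
by field; rewrite !gt_eqF.
Qed.

Lemma measurable_normal_pdf_mul a b h : 0 < a -> continuous h ->
  measurable_fun setT (fun p : measurableTypeR R * measurableTypeR R =>
    (h p.2 * (normal_pdf (b * p.1) a p.2 * normal_pdf 0 1 p.1))%:E).
Proof.
move=> a0 ch; apply/measurable_EFinP; apply: measurable_funM.
  by apply: measurableT_comp; [exact: continuous_measurable_fun|exact: measurable_snd].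
apply: measurable_funM; last first.
  by apply: measurableT_comp; [exact: measurable_normal_pdf|exact: measurable_fst].
under eq_fun do rewrite normal_pdfS//.
do 2 (apply: measurable_funM => //); apply: measurableT_comp => //.
apply: measurable_funM => //; apply: measurableT_comp => //.
apply: measurable_funX; apply: measurable_funB; first exact: measurable_snd.
by apply: measurable_funM => //; exact: measurable_fst.
Qed.

(** After the substitution [y = a z + b w], Tonelli puts the integral over [w] inside. Completing
    the square leaves there a normal density in [w], of mass 1, times the density of N(0, a^2 + b^2)
    at [y]. *)
Lemma normal_convolution a b h : 0 < a -> continuous h -> (forall x, 0 <= h x) ->
  (\int[@stdnormal R]_w \int[@stdnormal R]_z (h (a * z + b * w))%:E =
   \int[@stdnormal R]_z (h (Num.sqrt (a ^+ 2 + b ^+ 2) * z))%:E)%E.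
Proof.
move=> a0 ch h0; set c := Num.sqrt _.
have c20 : 0 < a ^+ 2 + b ^+ 2 by have := exprn_gt0 2 a0; have := sqr_ge0 b; lra.
have c0 : 0 < c by rewrite sqrtr_gt0.
have mf := measurable_normal_pdf_mul b a0 ch.
have f0 p : (0 <= (h p.2 * (normal_pdf (b * p.1) a p.2 * normal_pdf 0 1 p.1))%:E)%E.
  by rewrite lee_fin !mulr_ge0// normal_pdf_ge0.
under eq_integral do rewrite normal_affine//.
have mhp m s : measurable_fun setT (fun y : measurableTypeR R => (h y * normal_pdf m s y)%:E).
  apply/measurable_EFinP; apply: measurable_funM; first exact: continuous_measurable_fun.
  exact: measurable_normal_pdf.
have mpdf m s : measurable_fun setT (fun y : measurableTypeR R => (normal_pdf m s y)%:E).
  by apply/measurable_EFinP; exact: measurable_normal_pdf.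
have inner w : (\int[mu]_y (h y * normal_pdf (b * w) a y)%:E * (normal_pdf 0 1 w)%:E =
    \int[mu]_y (h y * (normal_pdf (b * w) a y * normal_pdf 0 1 w))%:E)%E.
  rewrite -ge0_integralZr//.
  - by apply: eq_integral => y _; rewrite -EFinM mulrA.
  - by move=> y _; rewrite lee_fin mulr_ge0// normal_pdf_ge0.
  - by rewrite lee_fin normal_pdf_ge0.
rewrite integral_normal_prob; last 2 first.
- have mF := @measurable_fun_fubini_tonelli_F _ _ _ _ R mu
    (fun p : measurableTypeR R * measurableTypeR R => (h p.2 * normal_pdf (b * p.1) a p.2)%:E).
  apply: mF => [|p]; last by rewrite lee_fin mulr_ge0// normal_pdf_ge0.
  apply/measurable_EFinP; apply: measurable_funM.
    by apply: measurableT_comp; [exact: continuous_measurable_fun|exact: measurable_snd].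
  under eq_fun do rewrite normal_pdfS//.
  do 2 (apply: measurable_funM => //); apply: measurableT_comp => //.
  apply: measurable_funM => //; apply: measurableT_comp => //.
  apply: measurable_funX; apply: measurable_funB; first exact: measurable_snd.
  by apply: measurable_funM => //; exact: measurable_fst.
- by move=> w; apply: integral_ge0 => y _; rewrite lee_fin mulr_ge0// normal_pdf_ge0.
under eq_integral do rewrite inner.
have FT := @fubini_tonelli _ _ _ _ R mu mu _ mf f0.
rewrite [LHS]FT.
under [RHS]eq_integral do rewrite -[X in h X]addr0.
rewrite [RHS](normal_affine 0 c0 ch h0); apply: eq_integral => y _.
transitivity (\int[mu]_w ((h y * normal_pdf 0 c y)%:E * (normal_pdf (b * y / c ^+ 2) (a / c) w)%:E))%E.
  apply: eq_integral => w _; rewrite -EFinM -[in RHS](mulrA (h y)); congr EFin.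
  by apply: (congr1 (fun r => h y * r)); exact: normal_pdf_mul.
rewrite ge0_integralZl.
- by rewrite (integral_normal_pdf (b * y / c ^+ 2) (a / c)) mule1.
- exact: measurableT.
- apply: mpdf.
- by move=> w _; rewrite lee_fin normal_pdf_ge0.
- by rewrite lee_fin; apply: mulr_ge0; [exact: h0|exact: normal_pdf_ge0].
Qed.

End normal_convolution.

(** * The heat semigroup *)

Section heat_semigroup.
Context {R : realType}.
Implicit Types (s t B M x y : R) (h : R -> R).

(** The parameter [t] is a variance, so that parameters add under composition. *)
Definition heat t h x : R := Ex (@stdnormal R) (fun z => h (x + Num.sqrt t * z)).

Lemma measurable_heat_arg t x : measurable_fun setT (fun z : measurableTypeR R => x + Num.sqrt t * z).
Proof. by apply: measurable_funD => //; exact: measurable_funM. Qed.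

Lemma L1_heat t h x M : measurable_fun setT h -> (forall y, `|h y| <= M) ->
  L1 (@stdnormal R) (fun z => h (x + Num.sqrt t * z)).
Proof.
move=> mh hM; apply: (@L1_bounded _ _ _ _ _ M) => //.
by apply: measurableT_comp => //; exact: measurable_heat_arg.
Qed.

Lemma heat0 h : heat 0 h = h.
Proof.
apply/funext => x; rewrite /heat sqrtr0.
by under [X in Ex _ X]eq_fun do rewrite mul0r addr0; rewrite Ex_cst.
Qed.

Lemma heat_bounded t h M : measurable_fun setT h -> (forall y, `|h y| <= M) ->
  forall x, `|heat t h x| <= M.
Proof.
move=> mh hM x; rewrite (le_trans (Ex_abs (L1_heat t x mh hM)))//.
rewrite -[leRHS](Ex_cst (@stdnormal R)); apply: Ex_le => //.
- by apply: L1_abs; exact: L1_heat hM.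
- exact: L1_cst.
Qed.

(** Tonelli covers nonnegative integrands; the general case is the difference of the positive and
    negative parts, both integrable for every [x]. *)
Lemma measurable_Ex_param (f : measurableTypeR R * measurableTypeR R -> R) :
  measurable_fun setT f -> (forall x, L1 (@stdnormal R) (fun z => f (x, z))) ->
  measurable_fun setT (fun x : R => Ex (@stdnormal R) (fun z => f (x, z))).
Proof.
move=> mf iF.
have pos (g : measurableTypeR R * measurableTypeR R -> R) : measurable_fun setT g ->
    measurable_fun setT (fun x : R => Ex (@stdnormal R) (fun z => Num.max (g (x, z)) 0)).
  move=> mg.
  have mF := @measurable_fun_fubini_tonelli_F _ _ _ _ R (@stdnormal R)
    (fun p => (Num.max (g p) 0)%:E).
  apply: (measurableT_comp _ (mF _ _)); first exact: fine_measurable.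
  - by apply/measurable_EFinP; apply: measurable_maxr.
  - by move=> p; rewrite lee_fin le_max lexx orbT.
have iM (g : measurableTypeR R -> R) : L1 (@stdnormal R) g -> L1 (@stdnormal R) (fun z => Num.max (g z) 0).
  move=> ig; apply: (@L1_le _ _ _ (@stdnormal R) _ (fun z => `|g z|)).
  - by apply: measurable_maxr => //; exact: L1_measurable ig.
  - exact: L1_abs.
  - by move=> z; have [g0|g0] := leP (g z) 0; rewrite ?normr0.
have -> : (fun x => Ex (@stdnormal R) (fun z => f (x, z))) =
    (fun x => Ex (@stdnormal R) (fun z => Num.max (f (x, z)) 0) -
              Ex (@stdnormal R) (fun z => Num.max (- f (x, z)) 0)).
  apply/funext => x; rewrite -ExB; [|exact: iM|apply: iM].
    congr Ex; apply/funext => z.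
    by have [f0|f0] := leP (f (x, z)) 0; have [f1|f1] := leP (- f (x, z)) 0; lra.
  have := L1Z (-1) (iF x); congr (L1 _ _).
  by apply/funext => z; rewrite mulN1r.
apply: measurable_funB; first exact: pos.
by apply: (pos (fun p => - f p)); exact: measurableT_comp.
Qed.

Lemma measurable_heat t h M : measurable_fun setT h -> (forall y, `|h y| <= M) ->
  measurable_fun setT (heat t h).
Proof.
move=> mh hM.
apply: (@measurable_Ex_param (fun p => h (p.1 + Num.sqrt t * p.2))); last first.
  by move=> x; exact: L1_heat hM.
apply: measurableT_comp => //; apply: measurable_funD; first exact: measurable_fst.
by apply: measurable_funM => //; exact: measurable_snd.
Qed.

(** Convolution of N(0, s) with N(0, t). Adding the bound [M] makes the integrand nonnegative, as
    the convolution formula requires, and the constant cancels at the end. The case [t = 0] is apart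
    because that formula needs a positive deviation. *)
Lemma heat_semigroup s t h M : 0 <= s -> 0 <= t -> continuous h ->
  (forall y, `|h y| <= M) -> heat s (heat t h) = heat (s + t) h.
Proof.
move=> s0; rewrite le_eqVlt => /predU1P[<- _ _|t0 ch hM]; first by rewrite heat0 addr0.
have mh : measurable_fun setT h by exact: continuous_measurable_fun.
apply/funext => x.
pose g y := h (x + y) + M.
have g0 y : 0 <= g y by have := hM (x + y); rewrite /g ler_norml; lra.
have cg : continuous g.
  move=> y; apply: cvgD; last exact: cvg_cst.
  apply: continuous_comp; last exact: ch.
  by apply: cvgD; [exact: cvg_cst|exact: cvg_id].
have st0 : 0 < Num.sqrt t by rewrite sqrtr_gt0.
have := normal_convolution (Num.sqrt s) st0 cg g0.
rewrite !sqr_sqrtr ?(ltW t0)// addrC.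
have -> : (fun w => (\int[@stdnormal R]_z (g (Num.sqrt t * z + Num.sqrt s * w))%:E)%E) =
    (fun w => (heat t h (x + Num.sqrt s * w) + M)%:E).
  apply/funext => w.
  have iH := L1_heat t (x + Num.sqrt s * w) mh hM.
  have -> : (fun z => (g (Num.sqrt t * z + Num.sqrt s * w))%:E) =
      (fun z => (h ((x + Num.sqrt s * w) + Num.sqrt t * z) + M)%:E).
    by apply/funext => z; rewrite /g; congr ((h _ + _)%:E); ring.
  rewrite (@EFin_Ex _ _ _ (@stdnormal R) (fun z => h (x + Num.sqrt s * w + Num.sqrt t * z) + M)).
    by rewrite ExD ?Ex_cst//; exact: L1_cst.
  by apply: L1D => //; exact: L1_cst.
have iH := L1_heat s x (measurable_heat t mh hM) (heat_bounded t mh hM).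
rewrite (@EFin_Ex _ _ _ (@stdnormal R) (fun w => heat t h (x + Num.sqrt s * w) + M)); last first.
  by apply: L1D => //; exact: L1_cst.
have iH2 := L1_heat (s + t) x mh hM.
rewrite (@EFin_Ex _ _ _ (@stdnormal R) (fun z => h (x + Num.sqrt (s + t) * z) + M)); last first.
  by apply: L1D => //; exact: L1_cst.
move=> [].
rewrite ExD//; last exact: L1_cst.
rewrite ExD//; last exact: L1_cst.
by move/addIr.
Qed.

(* Bounded functions with a uniform second-order Taylor expansion; unlike C^3_b
   this class is closed under [heat] without differentiating under the integral. *)
Definition taylor2 B h := exists h1 h2 : R -> R,
  [/\ measurable_fun setT h1, measurable_fun setT h2,
      (forall x, [/\ `|h x| <= B, `|h1 x| <= B & `|h2 x| <= B]) &
      forall x y, `|h (x + y) - h x - h1 x * y - h2 x * (y ^+ 2 / 2)| <=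
        B * Num.min (y ^+ 2) (`|y| ^+ 3)].

Lemma taylor2_bounded B h : taylor2 B h -> forall x, `|h x| <= B.
Proof. by move=> [h1 [h2 [_ _ hB _]]] x; have [] := hB x. Qed.

Lemma taylor2_ge0 B h : taylor2 B h -> 0 <= B.
Proof. by move=> /taylor2_bounded/(_ 0); apply: le_trans. Qed.

Lemma taylor2_lip B h : taylor2 B h -> forall x y, `|y| <= 1 -> `|h (x + y) - h x| <= 3 * B * `|y|.
Proof.
move=> tB; have B0 := taylor2_ge0 tB; case: tB => h1 [h2 [_ _ hB hT]] x y y1.
have -> : h (x + y) - h x = (h (x + y) - h x - h1 x * y - h2 x * (y ^+ 2 / 2)) +
   (h1 x * y + h2 x * (y ^+ 2 / 2)) by ring.
apply: le_trans (ler_normD _ _) _.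
have [_ b1 b2] := hB x.
have y2 : `|y ^+ 2| <= `|y| by rewrite normrX expr2 ler_piMr.
have t1 : `|h1 x * y + h2 x * (y ^+ 2 / 2)| <= B * `|y| + B * `|y|.
  apply: le_trans (ler_normD _ _) _; rewrite (normrM (h1 x)) (normrM (h2 x)).
  apply: lerD; first exact: ler_wpM2r.
  apply: ler_pM => //; rewrite normrM [ `|2^-1|]ger0_norm ?invr_ge0//.
  by move: y2; have := normr_ge0 (y ^+ 2); lra.
have t2 : B * Num.min (y ^+ 2) (`|y| ^+ 3) <= B * `|y|.
  by rewrite ler_wpM2l// ge_min -[y ^+ 2]ger0_norm ?sqr_ge0// y2.
apply: le_trans (lerD (hT x y) t1) _; apply: le_trans (lerD t2 (lexx _)) _.
by rewrite le_eqVlt; apply/orP; left; apply/eqP; ring.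
Qed.

Lemma taylor2_continuous B h : taylor2 B h -> continuous h.
Proof.
move=> tB x; have B0 := taylor2_ge0 tB.
apply/cvgrPdist_le => e e0; near=> z.
have -> : h z = h (x + (z - x)) by rewrite subrKC.
have : `|z - x| <= Num.min 1 (e / (3 * B + 1)).
  rewrite distrC; near: z; apply: (@cvgr_dist_le _ R^o _ (nbhs x) _ id x); first exact: cvg_id.
  by rewrite lt_min ltr01 divr_gt0//; lra.
rewrite le_min => /andP[d1 d2]; rewrite distrC.
apply: le_trans (taylor2_lip tB _ d1) _.
apply: le_trans (_ : (3 * B + 1) * `|z - x| <= _); first by have := normr_ge0 (z - x); lra.
by rewrite mulrC -ler_pdivlMr//; lra.
Unshelve. all: by end_near. Qed.

Lemma taylor2_measurable B h : taylor2 B h -> measurable_fun setT h.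
Proof. by move=> /taylor2_continuous; exact: continuous_measurable_fun. Qed.

(** Averaging the expansion of [h] over translated base points expands [heat t h], with coefficients
    [heat t h1] and [heat t h2]. The remainder bound is uniform in the base point, so [B] does not
    change and the step can be iterated in [lindeberg_sum]. *)
Lemma taylor2_heat B h t : taylor2 B h -> taylor2 B (heat t h).
Proof.
move=> tB; have mh := taylor2_measurable tB.
case: tB => h1 [h2 [m1 m2 hB hT]]; exists (heat t h1), (heat t h2).
have b0 x : `|h x| <= B by have [] := hB x.
have b1 x : `|h1 x| <= B by have [] := hB x.
have b2 x : `|h2 x| <= B by have [] := hB x.
split.
- exact: measurable_heat b1.
- exact: measurable_heat b2.
- by move=> x; split; apply: heat_bounded.
- move=> x y.
  have i0 z := L1_heat t z mh b0.
  have i1 z := L1_heat t z m1 b1.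
  have i2 z := L1_heat t z m2 b2.
  pose g z := h (x + y + Num.sqrt t * z) - h (x + Num.sqrt t * z) -
    y * h1 (x + Num.sqrt t * z) - y ^+ 2 / 2 * h2 (x + Num.sqrt t * z).
  have ig : L1 (@stdnormal R) g.
    by apply: L1B; [apply: L1B; [exact: L1B|exact: L1Z]|exact: L1Z].
  have -> : heat t h (x + y) - heat t h x - heat t h1 x * y - heat t h2 x * (y ^+ 2 / 2) =
      Ex (@stdnormal R) g.
    rewrite /g ExB; [|by apply: L1B; [exact: L1B|exact: L1Z]|exact: L1Z].
    rewrite ExB; [|exact: L1B|exact: L1Z].
    by rewrite ExB// !ExZ// [heat t h1 x * y]mulrC [heat t h2 x * _]mulrC.
  rewrite (le_trans (Ex_abs ig))// -[leRHS](Ex_cst (@stdnormal R)); apply: Ex_le.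
  - exact: L1_abs.
  - exact: L1_cst.
  - move=> z; rewrite /g; apply: le_trans (hT (x + Num.sqrt t * z) y).
    by rewrite (addrAC x y) (mulrC y) (mulrC (y ^+ 2 / 2)).
Qed.

Definition kappa3 : R := Ex (@stdnormal R) (fun z => `|z| ^+ 3).

Lemma kappa3_ge0 : 0 <= kappa3.
Proof. by apply: Ex_ge0 => z; rewrite exprn_ge0. Qed.

(** The linear term has mean 0, the quadratic one mean [h2 x * (t / 2)], and the remainder is cubic
    in [Num.sqrt t * z]. *)
Lemma heat_taylor B h h1 h2 t : measurable_fun setT h -> (forall x, `|h x| <= B) -> 0 <= t ->
  (forall x y, `|h (x + y) - h x - h1 x * y - h2 x * (y ^+ 2 / 2)| <=
        B * Num.min (y ^+ 2) (`|y| ^+ 3)) ->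
  forall x, `|heat t h x - h x - h2 x * (t / 2)| <= B * (t * Num.sqrt t * kappa3).
Proof.
move=> mh hB t0 hT x; have B0 : 0 <= B by apply: le_trans (hB 0).
have i0 := L1_heat t x mh hB.
have [_ iz2] := @L2_stdnormal R; have iz := L2_L1 (@L2_stdnormal R).
have iz3 := @L1_stdnormal_cube R.
set st := Num.sqrt t; have st2 : st ^+ 2 = t by rewrite sqr_sqrtr.
have aux z : `|h (x + st * z) - h x - h1 x * st * z - h2 x * (t / 2) * z ^+ 2| <=
    B * (t * st * `|z| ^+ 3).
  have -> : h2 x * (t / 2) * z ^+ 2 = h2 x * ((st * z) ^+ 2 / 2).
    by rewrite exprMn st2; field.
  rewrite -[h1 x * st * z]mulrA; apply: le_trans (hT x (st * z)) _.
  rewrite ler_wpM2l// ge_min; apply/orP; right.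
  by rewrite normrM exprMn (ger0_norm (sqrtr_ge0 _)) -/st -st2 -exprSr.
have -> : heat t h x - h x - h2 x * (t / 2) =
   Ex (@stdnormal R) (fun z => (h (x + st * z) - h x - h1 x * st * z - h2 x * (t / 2) * z ^+ 2)).
  rewrite ExB; [|by apply: L1B; [apply: L1B => //; exact: L1_cst|exact: L1Z]|exact: L1Z].
  rewrite ExB; [|by apply: L1B => //; exact: L1_cst|exact: L1Z].
  rewrite ExB//; last exact: L1_cst.
  by rewrite Ex_cst !ExZ// Ex_stdnormal_id Ex_stdnormal_sqr mulr0 subr0 mulr1.
have iT : L1 (@stdnormal R) (fun z => (h (x + st * z) - h x - h1 x * st * z - h2 x * (t / 2) * z ^+ 2)).
  by apply: L1B; [apply: L1B; [apply: L1B => //; exact: L1_cst|exact: L1Z]|exact: L1Z].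
rewrite (le_trans (Ex_abs iT))// -ExZ// -ExZ; last exact: L1Z.
apply: Ex_le; [exact: L1_abs|by do 2 apply: L1Z|exact: aux].
Qed.

(** By the semigroup law the increment is one from time 0 for [heat s h], which lies in the same
    class; [t <= 1] absorbs [t * Num.sqrt t] into [t]. *)
Lemma heat_lip B h s t : taylor2 B h -> 0 <= s -> 0 <= t -> t <= 1 ->
  forall x, `|heat (s + t) h x - heat s h x| <= B * (1 + kappa3) * t.
Proof.
move=> tB s0 t0 t1 x; have B0 := taylor2_ge0 tB.
have hB := taylor2_bounded tB.
rewrite (addrC s) -(heat_semigroup _ _ (taylor2_continuous tB) hB)//.
move: (heat s h) (taylor2_heat s tB) => {hB} g tg.
have mg := taylor2_measurable tg; have gB := taylor2_bounded tg.
case: tg => g1 [g2 [_ _ bs gT]].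
have hx := heat_taylor mg gB t0 gT x; have [_ _ b2] := bs x.
have -> : heat t g x - g x = (heat t g x - g x - g2 x * (t / 2)) + g2 x * (t / 2) by ring.
apply: le_trans (ler_normD _ _) _.
have : `|g2 x * (t / 2)| <= B * t.
  rewrite normrM [ `|t / 2|]ger0_norm ?divr_ge0//.
  by apply: ler_pM => //; [rewrite divr_ge0|lra].
have : B * (t * Num.sqrt t * kappa3) <= B * (t * 1 * kappa3).
  rewrite ler_wpM2l// ler_wpM2r ?kappa3_ge0// ler_wpM2l//.
  by rewrite -sqrtr1 ler_wsqrtr.
move=> k1 k2; apply: le_trans (lerD (le_trans hx k1) k2) _.
by rewrite le_eqVlt; apply/orP; left; apply/eqP; ring.
Qed.

End heat_semigroup.

Lemma cvg_invn (R : realType) : (n%:R^-1 : R) @[n --> \oo] --> 0.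
Proof.
apply/gtr0_cvgV0; last exact: cvgr_idn.
by near=> n; rewrite ltr0n; near: n; exists 1%N.
Unshelve. all: by end_near. Qed.

Lemma cvg_invsqrtn (R : realType) : ((Num.sqrt n%:R)^-1 : R) @[n --> \oo] --> 0.
Proof.
have -> : (fun n => (Num.sqrt n%:R)^-1 : R) = (fun n => Num.sqrt (n%:R^-1)).
  by apply/funext => n; rewrite sqrtrV.
rewrite -(sqrtr0 R).
exact: (cvg_comp _ _ (@cvg_invn R) (@sqrt_continuous R 0)).
Qed.

(** * Lindeberg replacement *)

Section lindeberg.
Context {R : realType} {dT} {T : measurableType dT} (P : probability T R).
Implicit Types (U Y : T -> R) (B v e : R) (h : R -> R).

(** The shape of the Taylor remainder in [taylor2]: the cubic bound makes the replacement errors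
    vanish, the quadratic one keeps them integrable under a second moment. *)
Definition trunc3 (y : R) : R := Num.min (y ^+ 2) (`|y| ^+ 3).

Lemma trunc3_ge0 y : 0 <= trunc3 y.
Proof. by rewrite le_min sqr_ge0 exprn_ge0. Qed.

Lemma measurable_trunc3 : measurable_fun setT trunc3.
Proof.
apply: measurable_minr; first exact: measurable_funX.
by apply: measurable_funX; apply: measurableT_comp => //; exact: normr_measurable.
Qed.

Lemma L1_trunc3 Y : L2 P Y -> L1 P (fun w => trunc3 (Y w)).
Proof.
move=> [mY iY]; apply: (@L1_le _ _ _ _ _ (fun w => Y w ^+ 2)) => //.
  by apply: measurableT_comp => //; exact: measurable_trunc3.
by move=> w; rewrite ger0_norm ?trunc3_ge0// ge_min lexx.
Qed.

Lemma L1_comp_mul (f : R -> R) M U Y : measurable_fun setT f -> (forall x, `|f x| <= M) ->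
  measurable_fun setT U -> L1 P Y -> L1 P (fun w => f (U w) * Y w).
Proof.
move=> mf fM mU iY; apply: (@L1_le _ _ _ _ _ (fun w => M * `|Y w|)).
- by apply: measurable_funM; [exact: measurableT_comp|exact: L1_measurable iY].
- by apply: L1Z; exact: L1_abs.
- by move=> w; rewrite normrM ler_wpM2r.
Qed.

(** Both expectations are compared with that of [h (U w)]: the linear term in [Y] vanishes and the
    quadratic terms agree. Independence of [U] and [Y] enters only through the two identities for
    bounded [f], applied to the Taylor coefficients [h1] and [h2]. *)
Lemma lindeberg_step U Y h B v e : measurable_fun setT U -> L2 P Y -> 0 <= v ->
  taylor2 B h ->
  (forall (f : R -> R) M, measurable_fun setT f -> (forall x, `|f x| <= M) ->
    Ex P (fun w => f (U w) * Y w) = 0 /\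
    Ex P (fun w => f (U w) * Y w ^+ 2) = v * Ex P (fun w => f (U w))) ->
  Ex P (fun w => trunc3 (Y w)) <= e ->
  `|Ex P (fun w => h (U w + Y w)) - Ex P (fun w => heat v h (U w))| <=
    B * (e + v * Num.sqrt v * kappa3).
Proof.
move=> mU iY v0 tB orth he; have B0 := taylor2_ge0 tB.
have mh := taylor2_measurable tB; have hB := taylor2_bounded tB.
have mHv := measurable_heat v mh hB; have HvB := heat_bounded v mh hB.
have [mY iY2] := iY.
case: tB => h1 [h2 [m1 m2 bs hT]].
have b1 x : `|h1 x| <= B by have [] := bs x.
have b2 x : `|h2 x| <= B by have [] := bs x.
have [c1 _] := orth _ _ m1 b1; have [_ c2] := orth _ _ m2 b2.
have i0 : L1 P (fun w => h (U w + Y w)).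
  apply: (@L1_bounded _ _ _ _ _ B) => //.
  by apply: measurableT_comp => //; exact: measurable_funD.
have comp (f : R -> R) : measurable_fun setT f -> (forall x, `|f x| <= B) -> L1 P (fun w => f (U w)).
  move=> mf fB; apply: (@L1_bounded _ _ _ _ _ B) => //; exact: measurableT_comp.
have ih := comp _ mh hB; have ih2 := comp _ m2 b2; have iHv := comp _ mHv HvB.
have i1 : L1 P (fun w => h1 (U w) * Y w) by apply: L1_comp_mul b1 _ _ => //; exact: L2_L1.
have i2 : L1 P (fun w => h2 (U w) * Y w ^+ 2) by apply: L1_comp_mul b2 _ _.
pose g1 w := h (U w + Y w) - h (U w) - h1 (U w) * Y w - 2^-1 * (h2 (U w) * Y w ^+ 2).
pose g2 w := heat v h (U w) - h (U w) - v / 2 * h2 (U w).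
have ig1 : L1 P g1 by exact: (L1B (L1B (L1B i0 ih) i1) (L1Z 2^-1 i2)).
have ig2 : L1 P g2 by exact: (L1B (L1B iHv ih) (L1Z (v / 2) ih2)).
have e1 : Ex P g1 = Ex P (fun w => h (U w + Y w)) - Ex P (fun w => h (U w)) -
    2^-1 * (v * Ex P (fun w => h2 (U w))).
  have j1 := L1B i0 ih; have j2 := L1B j1 i1.
  by rewrite (ExB j2 (L1Z 2^-1 i2)) (ExB j1 i1) (ExB i0 ih) (ExZ _ i2) c1 c2 subr0.
have e2 : Ex P g2 = Ex P (fun w => heat v h (U w)) - Ex P (fun w => h (U w)) -
    v / 2 * Ex P (fun w => h2 (U w)).
  have j1 := L1B iHv ih.
  by rewrite (ExB j1 (L1Z (v / 2) ih2)) (ExB iHv ih) (ExZ _ ih2).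
have -> : Ex P (fun w => h (U w + Y w)) - Ex P (fun w => heat v h (U w)) = Ex P g1 - Ex P g2.
  by rewrite e1 e2; field.
apply: le_trans (ler_normB _ _) _.
rewrite mulrDr; apply: lerD.
  apply: le_trans (Ex_abs ig1) _.
  apply: le_trans (_ : B * Ex P (fun w => trunc3 (Y w)) <= _); last by rewrite ler_wpM2l.
  rewrite -ExZ; last exact: L1_trunc3.
  apply: Ex_le; [exact: L1_abs|by apply: L1Z; exact: L1_trunc3|move=> w].
  by rewrite /g1 mulrCA [2^-1 * _]mulrC; exact: hT.
apply: le_trans (Ex_abs ig2) _.
rewrite -[leRHS](Ex_cst P); apply: Ex_le; [exact: L1_abs|exact: L1_cst|move=> w].
by rewrite /g2 [v / 2 * _]mulrC; exact: heat_taylor.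
Qed.

(** The last summand is replaced first. What remains is a sum of [k] terms tested against
    [heat v h], which has the same constant [B]; the Gaussian parts accumulate by the semigroup
    law. *)
Lemma lindeberg_sum (Y : nat -> T -> R) v e h B k : 0 <= v -> taylor2 B h ->
  (forall j, L2 P (Y j)) ->
  (forall j (f : R -> R) M, measurable_fun setT f -> (forall x, `|f x| <= M) ->
    Ex P (fun w => f (\sum_(i < j) Y i w) * Y j w) = 0 /\
    Ex P (fun w => f (\sum_(i < j) Y i w) * Y j w ^+ 2) = v * Ex P (fun w => f (\sum_(i < j) Y i w))) ->
  (forall j, Ex P (fun w => trunc3 (Y j w)) <= e) ->
  `|Ex P (fun w => h (\sum_(i < k) Y i w)) - heat (k%:R * v) h 0| <=
    k%:R * (B * (e + v * Num.sqrt v * kappa3)).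
Proof.
move=> v0 + iY orth he; elim: k h => [|k IH] h tB.
  rewrite !mul0r heat0; under [X in Ex P X]eq_fun do rewrite big_ord0.
  by rewrite Ex_cst subrr normr0.
have hB := taylor2_bounded tB.
have mU : measurable_fun setT (fun w => \sum_(i < k) Y i w).
  by have [] := @L2_sum _ _ _ P k _ iY.
have s1 := lindeberg_step mU (iY k) v0 tB (orth k) (he k).
have s2 := IH _ (taylor2_heat v tB).
rewrite (heat_semigroup (mulr_ge0 (ler0n _ k) v0) v0 (taylor2_continuous tB) hB) in s2.
under [X in Ex P X]eq_fun do rewrite big_ord_recr.
rewrite -(natr1 k) !mulrDl !mul1r.
have := ler_normD (Ex P (fun w => h (\sum_(i < k) Y i w + Y k w)) -
    Ex P (fun w => heat v h (\sum_(i < k) Y i w)))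
  (Ex P (fun w => heat v h (\sum_(i < k) Y i w)) - heat (k%:R * v + v) h 0).
rewrite addrA subrK => /le_trans; apply; rewrite [leRHS]addrC; exact: lerD.
Qed.

Lemma cvg_Ex_dominated (X : nat -> T -> R) (Z : T -> R) :
  (forall n, measurable_fun setT (X n)) -> L1 P Z -> (forall n w, `|X n w| <= Z w) ->
  {ae P, forall w, X ^~ w @ \oo --> (0 : R)} -> (fun n => Ex P (X n)) @ \oo --> (0 : R).
Proof.
move=> mX iZ XZ X0.
have [] := @dominated_convergence _ _ _ P setT measurableT (fun n w => (X n w)%:E)
  (fun=> 0%E) (fun w => (Z w)%:E).
- by move=> n; exact/measurable_EFinP.
- exact: measurable_cst.
- apply: filterS X0 => w X0 _; apply/fine_cvgP; split; [exact: nearW|exact: X0].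
- exact: iZ.
- by apply: aeW => w n _ /=; rewrite lee_fin.
move=> _ _; rewrite integral0 => /fine_cvgP[_]; exact.
Qed.

(** This plays the role of Lindeberg's condition for equidistributed summands. The integrand is at
    most [Y w ^+ 2], which is integrable, and at most [|Y w| ^+ 3 / Num.sqrt n%:R], which tends to
    0. *)
Lemma cvg_trunc3 Y : L2 P Y ->
  (fun n => Ex P (fun w => n%:R * trunc3 (Y w / Num.sqrt n%:R))) @ \oo --> (0 : R).
Proof.
move=> [mY iY].
have dom n w : n%:R * trunc3 (Y w / Num.sqrt n%:R) <= Y w ^+ 2.
  have [->|n0] := posnP n; first by rewrite mul0r sqr_ge0.
  apply: le_trans (_ : n%:R * (Y w / Num.sqrt n%:R) ^+ 2 <= _).
    by rewrite ler_wpM2l// ge_min lexx.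
  by rewrite expr_div_n sqr_sqrtr// mulrC divfK// pnatr_eq0 -lt0n.
apply: (@cvg_Ex_dominated _ (fun w => Y w ^+ 2)) => //.
- move=> n; apply: measurable_funM => //; apply: measurableT_comp; first exact: measurable_trunc3.
  exact: measurable_funM.
- by move=> n w; rewrite ger0_norm ?mulr_ge0 ?trunc3_ge0.
- apply: aeW => w.
  apply: (@squeeze_cvgr _ _ _ _ (fun=> 0) (fun n => `|Y w| ^+ 3 / Num.sqrt n%:R)).
  + near=> n; rewrite mulr_ge0 ?trunc3_ge0//=.
    have n0 : (0 < n)%N by near: n; exists 1%N.
    apply: le_trans (_ : n%:R * `|Y w / Num.sqrt n%:R| ^+ 3 <= _).
      by rewrite ler_wpM2l// ge_min lexx orbT.
    have sn : 0 < Num.sqrt (n%:R : R) by rewrite sqrtr_gt0 ltr0n.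
    rewrite normrM exprMn normfV (ger0_norm (ltW sn)) mulrCA ler_wpM2l ?exprn_ge0//.
    set q := Num.sqrt _ in sn *.
    have -> : n%:R = q ^+ 2 by rewrite sqr_sqrtr.
    by rewrite le_eqVlt; apply/orP; left; apply/eqP; field; rewrite gt_eqF.
  + exact: cvg_cst.
  + rewrite -(mulr0 (`|Y w| ^+ 3)); apply: cvgMr; exact: cvg_invsqrtn.
Unshelve. all: by end_near. Qed.

End lindeberg.

(** * Gaussian smoothing *)

Section expR_remainder.
Context {R : realType}.
Implicit Types (a x : R).

(** Beyond the quadratic term, the series is [a ^+ 3] times a series dominated termwise by that of
    [expR |a|], since [i! <= (i + 3)!]. *)
Lemma expR_taylor3 a : `|expR a - (1 + a + a ^+ 2 / 2)| <= `|a| ^+ 3 * expR `|a|.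
Proof.
have part n : `|series (exp_coeff a) n.+3 - (1 + a + a ^+ 2 / 2)| <=
    `|a| ^+ 3 * series (exp_coeff `|a|) n.
  rewrite /series /= !big_nat_recl//= /exp_coeff /= !factS fact0.
  rewrite expr0 expr1 !muln1 divr1.
  rewrite [X in `|X|](_ : _ = \sum_(0 <= i < n) a ^+ i.+3 / i.+3`!%:R); last by rewrite expr2; field.
  rewrite mulr_sumr (le_trans (ler_norm_sum _ _ _))//; apply: ler_sum => i _.
  rewrite normrM normrX normfV normr_nat mulrA -exprD addnC addn3 ler_wpM2l ?exprn_ge0//.
  by rewrite lef_pV2 ?posrE ?ltr0n ?fact_gt0// ler_nat leq_fact//; lia.
have c1 : `|series (exp_coeff a) n.+3 - (1 + a + a ^+ 2 / 2)| @[n --> \oo] -->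
    `|expR a - (1 + a + a ^+ 2 / 2)|.
  apply: cvg_norm; apply: cvgB; last exact: cvg_cst.
  have -> : (fun n => series (exp_coeff a) n.+3) = (fun n => series (exp_coeff a) (n + 3)%N).
    by apply/funext => n; rewrite addn3.
  by rewrite (cvg_shiftn 3); exact: is_cvg_series_exp_coeff.
have c2 : `|a| ^+ 3 * series (exp_coeff `|a|) n @[n --> \oo] --> `|a| ^+ 3 * expR `|a|.
  apply: cvgMr; exact: is_cvg_series_exp_coeff.
rewrite -(cvg_lim _ c1)// -(cvg_lim _ c2)//; apply: ler_lim.
- by apply: cvgP c1.
- by apply: cvgP c2.
- by apply: nearW => n; exact: part.
Qed.

End expR_remainder.

Section gaussian_smoothing.
Context {R : realType}.
Implicit Types (m s t x y z M : R) (g : R -> R).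

Lemma normal_ratio1 m z : normal_ratio m 1 z = expR (m * z - m ^+ 2 / 2).
Proof. by rewrite /normal_ratio invr1 mul1r; congr expR; field. Qed.

(** In the next estimate 7 adds the constants 6 and 1 of two remainders, [expR 5] comes from
    [2 |z| + 1 <= 5 + z ^+ 2 / 4], and [Num.sqrt 2] cancels the normalization of
    [normal_ratio 0 (Num.sqrt 2)]. *)
Definition smoothing_cst : R := 7 * expR 5 * Num.sqrt 2.

Lemma smoothing_cst_ge0 : 0 <= smoothing_cst.
Proof. by rewrite !mulr_ge0// ?expR_ge0. Qed.

(** The ratio is [expR a] with [a = m * z - m ^+ 2 / 2], expanded to second order in [a], then
    reordered in powers of [m]; the coefficients are Hermite polynomials. Both remainders carry
    [|m| ^+ 3] and grow in [z] at most like [expR (2 * |z| + 1)], which the ratio of variance 2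
    dominates integrably. *)
Lemma normal_ratio_taylor m z : `|m| <= 1 ->
  `|normal_ratio m 1 z - (1 + m * z + m ^+ 2 * ((z ^+ 2 - 1) / 2))| <=
    `|m| ^+ 3 * (smoothing_cst * normal_ratio 0 (Num.sqrt 2) z).
Proof.
move=> m1.
have s2 : 0 < Num.sqrt 2 :> R by rewrite sqrtr_gt0.
pose u := `|z| + 1 / 2.
have z0 := normr_ge0 z; have m0 := normr_ge0 m.
have u0 : 0 <= u by rewrite /u; lra.
have ru : expR (u + u) <= expR 5 * Num.sqrt 2 * normal_ratio 0 (Num.sqrt 2) z.
  rewrite /normal_ratio subr0 sqr_sqrtr// -mulrA mulVKf ?gt_eqF// -expRD ler_expR /u.
  by rewrite -[z ^+ 2]real_normK ?num_real//; have := sqr_ge0 (`|z| - 4); nra.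
pose a := m * z - m ^+ 2 / 2.
have am : `|a| <= `|m| * u.
  rewrite /a /u (le_trans (ler_normB _ _))// normrM normrM normrX [ `|2^-1|]ger0_norm ?invr_ge0//.
  by nra.
have au : `|a| <= u by apply: le_trans am _; rewrite ler_piMl.
rewrite normal_ratio1 -/a.
have -> : expR a - (1 + m * z + m ^+ 2 * ((z ^+ 2 - 1) / 2)) =
   (expR a - (1 + a + a ^+ 2 / 2)) + m ^+ 3 * (m / 8 - z / 2) by rewrite /a; field.
apply: le_trans (ler_normD _ _) _.
have u3 : u ^+ 3 <= 6 * expR u.
  have := expR_ge1Dxn 2 u0; rewrite -ler_pdivrMl//.
  by rewrite (_ : 3`!%:R = 6)// => h; lra.
have e1 : `|expR a - (1 + a + a ^+ 2 / 2)| <= `|m| ^+ 3 * (6 * expR (u + u)).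
  apply: le_trans (expR_taylor3 _) _.
  apply: le_trans (_ : (`|m| * u) ^+ 3 * expR u <= _).
    by apply: ler_pM; rewrite ?exprn_ge0 ?expR_ge0// ?ler_expR// lerXn2r// nnegrE mulr_ge0.
  rewrite exprMn -mulrA ler_wpM2l ?exprn_ge0// (expRD u u) (mulrA 6).
  by rewrite ler_wpM2r ?expR_ge0.
have e2 : `|m ^+ 3 * (m / 8 - z / 2)| <= `|m| ^+ 3 * expR (u + u).
  rewrite normrM normrX ler_wpM2l ?exprn_ge0//.
  apply: le_trans (_ : 1 + (u + u) <= _); last exact: expR_ge1Dx.
  rewrite (le_trans (ler_normB _ _))// normrM normrM [ `|8^-1|]ger0_norm ?[ `|2^-1|]ger0_norm ?invr_ge0//.
  by rewrite /u; lra.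
apply: le_trans (lerD e1 e2) _.
have -> : `|m| ^+ 3 * (6 * expR (u + u)) + `|m| ^+ 3 * expR (u + u) =
   `|m| ^+ 3 * (7 * expR (u + u)) by ring.
rewrite ler_wpM2l ?exprn_ge0// /smoothing_cst.
by rewrite -[7 * _ * _ * _]mulrA -mulrA ler_pM2l// mulrA.
Qed.

(** One-dimensional Cameron-Martin formula: the shift moves from the function to the density, so
    that expanding in [m] asks no derivative of [g]. *)
Lemma Ex_stdnormal_shift g m M : continuous g -> (forall x, `|g x| <= M) ->
  Ex (@stdnormal R) (fun z => g (z + m)) = Ex (@stdnormal R) (fun z => g z * normal_ratio m 1 z).
Proof.
move=> cg gM.
pose h y := g y + M.
have h0 y : 0 <= h y by have := gM y; rewrite /h ler_norml; lra.
have ch : continuous h by move=> y; apply: cvgD; [exact: cg|exact: cvg_cst].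
have mg : measurable_fun setT g by exact: continuous_measurable_fun.
have mh : measurable_fun setT h by exact: continuous_measurable_fun.
have ir := @L1_normal_ratio R m 1 ltr01.
have mr := @measurable_normal_ratio R m 1.
have ig : L1 (@stdnormal R) (fun z => g (z + m)).
  apply: (@L1_bounded _ _ _ (@stdnormal R) _ M) => //.
  by apply: measurableT_comp => //; exact: measurable_funD.
have igr : L1 (@stdnormal R) (fun z => g z * normal_ratio m 1 z).
  apply: (@L1_le _ _ _ (@stdnormal R) _ (fun z => M * normal_ratio m 1 z)).
  - exact: measurable_funM.
  - exact: L1Z.
  - by move=> z; rewrite normrM (ger0_norm (normal_ratio_ge0 _ _ _))// ler_wpM2r ?normal_ratio_ge0.
have : (\int[@stdnormal R]_z (h (1 * z + m))%:E =
        \int[@stdnormal R]_z (h z * normal_ratio m 1 z)%:E)%E.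
  rewrite normal_affine// integral_normal_prob.
  - apply: eq_integral => z _; rewrite -EFinM -mulrA; congr (_ * _)%:E.
    by rewrite normal_ratioE.
  - by apply/measurable_EFinP; exact: measurable_funM.
  - by move=> z; rewrite lee_fin mulr_ge0// normal_ratio_ge0.
under eq_integral do rewrite mul1r.
rewrite (@EFin_Ex _ _ _ (@stdnormal R) (fun z => g (z + m) + M)); last by apply: L1D => //; exact: L1_cst.
have -> : (fun z => (h z * normal_ratio m 1 z)%:E) =
  (fun z => (g z * normal_ratio m 1 z + M * normal_ratio m 1 z)%:E).
  by apply/funext => z; rewrite /h mulrDl.
rewrite (@EFin_Ex _ _ _ (@stdnormal R) (fun z => g z * normal_ratio m 1 z + M * normal_ratio m 1 z)); last first.
  by apply: L1D => //; exact: L1Z.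
move=> []; rewrite ExD//; last exact: L1_cst.
rewrite [in RHS]ExD//; last exact: L1Z.
by rewrite Ex_cst ExZ// Ex_normal_ratio// mulr1 => /addIr.
Qed.

(** The increment is carried by [normal_ratio], whose expansion gives as coefficients the integrals
    of [g] against [z] and [z ^+ 2 - 1]. For [|m| <= 1] the remainder is cubic; for [|m| > 1] each
    term is at most a multiple of [m ^+ 2] because [g] is bounded. *)
Lemma taylor2_smoothing g M s : continuous g -> (forall x, `|g x| <= M) -> 0 < s -> s <= 1 ->
  exists B, taylor2 B (heat (s ^+ 2) g).
Proof.
move=> cg gM s0 s1.
have mg : measurable_fun setT g by exact: continuous_measurable_fun.
have M0 : 0 <= M by apply: le_trans (gM 0).
have ss : Num.sqrt (s ^+ 2) = s by rewrite sqrtr_sqr ger0_norm// ltW.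
have iz := L2_L1 (@L2_stdnormal R); have [_ iz2] := @L2_stdnormal R.
have iz21 : L1 (@stdnormal R) (fun z => z ^+ 2 - 1) by apply: L1B => //; exact: L1_cst.
pose c1 := Ex (@stdnormal R) (fun z => `|z|).
pose c2 := Ex (@stdnormal R) (fun z => `|z ^+ 2 - 1|).
have c10 : 0 <= c1 by exact: Ex_ge0.
have c20 : 0 <= c2 by exact: Ex_ge0.
have K0 := smoothing_cst_ge0.
pose C := 3 + c1 + c2 + smoothing_cst.
have C0 : 3 <= C by rewrite /C; lra.
pose F x z := g (x + s * z).
have FM x z : `|F x z| <= M by exact: gM.
have mF : measurable_fun setT (fun p : measurableTypeR R * measurableTypeR R => F p.1 p.2).
  apply: measurableT_comp => //; apply: measurable_funD; first exact: measurable_fst.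
  by apply: measurable_funM => //; exact: measurable_snd.
have mFx x : measurable_fun setT (F x).
  by apply: measurableT_comp => //; apply: measurable_funD => //; exact: measurable_funM.
have iF x (k : measurableTypeR R -> R) : L1 (@stdnormal R) k -> L1 (@stdnormal R) (fun z => F x z * k z).
  move=> ik; apply: (@L1_le _ _ _ (@stdnormal R) _ (fun z => M * `|k z|)).
  - by apply: measurable_funM; [exact: mFx|exact: (L1_measurable ik)].
  - by apply: L1Z; exact: L1_abs.
  - by move=> z; rewrite normrM ler_wpM2r.
have bF x (k : measurableTypeR R -> R) : L1 (@stdnormal R) k ->
    `|Ex (@stdnormal R) (fun z => F x z * k z)| <= M * Ex (@stdnormal R) (fun z => `|k z|).
  move=> ik; apply: le_trans (Ex_abs (iF x _ ik)) _.
  rewrite -ExZ; last exact: L1_abs.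
  apply: Ex_le; [exact: L1_abs (iF x _ ik)|by apply: L1Z; exact: L1_abs|move=> z].
  by rewrite normrM ler_wpM2r.
have mk (k : measurableTypeR R -> R) : L1 (@stdnormal R) k ->
    measurable_fun setT (fun x : R => Ex (@stdnormal R) (fun z => F x z * k z)).
  move=> ik; apply: (@measurable_Ex_param _ (fun p => F p.1 p.2 * k p.2)); last by move=> x; exact: iF.
  apply: measurable_funM; first exact: mF.
  by apply: measurableT_comp; [exact: (L1_measurable ik)|exact: measurable_snd].
have shift x y : heat (s ^+ 2) g (x + y) =
    Ex (@stdnormal R) (fun z => F x z * normal_ratio (y / s) 1 z).
  rewrite -(@Ex_stdnormal_shift (F x) _ M).
  - rewrite /heat ss; congr Ex; apply/funext => z; rewrite /F; congr g.
    by field; rewrite gt_eqF.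
  - move=> z; apply: continuous_comp; last exact: cg.
    by apply: cvgD; [exact: cvg_cst|apply: cvgM; [exact: cvg_cst|exact: cvg_id]].
  - by move=> z; exact: gM.
pose E1 x := Ex (@stdnormal R) (fun z => F x z * z).
pose E2 x := Ex (@stdnormal R) (fun z => F x z * (z ^+ 2 - 1)).
have hM := heat_bounded (s ^+ 2) mg gM.
have E1M x : `|E1 x| <= M * c1 by exact: bF.
have E2M x : `|E2 x| <= M * c2 by exact: bF.
have key x m : `|heat (s ^+ 2) g (x + s * m) - heat (s ^+ 2) g x - m * E1 x - m ^+ 2 / 2 * E2 x| <=
    M * C * Num.min (m ^+ 2) (`|m| ^+ 3).
  have m2 : m ^+ 2 = `|m| ^+ 2 by rewrite real_normK ?num_real.
  have [m1|m1] := leP `|m| 1.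
    have -> : Num.min (m ^+ 2) (`|m| ^+ 3) = `|m| ^+ 3.
      by rewrite m2; apply: min_r; rewrite exprS ler_piMl ?exprn_ge0.
    pose k z := normal_ratio m 1 z - (1 + m * z + m ^+ 2 * ((z ^+ 2 - 1) / 2)).
    have ir := @L1_normal_ratio R m 1 ltr01.
    have ik0 : L1 (@stdnormal R) (fun z => 1 + m * z + m ^+ 2 / 2 * (z ^+ 2 - 1)).
      by apply: L1D; [apply: L1D; [exact: L1_cst|exact: L1Z]|exact: L1Z].
    have ik : L1 (@stdnormal R) k.
      have := L1B ir ik0; congr (L1 _ _); apply/funext => z; rewrite /k.
      by congr (_ - (_ + _)); rewrite mulrAC mulrA.
    have -> : heat (s ^+ 2) g (x + s * m) - heat (s ^+ 2) g x - m * E1 x - m ^+ 2 / 2 * E2 x =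
        Ex (@stdnormal R) (fun z => F x z * k z).
      have i0 : L1 (@stdnormal R) (F x) by apply: (@L1_bounded _ _ _ (@stdnormal R) _ M); [exact: mFx|exact: FM].
      have i1 := iF x _ iz; have i2 := iF x _ iz21; have i3 := iF x _ ir.
      rewrite shift (_ : s * m / s = m); last by field; rewrite gt_eqF.
      rewrite {1}/heat ss -(ExZ m i1) -(ExZ (m ^+ 2 / 2) i2) -(ExB i3 i0) -(ExB (L1B i3 i0) (L1Z m i1)).
      rewrite -(ExB (L1B (L1B i3 i0) (L1Z m i1)) (L1Z (m ^+ 2 / 2) i2)).
      by congr Ex; apply/funext => z; rewrite /k; field.
    apply: le_trans (bF x _ ik) _; rewrite -mulrA ler_wpM2l//.
    have i4 := L1Z (`|m| ^+ 3) (L1Z smoothing_cst (@L1_normal_ratio R 0 (Num.sqrt 2) ltac:(by rewrite sqrtr_gt0))).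
    apply: le_trans (_ : Ex (@stdnormal R) (fun z =>
       `|m| ^+ 3 * (smoothing_cst * normal_ratio 0 (Num.sqrt 2) z)) <= _).
      by apply: Ex_le => //; [exact: L1_abs|move=> z; exact: normal_ratio_taylor].
    rewrite ExZ; last by apply: L1Z; apply: L1_normal_ratio; rewrite sqrtr_gt0.
    rewrite ExZ; last by apply: L1_normal_ratio; rewrite sqrtr_gt0.
    rewrite Ex_normal_ratio ?sqrtr_gt0// mulr1 mulrC ler_wpM2r ?exprn_ge0//.
    by rewrite /C; lra.
  have -> : Num.min (m ^+ 2) (`|m| ^+ 3) = `|m| ^+ 2.
    by rewrite m2; apply: min_l; rewrite [leRHS]exprS ler_peMl ?exprn_ge0// ltW.
  have n1 := hM (x + s * m); have n2 := hM x; have n3 := E1M x; have n4 := E2M x.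
  apply: le_trans (ler_normB _ _) _; apply: le_trans (lerD (ler_normB _ _) (lexx _)) _.
  apply: le_trans (lerD (lerD (ler_normB _ _) (lexx _)) (lexx _)) _.
  rewrite (normrM m) (normrM (m ^+ 2 / 2)) (ger0_norm (_ : 0 <= m ^+ 2 / 2)) ?divr_ge0 ?sqr_ge0//.
  rewrite m2; move: `|m| m1 => q q1.
  have q2 : q <= q ^+ 2 by rewrite expr2 ler_peMl// ltW// (lt_trans _ q1).
  have q3 : 1 <= q ^+ 2 by apply: le_trans q2; exact: ltW.
  have f1 : q * `|E1 x| <= q ^+ 2 * (M * c1) by apply: ler_pM => //; rewrite (le_trans _ (ltW q1)).
  have f2 : q ^+ 2 / 2 * `|E2 x| <= q ^+ 2 * (M * c2).
    by apply: ler_pM => //; rewrite ?divr_ge0 ?sqr_ge0//; lra.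
  have f3 : M + M <= q ^+ 2 * (M * (3 + smoothing_cst)).
    have : 1 * (M * (3 + smoothing_cst)) <= q ^+ 2 * (M * (3 + smoothing_cst)).
      by rewrite ler_wpM2r// mulr_ge0//; lra.
    apply: le_trans; rewrite mul1r; have : 0 <= M * smoothing_cst by rewrite mulr_ge0.
    lra.
  rewrite /C; lra.
(* Returning from [m = y / s] to [y] costs powers of [s^-1] up to the third, all at most
   [(s ^+ 3)^-1] since [s <= 1]. *)
have B1 : 1 <= (s ^+ 3)^-1 by rewrite invf_ge1 ?exprn_gt0// exprn_ile1// ltW.
have B0 : M * C <= M * C / s ^+ 3.
  by rewrite ler_peMr// mulr_ge0//; lra.
have scale k : (k <= 3)%N -> (s ^+ k)^-1 <= (s ^+ 3)^-1.
  by move=> k3; rewrite lef_pV2 ?posrE ?exprn_gt0// ler_wiXn2l// ltW.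
exists (M * C / s ^+ 3), (fun x => s^-1 * E1 x), (fun x => (s ^+ 2)^-1 * E2 x); split.
- by apply: measurable_funM => //; exact: mk.
- by apply: measurable_funM => //; exact: mk.
- move=> x; split.
  + apply: le_trans B0; apply: le_trans (hM x) _; rewrite ler_peMr//; lra.
  + rewrite normrM ger0_norm ?invr_ge0 ?(ltW s0)// mulrC.
    apply: ler_pM => //; first by rewrite invr_ge0 ltW.
      by apply: le_trans (E1M x) _; rewrite ler_wpM2l// /C; lra.
    exact: (scale 1%N).
  + rewrite normrM ger0_norm ?invr_ge0 ?exprn_ge0 ?(ltW s0)// mulrC.
    apply: ler_pM => //; first by rewrite invr_ge0 exprn_ge0 ?ltW.
      by apply: le_trans (E2M x) _; rewrite ler_wpM2l// /C; lra.
    exact: (scale 2%N).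
- move=> x y.
  have := key x (y / s); rewrite mulrC divfK ?gt_eqF//.
  have -> : y / s * E1 x = s^-1 * E1 x * y by ring.
  have -> : (y / s) ^+ 2 / 2 * E2 x = (s ^+ 2)^-1 * E2 x * (y ^+ 2 / 2).
    by field; rewrite gt_eqF.
  move=> h; apply: le_trans h _; rewrite -[leRHS]mulrA ler_wpM2l ?mulr_ge0//; first by lra.
  rewrite expr_div_n normrM exprMn normfV (ger0_norm (ltW s0)) exprVn.
  have j2 : y ^+ 2 / s ^+ 2 <= (s ^+ 3)^-1 * y ^+ 2.
    by rewrite mulrC ler_wpM2r ?sqr_ge0// scale.
  have [yy|yy] := leP (y ^+ 2) (`|y| ^+ 3).
    by rewrite ge_min j2.
  by rewrite ge_min (mulrC (`|y| ^+ 3)) lexx orbT.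
Qed.

End gaussian_smoothing.

(** * Lipschitz minorants and weak convergence *)

Section lipschitz_minorants.
Context {R : realType} {d : nat}.
Implicit Types (x y : 'I_d -> R) (F : ('I_d -> R) -> R) (L M : R).

Definition dist1 x y : R := \sum_(i < d) `|x i - y i|.

Lemma dist1_ge0 x y : 0 <= dist1 x y.
Proof. by apply: sumr_ge0. Qed.

Lemma dist1C x y : dist1 x y = dist1 y x.
Proof. by apply: eq_bigr => i _; rewrite distrC. Qed.

Lemma dist1_triangle x y z : dist1 x z <= dist1 x y + dist1 y z.
Proof. by rewrite -big_split; apply: ler_sum => i _; exact: ler_distD. Qed.

Lemma dist1_coord x y i : `|x i - y i| <= dist1 x y.
Proof. by rewrite /dist1 (bigD1 i)//= lerDl; apply: sumr_ge0. Qed.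

(** An enumeration of the rational vectors; an index that decodes to nothing gives the zero
    vector. *)
Definition ratvec (n : nat) : 'I_d -> R :=
  fun i => ratr ((odflt [ffun=> 0] (unpickle n) : {ffun 'I_d -> rat}) i).

Lemma ratvec_dense x (e : R) : 0 < e -> exists n, dist1 x (ratvec n) < e.
Proof.
move=> e0; pose e' := e / d.+1%:R.
have e'0 : 0 < e' by rewrite divr_gt0.
have /choice[q qP] : forall i, exists q : rat, ratr q \in `]x i, x i + e'[%R.
  by move=> i; apply: rat_in_itvoo; rewrite ltrDl.
exists (pickle [ffun i => q i]).
apply: le_lt_trans (_ : \sum_(i < d) e' < e).
  apply: ler_sum => i _; rewrite /ratvec pickleK/= ffunE.
  by have := qP i; rewrite in_itv/= distrC => /andP[q1 q2]; rewrite ger0_norm; lra.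
rewrite sumr_const card_ord -mulr_natr /e' mulrAC ltr_pdivrMr// ltr_pM2l//.
by rewrite ltr_nat.
Qed.

(** Vectors are plain functions here, hence continuity spelled out for [dist1]; [continuous1_row]
    translates from row vectors. *)
Definition continuous1 F := forall x (e : R), 0 < e ->
  exists2 dl : R, 0 < dl & forall y, dist1 x y < dl -> `|F y - F x| <= e.

(* Only rational points, so that [lipmin L F] is visibly measurable; [infs _ 0] is
   the infimum over the whole sequence. *)
Definition lipmin L F x := infs (fun n => F (ratvec n) + L * dist1 x (ratvec n)) 0.

Let D L F x := sdrop (fun n => F (ratvec n) + L * dist1 x (ratvec n)) 0.

Let lbD L F M x : 0 <= L -> (forall y, `|F y| <= M) -> lbound (D L F x) (- M).
Proof.
move=> L0 FM _ [n _ <-]; have := FM (ratvec n); rewrite ler_norml => /andP[h _].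
by rewrite (le_trans h)// lerDl mulr_ge0// dist1_ge0.
Qed.

Let D0 L F x : D L F x !=set0.
Proof. by exists (F (ratvec 0) + L * dist1 x (ratvec 0)), 0%N. Qed.

Lemma lipmin_le L F M x n : 0 <= L -> (forall y, `|F y| <= M) ->
  lipmin L F x <= F (ratvec n) + L * dist1 x (ratvec n).
Proof.
move=> L0 FM; apply: ge_inf; last by exists n.
by exists (- M); exact: lbD.
Qed.

Lemma lipmin_geP L F x c : (forall n, c <= F (ratvec n) + L * dist1 x (ratvec n)) ->
  c <= lipmin L F x.
Proof. by move=> h; apply: lb_le_inf; [exact: D0|move=> _ [n _ <-]; exact: h]. Qed.

Lemma lipmin_lip L F M x y : 0 <= L -> (forall y, `|F y| <= M) ->
  `|lipmin L F x - lipmin L F y| <= L * dist1 x y.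
Proof.
move=> L0 FM.
have key u v : lipmin L F u - L * dist1 u v <= lipmin L F v.
  apply: lipmin_geP => n; rewrite lerBlDr (le_trans (lipmin_le u n L0 FM))//.
  by rewrite -addrA lerD2l -mulrDr ler_wpM2l// addrC dist1_triangle.
have := key x y; have := key y x; rewrite (dist1C y) => h1 h2.
by rewrite ler_norml; apply/andP; split; lra.
Qed.

(** The infimum runs over rational points only, so a rational point is taken so near [x] that the
    variation of [F] and the penalty are each at most [e / 2]. *)
Lemma lipmin_le_fun L F M x : 0 <= L -> (forall y, `|F y| <= M) -> continuous1 F ->
  lipmin L F x <= F x.
Proof.
move=> L0 FM cF; apply/ler_addgt0Pr => e e0.
have e20 : 0 < e / 2 by rewrite divr_gt0.
have [dl dl0 hF] := cF x _ e20.
have e30 : 0 < Num.min dl (e / 2 / (L + 1)) by rewrite lt_min dl0 divr_gt0//; lra.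
have [n] := ratvec_dense x e30; rewrite lt_min => /andP[n1 n2].
apply: le_trans (lipmin_le x n L0 FM) _.
have := hF _ n1; rewrite ler_norml => /andP[_ h1].
have : L * dist1 x (ratvec n) <= e / 2.
  rewrite ltr_pdivlMr in n2; last by lra.
  have := dist1_ge0 x (ratvec n); nra.
lra.
Qed.

Lemma lipmin_bounded L F M x : 0 <= L -> (forall y, `|F y| <= M) -> continuous1 F ->
  `|lipmin L F x| <= M.
Proof.
move=> L0 FM cF; rewrite ler_norml; apply/andP; split; last first.
  by apply: le_trans (lipmin_le_fun x L0 FM cF) _; have := FM x; rewrite ler_norml => /andP[].
apply: lipmin_geP => n; have := FM (ratvec n); rewrite ler_norml => /andP[h _].
by rewrite (le_trans h)// lerDl mulr_ge0// dist1_ge0.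
Qed.

(** Points farther than [dl] from [x] are harmless once the penalty [n%:R * dl] exceeds the
    oscillation [2 * M]; at nearer points [F] is at least [F x - e]. *)
Lemma cvg_lipmin F M x : (forall y, `|F y| <= M) -> continuous1 F ->
  (fun n : nat => lipmin n%:R F x) @ \oo --> F x.
Proof.
move=> FM cF; apply/cvgrPdist_le => e e0.
have [dl dl0 hF] := cF x _ e0.
have M0 : 0 <= M by apply: le_trans (FM x).
exists (Num.bound (2 * M / dl)) => // n /= Nn.
have Ln : 2 * M <= n%:R * dl.
  rewrite -ler_pdivrMr//; apply: le_trans (_ : (Num.bound (2 * M / dl))%:R <= _); last by rewrite ler_nat.
  by apply: ltW; apply: archi_boundP; rewrite divr_ge0 ?mulr_ge0// ltW.
rewrite ger0_norm ?subr_ge0; last exact: lipmin_le_fun FM cF.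
rewrite lerBlDl -lerBlDr; apply: lipmin_geP => m.
have [h|h] := ltP (dist1 x (ratvec m)) dl.
  have := hF _ h; rewrite ler_norml => /andP[h1 _].
  have : 0 <= n%:R * dist1 x (ratvec m) by rewrite mulr_ge0// dist1_ge0.
  lra.
have := FM x; have := FM (ratvec m); rewrite !ler_norml => /andP[h1 _] /andP[_ h2].
have : n%:R * dl <= n%:R * dist1 x (ratvec m) by rewrite ler_wpM2l.
lra.
Qed.

Lemma measurable_lipmin {dT} {T : measurableType dT} (X : T -> 'I_d -> R) L F M :
  0 <= L -> (forall y, `|F y| <= M) ->
  (forall i, measurable_fun setT (fun w => X w i)) ->
  measurable_fun setT (fun w => lipmin L F (X w)).
Proof.
move=> L0 FM mX.
apply: (@measurable_fun_infs _ _ _ _ (fun n w => F (ratvec n) + L * dist1 (X w) (ratvec n)) 0).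
  move=> w _; exists (- M) => _ [n _ <-]; apply: (@lbD L F M (X w)) => //.
  by exists n.
move=> n; apply: measurable_funD => //; apply: measurable_funM => //.
apply: measurable_sum => i; apply: measurableT_comp => //.
exact: measurable_funB.
Qed.

(** [F] is the pointwise limit of its minorants [lipmin], countable infima whose measurability is
    visible. *)
Lemma measurable_continuous1 {dT} {T : measurableType dT} (X : T -> 'I_d -> R) F M :
  (forall y, `|F y| <= M) -> continuous1 F ->
  (forall i, measurable_fun setT (fun w => X w i)) ->
  measurable_fun setT (fun w => F (X w)).
Proof.
move=> FM cF mX.
apply: (@measurable_fun_cvg _ _ _ _ (fun n w => lipmin n%:R F (X w))).
  by move=> n; exact: measurable_lipmin FM mX.
by move=> w _; exact: cvg_lipmin FM cF.
Qed.

Lemma continuous1_row (f : 'rV[R]_d -> R) : continuous f ->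
  continuous1 (fun x => f (\row_i x i)).
Proof.
move=> cf x e e0.
have /nbhs_ballP[dl dl0 h] : nbhs (\row_i x i) [set v | `|f (\row_i x i) - f v| <= e].
  have := @cvgr_dist_le _ R^o _ (nbhs (\row_i x i)) _ f (f (\row_i x i)) (cf (\row_i x i)) e e0; exact.
exists dl => // y xy; rewrite distrC; apply: h; split => // i j.
rewrite !mxE /ball/=; apply: le_lt_trans xy; exact: dist1_coord.
Qed.

End lipschitz_minorants.

(** * Weak convergence: from smooth to continuous test functions *)

Section weak_convergence.
Context {R : realType} {dT} {T : measurableType dT} (P : probability T R).
Implicit Types (L M s e : R).

Lemma heat_close (g : R -> R) L M s : measurable_fun setT g -> (forall x, `|g x| <= M) ->
  (forall x y, `|g x - g y| <= L * `|x - y|) -> 0 <= s ->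
  forall x, `|heat (s ^+ 2) g x - g x| <= L * s.
Proof.
move=> mg gM gL s0 x.
have L0 : 0 <= L by have := gL 1 0; rewrite subr0 normr1 mulr1; apply: le_trans.
have ig := L1_heat (s ^+ 2) x mg gM.
have iz := L2_L1 (@L2_stdnormal R).
rewrite /heat -[X in _ - X](Ex_cst (@stdnormal R)) -ExB//; last exact: L1_cst.
have iD := L1B ig (@L1_cst _ _ _ (@stdnormal R) (g x)).
apply: le_trans (Ex_abs iD) _.
apply: le_trans (_ : Ex (@stdnormal R) (fun z => L * s * `|z|) <= _).
  apply: Ex_le; [exact: L1_abs|by apply: L1Z; exact: L1_abs|move=> z].
  apply: le_trans (gL _ _) _; rewrite addrC addKr normrM sqrtr_sqr normr_id (ger0_norm s0).
  by rewrite mulrA.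
rewrite ExZ; last exact: L1_abs.
rewrite ler_piMr ?mulr_ge0//; apply: le_trans (Ex_abs_le_nrm (@L2_stdnormal R)) _.
by rewrite /nrm Ex_stdnormal_sqr sqrtr1.
Qed.

Lemma lip_continuous (g : R -> R) L : (forall x y, `|g x - g y| <= L * `|x - y|) -> continuous g.
Proof.
move=> gL x; have L0 : 0 <= L by have := gL 1 0; rewrite subr0 normr1 mulr1; apply: le_trans.
apply/cvgrPdist_le => e e0; near=> z; apply: le_trans (gL _ _) _.
have : `|x - z| <= e / (L + 1).
  near: z; apply: (@cvgr_dist_le _ R^o _ (nbhs x) _ id x); first exact: cvg_id.
  by rewrite divr_gt0//; lra.
by rewrite ler_pdivlMr; [have := normr_ge0 (x - z); nra|lra].
Unshelve. all: by end_near. Qed.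

Variables (Z : nat -> T -> R) (s2 : R).
Hypothesis mZ : forall n, measurable_fun setT (Z n).
Hypothesis cvgZ : forall B h, taylor2 B h ->
  (fun n => Ex P (fun w => h (Z n w))) @ \oo --> heat s2 h 0.

(** Smoothing at scale [s] moves [g] by at most [L * s <= e / 3] everywhere, hence its mean by as
    much under every law, and the smoothed function lies in the class of [cvgZ]. *)
Lemma weak_cvg_lip (g : R -> R) L M : (forall x, `|g x| <= M) ->
  (forall x y, `|g x - g y| <= L * `|x - y|) ->
  (fun n => Ex P (fun w => g (Z n w))) @ \oo --> heat s2 g 0.
Proof.
move=> gM gL; have L0 : 0 <= L by have := gL 1 0; rewrite subr0 normr1 mulr1; apply: le_trans.
have cg := lip_continuous gL; have mg : measurable_fun setT g by exact: continuous_measurable_fun.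
apply/cvgrPdist_le => e e0.
pose s := Num.min 1 (e / 3 / (L + 1)).
have s0 : 0 < s by rewrite lt_min ltr01/= divr_gt0//; lra.
have s1 : s <= 1 by rewrite ge_min lexx.
have Ls : L * s <= e / 3.
  have : s <= e / 3 / (L + 1) by rewrite ge_min lexx orbT.
  by rewrite ler_pdivlMr; nra.
have [B tB] := taylor2_smoothing cg gM s0 s1.
have hg := heat_close mg gM gL (ltW s0).
set h := heat (s ^+ 2) g in tB hg.
have hB := taylor2_bounded tB; have mh := taylor2_measurable tB.
have e30 : 0 < e / 3 by rewrite divr_gt0.
have close (X : T -> R) : measurable_fun setT X ->
    `|Ex P (fun w => h (X w)) - Ex P (fun w => g (X w))| <= e / 3.
  move=> mX.
  have ih : L1 P (fun w => h (X w)) by apply: (@L1_bounded _ _ _ _ _ B) => //; exact: measurableT_comp.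
  have ig : L1 P (fun w => g (X w)) by apply: (@L1_bounded _ _ _ _ _ M) => //; exact: measurableT_comp.
  rewrite -ExB//; apply: le_trans (Ex_abs (L1B ih ig)) _.
  rewrite -[leRHS](Ex_cst P); apply: Ex_le; [exact: L1_abs (L1B ih ig)|exact: L1_cst|move=> w].
  exact: le_trans (hg _) Ls.
have closeN : `|heat s2 h 0 - heat s2 g 0| <= e / 3.
  have ih := L1_heat s2 0 mh hB; have ig := L1_heat s2 0 mg gM.
  rewrite /heat -ExB//; apply: le_trans (Ex_abs (L1B ih ig)) _.
  rewrite -[leRHS](Ex_cst (@stdnormal R)); apply: Ex_le; [exact: L1_abs (L1B ih ig)|exact: L1_cst|move=> w].
  exact: le_trans (hg _) Ls.
move/cvgrPdist_le: (cvgZ tB) => /(_ _ e30).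
apply: filterS => n hn; have := close _ (mZ n).
have := ler_distD (Ex P (fun w => h (Z n w))) (heat s2 g 0) (Ex P (fun w => g (Z n w))).
have := ler_distD (heat s2 h 0) (heat s2 g 0) (Ex P (fun w => h (Z n w))).
move: closeN hn; rewrite (distrC (heat s2 h 0) (heat s2 g 0)).
by lra.
Qed.

Variables (d : nat) (X : nat -> T -> 'I_d -> R).
Hypothesis mX : forall n i, measurable_fun setT (fun w => X n w i).
Hypothesis XZ : (fun n => Ex P (fun w => Num.min 1 (dist1 (X n w) (fun=> Z n w)))) @ \oo --> (0 : R).

Lemma measurable_dist1 (U V : T -> 'I_d -> R) : (forall i, measurable_fun setT (fun w => U w i)) ->
  (forall i, measurable_fun setT (fun w => V w i)) ->
  measurable_fun setT (fun w => dist1 (U w) (V w)).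
Proof.
move=> mU mV; apply: measurable_sum => i; apply: measurableT_comp => //.
exact: measurable_funB.
Qed.

(** On the diagonal [F] is a Lipschitz function of one variable. Off it, the error is at most [L]
    times the distance where this is below 1 and at most [2 * M] elsewhere, hence the factor
    [2 * M + L] of the truncated distance. *)
Lemma weak_cvg_lip1 (F : ('I_d -> R) -> R) L M : (forall x, `|F x| <= M) -> 0 <= L ->
  (forall n, measurable_fun setT (fun w => F (X n w))) ->
  (forall x y, `|F x - F y| <= L * dist1 x y) ->
  (fun n => Ex P (fun w => F (X n w))) @ \oo --> heat s2 (fun z => F (fun=> z)) 0.
Proof.
move=> FM L0 mF FL.
pose g z := F (fun=> z).
have gL x y : `|g x - g y| <= L * d%:R * `|x - y|.
  apply: le_trans (FL _ _) _.
  by rewrite /dist1 sumr_const card_ord -[X in L * X]mulr_natl mulrA.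
have gM x : `|g x| <= M by exact: FM.
have cg := weak_cvg_lip gM gL.
have mg : measurable_fun setT g by apply: continuous_measurable_fun; exact: lip_continuous gL.
have M0 : 0 <= M by apply: le_trans (FM (fun=> 0)).
have mD n : measurable_fun setT (fun w => Num.min 1 (dist1 (X n w) (fun=> Z n w))).
  by apply: measurable_minr => //; apply: measurable_dist1.
have D1 n w : `|Num.min 1 (dist1 (X n w) (fun=> Z n w))| <= 1.
  by rewrite ger0_norm ?le_min ?ler01 ?dist1_ge0// ge_min lexx.
have iD n : L1 P (fun w => Num.min 1 (dist1 (X n w) (fun=> Z n w))).
  by apply: (@L1_bounded _ _ _ _ _ 1).
have iF n : L1 P (fun w => F (X n w)) by apply: (@L1_bounded _ _ _ _ _ M).
have ig n : L1 P (fun w => g (Z n w)).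
  by apply: (@L1_bounded _ _ _ _ _ M) => //; exact: measurableT_comp.
have diff : (fun n => Ex P (fun w => F (X n w)) - Ex P (fun w => g (Z n w))) @ \oo --> (0 : R).
  apply/norm_cvg0P.
  apply: (@squeeze_cvgr _ _ _ _ (fun=> 0) (fun n => (2 * M + L) *
    Ex P (fun w => Num.min 1 (dist1 (X n w) (fun=> Z n w))))).
  - apply: nearW => n; rewrite normr_ge0/= -ExB// -ExZ//.
    apply: le_trans (Ex_abs (L1B (iF n) (ig n))) _.
    apply: Ex_le; [exact: L1_abs (L1B (iF n) (ig n))|exact: L1Z|move=> w].
    have [d1|d1] := leP 1 (dist1 (X n w) (fun=> Z n w)).
      by have := ler_normB (F (X n w)) (g (Z n w)); have := FM (X n w); have := gM (Z n w); lra.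
    apply: le_trans (FL _ _) _; rewrite ler_wpM2r ?dist1_ge0//; lra.
  - exact: cvg_cst.
  - by rewrite -(mulr0 (2 * M + L)); apply: cvgMr.
have -> : (fun n => Ex P (fun w => F (X n w))) = (fun n =>
    (Ex P (fun w => F (X n w)) - Ex P (fun w => g (Z n w))) + Ex P (fun w => g (Z n w))).
  by apply/funext => n; rewrite subrK.
by rewrite -[X in _ --> X]add0r; exact: cvgD diff cg.
Qed.

(** A Lipschitz minorant yields the lower bound [low]; the upper bound is [low] for [- F]. *)
Lemma weak_cvg_continuous1 (F : ('I_d -> R) -> R) M : (forall x, `|F x| <= M) ->
  continuous1 F ->
  (fun n => Ex P (fun w => F (X n w))) @ \oo --> heat s2 (fun z => F (fun=> z)) 0.
Proof.
move: F M.
have low (F : ('I_d -> R) -> R) M' e : (forall x, `|F x| <= M') -> continuous1 F -> 0 < e ->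
    \forall n \near \oo, heat s2 (fun z => F (fun=> z)) 0 - e <= Ex P (fun w => F (X n w)).
  move=> FM cF e0; have e20 : 0 < e / 2 by rewrite divr_gt0.
  pose G (k : nat) z := lipmin k%:R F (fun=> z : R).
  have mG k : measurable_fun setT (fun z => G k (0 + Num.sqrt s2 * z) : R).
    apply: (measurable_lipmin (X := fun z (i : 'I_d) => 0 + Num.sqrt s2 * z)) FM _ => // i.
    exact: measurable_heat_arg.
  have mF0 : measurable_fun setT (fun z : R => F (fun=> 0 + Num.sqrt s2 * z)).
    apply: (measurable_continuous1 (X := fun z (i : 'I_d) => 0 + Num.sqrt s2 * z)) FM cF _ => i.
    exact: measurable_heat_arg.
  have M0 : 0 <= M' by apply: le_trans (FM (fun=> 0)).
  have GM k z : `|G k z| <= M' by exact: lipmin_bounded.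
  have iG k : L1 (@stdnormal R) (fun z => G k (0 + Num.sqrt s2 * z)).
    by apply: (@L1_bounded _ _ _ (@stdnormal R) _ M'); [exact: mG|move=> z; exact: GM].
  have iF0 : L1 (@stdnormal R) (fun z => F (fun=> 0 + Num.sqrt s2 * z)).
    by apply: (@L1_bounded _ _ _ (@stdnormal R) _ M'); [exact: mF0|move=> z; exact: FM].
  have c0 : (fun k => Ex (@stdnormal R) (fun z => F (fun=> 0 + Num.sqrt s2 * z) -
      G k (0 + Num.sqrt s2 * z))) @ \oo --> (0 : R).
    apply: (@cvg_Ex_dominated _ _ _ (@stdnormal R) _ (fun=> M' + M')).
    - by move=> k; apply: measurable_funB; [exact: mF0|exact: mG].
    - exact: L1_cst.
    - move=> k z; apply: le_trans (ler_normB _ _) _; apply: lerD; [exact: FM|exact: GM].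
    - apply: aeW => z; apply/cvgrPdist_le => e' e'0.
      have /cvgrPdist_le/(_ _ e'0) := @cvg_lipmin R d F M' (fun=> 0 + Num.sqrt s2 * z) FM cF.
      by apply: filterS => k; rewrite sub0r normrN.
  (* One [k] is fixed for which passing from [F] to its minorant costs at most [e / 2] under the
     Gaussian law. *)
  move/cvgrPdist_le: c0 => /(_ _ e20) [k _ hk].
  have := hk k (leqnn k) => /=; rewrite sub0r normrN ExB// => hkk.
  have ck := @weak_cvg_lip1 (lipmin k%:R F) k%:R M' _ _ _ _.
  have {ck} := ck _ (ler0n _ k) _ _.
  move=> /(_ (fun x => lipmin_bounded x (ler0n _ k) FM cF)).
  move=> /(_ (fun n => measurable_lipmin (ler0n _ k) FM (mX n))).
  move=> /(_ (fun x y => lipmin_lip x y (ler0n _ k) FM)).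
  move=> /cvgrPdist_le/(_ _ e20).
  apply: filterS => n; rewrite ler_norml => /andP[_ hn].
  apply: le_trans (_ : Ex P (fun w => lipmin k%:R F (X n w)) <= _).
    move: hkk; rewrite ler_norml => /andP[_]; rewrite /heat; move: hn; rewrite /heat -/(G k).
    lra.
  apply: Ex_le.
  - apply: (@L1_bounded _ _ _ _ _ M'); first exact: measurable_lipmin FM (mX n).
    by move=> w; exact: lipmin_bounded.
  - by apply: (@L1_bounded _ _ _ _ _ M') => //; exact: measurable_continuous1 FM cF (mX n).
  - by move=> w; exact: lipmin_le_fun FM cF.
move=> F M FM cF; apply/cvgrPdist_le => e e0.
have FMN x : `|- F x| <= M by rewrite normrN.
have cFN : continuous1 (fun x => - F x).
  move=> x e' e'0; have [dl dl0 h] := cF x _ e'0; exists dl => // y /h.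
  by rewrite -opprD normrN.
have l1 := low _ _ _ FM cF e0.
have l2 := low _ _ _ FMN cFN e0.
near=> n.
have h1 : heat s2 (fun z => F (fun=> z)) 0 - e <= Ex P (fun w => F (X n w)) by near: n.
have h2 : heat s2 (fun z => - F (fun=> z)) 0 - e <= Ex P (fun w => - F (X n w)) by near: n.
have exN d' (T' : measurableType d') (Q : probability T' R) (Y : T' -> R) : L1 Q Y ->
    Ex Q (fun w => - Y w) = - Ex Q Y.
  move=> iY; rewrite -mulN1r -ExZ//; congr Ex; apply/funext => w; by rewrite mulN1r.
move: h2; rewrite /heat !exN.
- by rewrite ler_norml => h2; move: h1; rewrite /heat => h1; apply/andP; split; lra.
- by apply: (@L1_bounded _ _ _ _ _ M) => //; exact: measurable_continuous1 FM cF (mX n).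
- apply: (@L1_bounded _ _ _ (@stdnormal R) _ M) => //.
  apply: (measurable_continuous1 (X := fun z (i : 'I_d) => 0 + Num.sqrt s2 * z)) FM cF _ => i.
  exact: measurable_heat_arg.
Unshelve. all: by end_near. Qed.

End weak_convergence.

(** * Max-plus trajectories *)

Section maxplus.
Context {R : realType} {d : nat} (i0 : 'I_d).
Implicit Types (A B : @mp_op R d) (x y : 'I_d -> R) (a : nat -> @mp_op R d) (c : R).

(* [i0] is a default element: the index set is nonempty. *)
Definition vmax x : R := \big[Num.max/x i0]_(i < d) x i.

Lemma le_vmax x i : x i <= vmax x.
Proof. exact: le_bigmax. Qed.

Lemma vmax_le x c : (forall i, x i <= c) -> vmax x <= c.
Proof. by move=> xc; apply: bigmax_le => // i _. Qed.

Lemma vmax_le_shift x y c : (forall i, x i <= y i + c) -> vmax x <= vmax y + c.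
Proof. by move=> xy; apply: vmax_le => i; rewrite (le_trans (xy i))// lerD2r le_vmax. Qed.

Lemma vmax_shift x y c : (forall i, x i = y i + c) -> vmax x = vmax y + c.
Proof.
move=> xy; apply/eqP; rewrite eq_le vmax_le_shift; last by move=> i; rewrite xy.
rewrite -lerBrDr; apply: vmax_le_shift => i; by rewrite xy addrK.
Qed.

(** The absence of [+oo] and one entry above [-oo] in the row make the maximum finite, so [fine]
    loses nothing; order questions on real trajectories then reduce to entries. *)
Lemma mp_applyP A x i c : is_mp_op A ->
  (mp_apply A x i <= c) <-> (forall j, (A i j + (x j)%:E <= c%:E)%E).
Proof.
move=> [Ay ANy]; have [j0 Aj0] := ANy i.
set m := \big[maxe/-oo%E]_(j < d) (A i j + (x j)%:E)%E.
have my : m != +oo%E.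
  rewrite -ltey /m; apply: bigmax_lt => // j _.
  by rewrite lte_add_pinfty ?ltry// ltey.
have mNy : m != -oo%E.
  rewrite -ltNye; apply: (@lt_le_trans _ _ (A i j0 + (x j0)%:E)%E); last exact: le_bigmax.
  by move: Aj0 (Ay i j0); case: (A i j0) => //= r _ _; exact: ltNyr.
have fm : m \is a fin_num by rewrite fin_numE mNy my.
rewrite /mp_apply -/m -lee_fin fineK//; split.
  by move=> mc j; apply: le_trans mc; exact: le_bigmax.
by move=> h; apply: bigmax_le => //; exact: leNye.
Qed.

Lemma mp_apply_ge A x i j : is_mp_op A -> (A i j + (x j)%:E <= (mp_apply A x i)%:E)%E.
Proof. by move=> oA; exact: (iffLR (mp_applyP x i _ oA)). Qed.

Lemma mp_apply_le_shift A x y c : is_mp_op A -> (forall j, x j <= y j + c) ->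
  forall i, mp_apply A x i <= mp_apply A y i + c.
Proof.
move=> oA xy i; apply/(mp_applyP _ _ _ oA) => j; rewrite EFinD.
apply: le_trans (leeD2r _ (mp_apply_ge y i j oA)).
by rewrite -addeA leeD2l// -EFinD lee_fin.
Qed.

Lemma mp_apply_shift A x y c : is_mp_op A -> (forall j, x j = y j + c) ->
  forall i, mp_apply A x i = mp_apply A y i + c.
Proof.
move=> oA xy i; apply/eqP; rewrite eq_le mp_apply_le_shift//; last by move=> j; rewrite xy.
by rewrite -lerBrDr; apply: mp_apply_le_shift => // j; rewrite xy addrK.
Qed.

Lemma is_mp_op_mul A B : is_mp_op A -> is_mp_op B -> is_mp_op (mp_mul A B).
Proof.
move=> [Ay ANy] [By BNy]; split=> [i j|i].
  rewrite -ltey /mp_mul; apply: bigmax_lt => // p _.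
  by rewrite lte_add_pinfty// ltey.
have [p Ap] := ANy i; have [j Bj] := BNy p; exists j.
rewrite -ltNye; apply: (@lt_le_trans _ _ (A i p + B p j)%E).
  by move: Ap Bj (Ay i p) (By p j); case: (A i p) => //= r _; case: (B p j) => //= s _ _ _; exact: ltNyr.
exact: (le_bigmax _ (fun p => A i p + B p j)%E p).
Qed.

Lemma mp_apply_mul A B x i : is_mp_op A -> is_mp_op B ->
  mp_apply (mp_mul A B) x i = mp_apply A (mp_apply B x) i.
Proof.
move=> oA oB; have oAB := is_mp_op_mul oA oB; apply/eqP; rewrite eq_le; apply/andP; split.
  apply/(mp_applyP _ _ _ oAB) => j; rewrite /mp_mul.
  have [By BNy] := oB; have [Ay ANy] := oA.
  rewrite -leeBrDr//; apply: bigmax_le => [|p _]; first exact: leNye.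
  rewrite leeBrDr// -addeA; apply: le_trans (mp_apply_ge _ _ p oA).
  by rewrite leeD2l// mp_apply_ge.
apply/(mp_applyP _ _ _ oA) => p.
have [By BNy] := oB; have [Ay ANy] := oA.
case Aip : (A i p) => [r| |] //; last 2 first.
- by have := Ay i p; rewrite Aip.
- by rewrite addNye leNye.
rewrite -EFinD lee_fin -lerBrDl; apply/(mp_applyP _ _ _ oB) => j.
rewrite EFinB leeBrDl//; apply: le_trans (mp_apply_ge x i j oAB).
rewrite addeA leeD2r// -Aip; exact: (le_bigmax _ (fun p => A i p + B p j)%E p).
Qed.

Lemma is_mp_op_one : is_mp_op (@mp_one R d).
Proof.
split=> [i j|i]; first by rewrite /mp_one; case: ifP.
by exists i; rewrite /mp_one eqxx.
Qed.

Lemma mp_apply_one x i : mp_apply mp_one x i = x i.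
Proof.
apply/eqP; rewrite eq_le; apply/andP; split; last first.
  have := mp_apply_ge x i i is_mp_op_one.
  by rewrite /mp_one eqxx add0e lee_fin.
apply/(mp_applyP _ _ _ is_mp_op_one) => j; rewrite /mp_one.
by case: eqP => [<-|_]; [rewrite add0e|rewrite addNye leNye].
Qed.

(** The image of the zero vector lists the row maxima. The largest entry thus becomes a real number
    read off a trajectory. *)
Lemma mp_maxentryE A : is_mp_op A -> mp_maxentry A = (vmax (mp_apply A (fun=> 0)))%:E.
Proof.
move=> oA; apply/eqP; rewrite eq_le; apply/andP; split.
  apply: bigmax_le => [|i _]; first exact: leNye.
  apply: bigmax_le => [|j _]; first exact: leNye.
  apply: (@le_trans _ _ (mp_apply A (fun=> 0) i)%:E); last by rewrite lee_fin le_vmax.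
  by have := mp_apply_ge (fun=> 0) i j oA; rewrite adde0.
have fm : mp_maxentry A \is a fin_num.
  rewrite fin_numElt; apply/andP; split.
    have [_ /(_ i0)[j Aj]] := oA; apply: (@lt_le_trans _ _ (A i0 j)); first by rewrite ltNye.
    apply: le_trans (le_bigmax _ _ i0); exact: le_bigmax.
  have [Ay _] := oA.
  by apply: bigmax_lt => // i _; apply: bigmax_lt => // j _; rewrite ltey.
rewrite -(fineK fm) lee_fin; apply: vmax_le => i.
apply/(mp_applyP _ _ _ oA) => j; rewrite adde0 fineK//.
apply: le_trans (le_bigmax _ _ i); exact: le_bigmax.
Qed.

Lemma vmax_apply_le A x : is_mp_op A ->
  ((vmax (mp_apply A x))%:E <= mp_maxentry A + (vmax x)%:E)%E.
Proof.
move=> oA; rewrite mp_maxentryE// -EFinD lee_fin; apply: vmax_le => i.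
apply: le_trans (lerD (le_vmax _ i) (lexx _)).
by apply: mp_apply_le_shift => // j; rewrite add0r le_vmax.
Qed.

(** Whichever column carries the largest coordinate of [x], some entry of that column is at least
    [mp_minmax A]. A column of [-oo] makes the bound void. *)
Lemma vmax_apply_ge A x : is_mp_op A ->
  (mp_minmax A + (vmax x)%:E <= (vmax (mp_apply A x))%:E)%E.
Proof.
move=> oA; have key j : (mp_minmax A + (x j)%:E <= (vmax (mp_apply A x))%:E)%E.
  rewrite -leeBrDr//; apply: le_trans (bigmin_le _ j _) _.
  apply: bigmax_le => [|i _]; first exact: leNye.
  rewrite leeBrDr//; apply: le_trans (mp_apply_ge x i j oA) _.
  by rewrite lee_fin le_vmax.
case mA : (mp_minmax A) => [m| |].
- rewrite -EFinD lee_fin -lerBrDl; apply: vmax_le => j.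
  by have := key j; rewrite mA -EFinD lee_fin -lerBrDl.
- by have := key i0; rewrite mA addye.
- by rewrite addNye leNye.
Qed.

(* Sequences are indexed from 0: [a k] plays the role of A(k+1). *)
Fixpoint trj a x n : 'I_d -> R := if n is k.+1 then mp_apply (a k) (trj a x k) else x.

Definition sh n a : nat -> @mp_op R d := fun k => a (n + k)%N.

Definition okseq a := forall k, is_mp_op (a k).

Lemma okseq_sh n a : okseq a -> okseq (sh n a).
Proof. by move=> oa k; exact: oa. Qed.

Lemma trj_add a x n m : trj a x (n + m) = trj (sh n a) (trj a x n) m.
Proof. by elim: m => [|m IH]; rewrite ?addn0// addnS /= IH. Qed.

Lemma trj_ext a b x n : (forall k, (k < n)%N -> a k = b k) -> trj a x n = trj b x n.
Proof.
by elim: n => //= n IH ab; rewrite ab// IH// => k kn; apply: ab; rewrite ltnW.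
Qed.

Lemma trj_le_shift a x y c n : okseq a -> (forall j, x j <= y j + c) ->
  forall i, trj a x n i <= trj a y n i + c.
Proof. by move=> oa xy; elim: n => //= n IH; exact: mp_apply_le_shift. Qed.

Lemma trj_shift a x y c n : okseq a -> (forall j, x j = y j + c) ->
  forall i, trj a x n i = trj a y n i + c.
Proof. by move=> oa xy; elim: n => //= n IH; exact: mp_apply_shift. Qed.

(** The inequality [x <= y + dist1 x y] survives every step, by isotonicity and homogeneity;
    likewise with [x] and [y] exchanged. *)
Lemma trj_nonexpansive a x y n i : okseq a -> `|trj a x n i - trj a y n i| <= dist1 x y.
Proof.
move=> oa; rewrite ler_norml; apply/andP; split.
  rewrite lerBrDl -lerBrDr opprK; apply: trj_le_shift => // j.
  by have := dist1_coord y x j; rewrite dist1C ler_norml => /andP[_]; lra.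
rewrite lerBlDl; apply: trj_le_shift => // j.
by have := dist1_coord x y j; rewrite ler_norml => /andP[_]; lra.
Qed.

(* Rational initial vectors suffice because trajectories are nonexpansive; a
   countable family makes this event measurable. *)
Definition rk1 a n := forall p q i j,
  trj a (ratvec p) n i - trj a (ratvec q) n i = trj a (ratvec p) n j - trj a (ratvec q) n j.

(** The constant is read off at [i0]. Rational vectors within [e / 4] of [x] and [y] move each of
    the four coordinates compared by at most [e / 4]. *)
Lemma rk1P a n : okseq a -> rk1 a n <->
  (forall x y, exists c, forall i, trj a x n i = trj a y n i + c).
Proof.
move=> oa; split=> [ra x y|h p q i j]; last first.
  have [c hc] := h (ratvec p) (ratvec q); rewrite !hc; ring.
exists (trj a x n i0 - trj a y n i0) => i.
apply/eqP; rewrite -subr_eq0 -normr_le0; apply/ler_addgt0Pr => e e0; rewrite add0r.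
have e40 : 0 < e / 4 by rewrite divr_gt0.
have [p hp] := ratvec_dense x e40; have [q hq] := ratvec_dense y e40.
have h1 := trj_nonexpansive x (ratvec p) n i oa.
have h2 := trj_nonexpansive x (ratvec p) n i0 oa.
have h3 := trj_nonexpansive y (ratvec q) n i oa.
have h4 := trj_nonexpansive y (ratvec q) n i0 oa.
have := ra p q i i0.
move: (le_trans h1 (ltW hp)) (le_trans h2 (ltW hp)) (le_trans h3 (ltW hq)) (le_trans h4 (ltW hq)).
rewrite !ler_norml => /andP[? ?] /andP[? ?] /andP[? ?] /andP[? ?] ?.
by apply/andP; split; lra.
Qed.

Lemma rk1_addl a n m : okseq a -> rk1 a n -> rk1 a (n + m).
Proof.
move=> oa /(rk1P _ oa) ra; apply/(rk1P _ oa) => x y; rewrite !trj_add.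
have [c hc] := ra x y; exists c; apply: trj_shift => //; exact: okseq_sh.
Qed.

Lemma rk1_addr a n m : okseq a -> rk1 (sh n a) m -> rk1 a (n + m).
Proof.
move=> oa /(rk1P _ (okseq_sh n oa)) ra; apply/(rk1P _ oa) => x y; rewrite !trj_add.
exact: ra.
Qed.

Lemma rk1_ext a b n : (forall k, (k < n)%N -> a k = b k) -> rk1 a n -> rk1 b n.
Proof.
by move=> ab ra p q i j; have := ra p q i j; rewrite !(trj_ext _ ab).
Qed.

Definition Xm n a : R := vmax (trj a (fun=> 0) n).

Lemma Xm0 a : Xm 0 a = 0.
Proof. by apply: (big_ind (fun u : R => u = 0)) => // u v -> ->; rewrite maxxx. Qed.

Lemma Xm_ext a b n : (forall k, (k < n)%N -> a k = b k) -> Xm n a = Xm n b.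
Proof. by move=> ab; rewrite /Xm (trj_ext _ ab). Qed.

Definition defect n m a : R := Xm n a + Xm m (sh n a) - Xm (n + m) a.

(** A bound for the square of an increment of [vmax] whatever its sign: the first term serves for
    nonnegative increments, the second for negative ones. It is [+oo] if some column is identically
    [-oo]. *)
Definition Qb A : \bar R := (mp_maxentry A * mp_maxentry A + mp_minmax A * mp_minmax A)%E.

Lemma sqr_increment_le A x : is_mp_op A ->
  (((vmax (mp_apply A x) - vmax x) ^+ 2)%:E <= Qb A)%E.
Proof.
move=> oA; have := vmax_apply_le x oA; have := vmax_apply_ge x oA.
rewrite /Qb mp_maxentryE// -EFinD lee_fin.
set M := vmax (mp_apply A (fun=> 0)).
case: (mp_minmax A) => [m| |] //.
  rewrite -EFinD -!EFinM -EFinD !lee_fin => h1 h2.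
  move: (vmax (mp_apply A x)) (vmax x) h1 h2 => u v h1 h2.
  have [uv|uv] := leP 0 (u - v).
    apply: le_trans (_ : M * M <= _); last by rewrite lerDl -expr2 sqr_ge0.
    by rewrite expr2; apply: ler_pM => //; lra.
  apply: le_trans (_ : m * m <= _); last by rewrite lerDr -expr2 sqr_ge0.
  by rewrite -sqrrN expr2 -[m * m]mulrNN; apply: ler_pM => //; lra.
by move=> _ _; rewrite mulNyNy addey// leey.
Qed.

Lemma Xm_increment_le a n : okseq a -> (((Xm n.+1 a - Xm n a) ^+ 2)%:E <= Qb (a n))%E.
Proof. by move=> oa; exact: sqr_increment_le. Qed.

Lemma defect0 n a : defect n 0 a = 0.
Proof. by rewrite /defect Xm0 addn0 addr0 subrr. Qed.

(** After rank 1, the trajectories started from 0 and from the state at time [n] differ by a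
    constant, so the next operator adds the same amount to both maxima. *)
Lemma defect_stable n m a : okseq a -> rk1 (sh n a) m -> defect n m.+1 a = defect n m a.
Proof.
move=> oa ra; have os := okseq_sh n oa.
have /(rk1P _ os)/(_ (fun=> 0) (trj a (fun=> 0) n))[c hc] := ra.
rewrite /defect /Xm addnS /= -[a (n + m)%N]/(sh n a m) trj_add.
rewrite (vmax_shift hc) (vmax_shift (mp_apply_shift (os m) hc)); ring.
Qed.

(** The move is a difference of two increments caused by the same operator, each of square at most
    [Qb]; the 4 comes from [(x - y) ^+ 2 <= 2 * x ^+ 2 + 2 * y ^+ 2]. *)
Lemma defect_increment_le n m a : okseq a ->
  (((defect n m.+1 a - defect n m a) ^+ 2)%:E <= 4%:E * Qb (a (n + m)%N))%E.
Proof.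
move=> oa; have h1 := Xm_increment_le m (okseq_sh n oa).
have h2 := Xm_increment_le (n + m) oa.
rewrite -[sh n a m]/(a (n + m)%N) in h1; move: h1 h2; rewrite /defect addnS.
set u := Xm m.+1 _; set v := Xm m _; set s := Xm (n + m).+1 _; set t := Xm (n + m) _.
case: (Qb _) => [q| |] //; last by move=> _ _; rewrite gt0_muley ?lte_fin// leey.
rewrite -EFinM !lee_fin => h1 h2.
have -> : Xm n a + u - s - (Xm n a + v - t) = (u - v) - (s - t) by ring.
by move: (u - v) (s - t) h1 h2 => x y h1 h2; have := sqr_ge0 (x + y); nra.
Qed.

End maxplus.

(** * Independence *)

Section independence.
Context {R : realType} {dT d1 d2} {T : measurableType dT}
  {T1 : measurableType d1} {T2 : measurableType d2} (P : probability T R).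

Definition image_measure d' {T' : measurableType d'} (m : {measure set T -> \bar R}) (f : T -> T')
    (mf : measurable_fun setT f) : {measure set T' -> \bar R} :=
  measure_function_pushforward__canonical__measure_function_Measure m mf.

Lemma image_measureE d' {T' : measurableType d'} (m : {measure set T -> \bar R}) (f : T -> T')
  (mf : measurable_fun setT f) S : image_measure m mf S = m (f @^-1` S).
Proof. by []. Qed.

Lemma preimage_measurable d' {T' : measurableType d'} (f : T -> T') (S : set T') :
  measurable_fun setT f -> measurable S -> measurable (f @^-1` S).
Proof. by move=> mf mS; rewrite -[X in measurable X]setTI; exact: mf. Qed.

Lemma pi_system_measure_eq d' {T' : measurableType d'} (G : set (set T'))
    (m1 m2 : {measure set T' -> \bar R}) :
  measurable = <<s G >> -> setI_closed G -> G setT -> (m1 setT < +oo)%E ->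
  (forall S, G S -> m1 S = m2 S) -> forall S, measurable S -> m1 S = m2 S.
Proof.
move=> mG GI GT m1T m12; apply: (measure_unique G (fun=> setT)) => //.
by apply/seteqP; split => // x _; exists 0%N.
Qed.

Definition indep (f : T -> T1) (g : T -> T2) := forall S1 S2, measurable S1 -> measurable S2 ->
  P (f @^-1` S1 `&` g @^-1` S2) = (P (f @^-1` S1) * P (g @^-1` S2))%E.

(** Uniqueness of measures is used twice: in [S1] with [S2] in [G2] fixed, then in [S2] with [S1]
    arbitrary. Each side is a finite measure of the free set, a restriction of [P] or a multiple of
    [P], pushed forward. *)
Lemma indep_pi_system (f : T -> T1) (g : T -> T2) (G1 : set (set T1)) (G2 : set (set T2)) :
  measurable_fun setT f -> measurable_fun setT g ->
  measurable = <<s G1 >> -> setI_closed G1 -> G1 setT ->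
  measurable = <<s G2 >> -> setI_closed G2 -> G2 setT ->
  (forall S1 S2, G1 S1 -> G2 S2 ->
    P (f @^-1` S1 `&` g @^-1` S2) = (P (f @^-1` S1) * P (g @^-1` S2))%E) ->
  indep f g.
Proof.
move=> mf mg mG1 GI1 GT1 mG2 GI2 GT2 h12.
have sc (c : \bar R) : (0 <= c)%E -> c \is a fin_num -> exists r : {nonneg R}, r%:num%:E = c.
  case: c => // r; rewrite lee_fin => r0 _; by exists (NngNum r0).
have Pfin S : measurable S -> P S \is a fin_num by move=> mS; exact: fin_num_measure.
have step1 S1 S2 : measurable S1 -> G2 S2 ->
    P (f @^-1` S1 `&` g @^-1` S2) = (P (f @^-1` S1) * P (g @^-1` S2))%E.
  move=> mS1 gS2; have mS2 : measurable S2 by rewrite mG2; exact: sub_sigma_algebra.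
  have mB := preimage_measurable mg mS2.
  have [r rE] := sc _ (measure_ge0 P _) (Pfin _ mB).
  have E1 S : image_measure (mrestr P mB) mf S = P (f @^-1` S `&` g @^-1` S2) by [].
  have E2 S : image_measure (mscale r P) mf S = (P (f @^-1` S) * P (g @^-1` S2))%E.
    by rewrite muleC -rE.
  rewrite -E1 -E2; apply: (pi_system_measure_eq mG1 GI1 GT1) mS1.
    rewrite E1; apply: le_lt_trans (_ : 1 < +oo)%E; last exact: ltry.
    by apply: probability_le1; apply: measurableI => //; exact: preimage_measurable.
  by move=> S gS; rewrite E1 E2 h12.
move=> S1 S2 mS1 mS2.
have mB := preimage_measurable mf mS1.
have [r rE] := sc _ (measure_ge0 P _) (Pfin _ mB).
have E1 S : image_measure (mrestr P mB) mg S = P (f @^-1` S1 `&` g @^-1` S) by rewrite setIC.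
have E2 S : image_measure (mscale r P) mg S = (P (f @^-1` S1) * P (g @^-1` S))%E.
  by rewrite -rE.
rewrite -E1 -E2; apply: (pi_system_measure_eq mG2 GI2 GT2) mS2.
  rewrite E1; apply: le_lt_trans (_ : 1 < +oo)%E; last exact: ltry.
  by apply: probability_le1; apply: measurableI => //; exact: preimage_measurable.
by move=> S gS; rewrite E1 E2 step1.
Qed.

Definition mfun_of d' {T' : measurableType d'} (f : T -> T')
    (mf : measurable_fun setT f) : {mfun T >-> T'} :=
  HB.pack f (isMeasurableFun.Build _ _ _ _ _ mf).

(** Independence identifies the joint law with the product law on rectangles, hence everywhere;
    Tonelli concludes. *)
Lemma indep_ge0_integral (f : T -> T1) (g : T -> T2) (u : T1 -> \bar R) (v : T2 -> \bar R) :
  measurable_fun setT f -> measurable_fun setT g -> indep f g ->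
  measurable_fun setT u -> measurable_fun setT v ->
  (forall x, 0 <= u x)%E -> (forall x, 0 <= v x)%E ->
  (\int[P]_w (u (f w) * v (g w)) = \int[P]_w u (f w) * \int[P]_w v (g w))%E.
Proof.
move=> mf mg ifg mu mv u0 v0.
pose m1 : probability T1 R := distribution P (mfun_of mf).
pose m2 : probability T2 R := distribution P (mfun_of mg).
have mfg : measurable_fun setT (fun w => (f w, g w)) by exact: measurable_fun_pair.
pose m : probability _ R := distribution P (mfun_of mfg).
pose F z := (u z.1 * v z.2)%E.
have mF : measurable_fun setT F.
  apply: emeasurable_funM; first by apply: measurableT_comp => //; exact: measurable_fst.
  by apply: measurableT_comp => //; exact: measurable_snd.
have F0 z : (0 <= F z)%E by exact: mule_ge0.
have -> : (\int[P]_w (u (f w) * v (g w)) = \int[m]_z F z)%E.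
  by rewrite /m /distribution ge0_integral_pushforward.
have -> : (\int[m]_z F z = \int[m1 \x m2]_z F z)%E.
  apply: eq_measure_integral => S mS _; apply/esym.
  by apply: product_measure_unique => // S1 S2 mS1 mS2; exact: ifg.
rewrite fubini_tonelli1// /fubini_F /F /=.
have -> : (\int[P]_w v (g w) = \int[m2]_y v y)%E.
  by rewrite /m2 /distribution ge0_integral_pushforward.
have -> : (\int[P]_w u (f w) = \int[m1]_x u x)%E.
  by rewrite /m1 /distribution ge0_integral_pushforward.
under eq_integral do rewrite ge0_integralZl//.
by rewrite ge0_integralZr//; exact: integral_ge0.
Qed.

Lemma indep_comp_ge0_Ex (f : T -> T1) (g : T -> T2) (u : T1 -> R) (v : T2 -> R) :
  measurable_fun setT f -> measurable_fun setT g -> indep f g ->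
  measurable_fun setT u -> measurable_fun setT v ->
  (forall x, 0 <= u x) -> (forall x, 0 <= v x) ->
  L1 P (u \o f) -> L1 P (v \o g) ->
  L1 P (fun w => u (f w) * v (g w)) /\
  Ex P (fun w => u (f w) * v (g w)) = Ex P (u \o f) * Ex P (v \o g).
Proof.
move=> mf mg ifg mu mv u0 v0 iu iv.
have := @indep_ge0_integral f g (EFin \o u) (EFin \o v) mf mg ifg.
move=> /(_ _ _ (fun x => u0 x) (fun x => v0 x)).
have mu' : measurable_fun setT (EFin \o u) by exact/measurable_EFinP.
have mv' : measurable_fun setT (EFin \o v) by exact/measurable_EFinP.
move=> /(_ mu' mv') /=.
rewrite (EFin_Ex iu) (EFin_Ex iv) -EFinM => h.
have i : L1 P (fun w => u (f w) * v (g w)).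
  apply/integrableP; split.
    apply/measurable_EFinP; apply: measurable_funM.
      exact: (L1_measurable iu).
    exact: (L1_measurable iv).
  under eq_integral do rewrite /= ger0_norm ?mulr_ge0//.
  by rewrite h ltry.
by split => //; have [] := etrans (esym (EFin_Ex i)) h.
Qed.

Lemma indep_Ex (f : T -> T1) (g : T -> T2) (u : T1 -> R) (v : T2 -> R) :
  measurable_fun setT f -> measurable_fun setT g -> indep f g ->
  measurable_fun setT u -> measurable_fun setT v ->
  L1 P (u \o f) -> L1 P (v \o g) ->
  Ex P (fun w => u (f w) * v (g w)) = Ex P (u \o f) * Ex P (v \o g).
Proof.
move=> mf mg ifg mu mv iu iv.
have mpos d' (T' : measurableType d') (h : T' -> R) : measurable_fun setT h ->
   measurable_fun setT (fun x => Num.max (h x) 0) by move=> mh; exact: measurable_maxr.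
have mneg d' (T' : measurableType d') (h : T' -> R) : measurable_fun setT h ->
   measurable_fun setT (fun x => Num.max (- h x) 0).
  by move=> mh; apply: measurable_maxr => //; exact: measurableT_comp.
have p0 (x : R) : 0 <= Num.max x 0 by rewrite le_max lexx orbT.
have pd (x : R) : x = Num.max x 0 - Num.max (- x) 0.
  by have [h|h] := leP x 0; have [h'|h'] := leP (- x) 0; lra.
have pn (x : R) : `|Num.max x 0| <= `|x|.
  by have [h|h] := leP x 0; rewrite ?normr0.
have ip (h : T -> R) : L1 P h -> L1 P (fun w => Num.max (h w) 0).
  move=> ih; apply: L1_le (L1_abs ih) _ => //; exact: mpos (L1_measurable ih).
have im (h : T -> R) : L1 P h -> L1 P (fun w => Num.max (- h w) 0).
  move=> ih; apply: L1_le (L1_abs ih) _; first exact: mneg (L1_measurable ih).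
  by move=> w; rewrite -(normrN (h w)).
have [i1 e1] := indep_comp_ge0_Ex mf mg ifg (mpos _ _ _ mu) (mpos _ _ _ mv)
  (fun x => p0 _) (fun x => p0 _) (ip _ iu) (ip _ iv).
have [i2 e2] := indep_comp_ge0_Ex mf mg ifg (mpos _ _ _ mu) (mneg _ _ _ mv)
  (fun x => p0 _) (fun x => p0 _) (ip _ iu) (im _ iv).
have [i3 e3] := indep_comp_ge0_Ex mf mg ifg (mneg _ _ _ mu) (mpos _ _ _ mv)
  (fun x => p0 _) (fun x => p0 _) (im _ iu) (ip _ iv).
have [i4 e4] := indep_comp_ge0_Ex mf mg ifg (mneg _ _ _ mu) (mneg _ _ _ mv)
  (fun x => p0 _) (fun x => p0 _) (im _ iu) (im _ iv).
have -> : Ex P (u \o f) = Ex P (fun w => Num.max (u (f w)) 0) - Ex P (fun w => Num.max (- u (f w)) 0).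
  by rewrite -ExB//; [congr Ex; apply/funext => w; exact: pd|exact: ip|exact: im].
have -> : Ex P (v \o g) = Ex P (fun w => Num.max (v (g w)) 0) - Ex P (fun w => Num.max (- v (g w)) 0).
  by rewrite -ExB//; [congr Ex; apply/funext => w; exact: pd|exact: ip|exact: im].
rewrite mulrBl !mulrBr.
rewrite -[X in X - _ - _]e1 -[X in _ - X - _]e2 -[X in _ - (X - _)]e3 -[X in _ - (_ - X)]e4.
rewrite -(ExB i1 i2) -(ExB i3 i4) -(ExB (L1B i1 i2) (L1B i3 i4)).
congr Ex; apply/funext => w.
by rewrite [X in X * _]pd [X in _ * X]pd; ring.
Qed.

End independence.

(** * Sequences of operators *)

Section sequence_space.
Context {R : realType} {d : nat} (i0 : 'I_d).
Local Notation op := (@mp_op R d).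
Implicit Types (x : 'I_d -> R).

Definition entry_sets : set (set ('I_d -> 'I_d -> \bar R)) :=
  [set S | exists i j (B : set (\bar R)), measurable B /\ S = [set M | B (M i j)]].

(** The constraints bear on an initial segment, not on an arbitrary finite set of coordinates: an
    intersection only needs the longer segment, and [setT] is the case [m = 0]. *)
Definition cylinders : set (set (nat -> 'I_d -> 'I_d -> \bar R)) :=
  [set C | exists m (S : nat -> set op), (forall k, mp_op_sigma (S k)) /\
     C = [set a | forall k, (k < m)%N -> S k (a k)]].

Definition mseq := g_sigma_algebraType cylinders.

Lemma mp_op_sigmaI (A B : set op) : mp_op_sigma A -> mp_op_sigma B -> mp_op_sigma (A `&` B).
Proof. exact: (@measurableI _ (g_sigma_algebraType entry_sets)). Qed.

Lemma mp_op_sigmaT : mp_op_sigma (setT : set op).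
Proof. exact: (@measurableT _ (g_sigma_algebraType entry_sets)). Qed.

Lemma cylinders_setI : setI_closed cylinders.
Proof.
move=> _ _ [m1 [S1 [mS1 ->]]] [m2 [S2 [mS2 ->]]].
exists (maxn m1 m2), (fun k => (if (k < m1)%N then S1 k else setT) `&` (if (k < m2)%N then S2 k else setT)).
split.
  by move=> k; apply: mp_op_sigmaI; case: ifP => // _; exact: mp_op_sigmaT.
apply/seteqP; split => a /=.
  by move=> [h1 h2] k _; split; case: ifP => // ?; [exact: h1|exact: h2].
move=> h; split => k km.
  by have := h k; rewrite leq_max km => /(_ isT)[].
by have := h k; rewrite leq_max km orbT => /(_ isT)[].
Qed.

Lemma cylindersT : cylinders setT.
Proof.
exists 0%N, (fun=> setT); split; first by move=> _; exact: mp_op_sigmaT.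
by apply/seteqP; split.
Qed.

Lemma measurable_mseq : @measurable _ mseq = <<s cylinders >>.
Proof. by []. Qed.

Lemma measurable_coord k i j : measurable_fun setT (fun a : mseq => a k i j).
Proof.
move=> _ B mB; rewrite setTI; apply: sub_sigma_algebra.
exists k.+1, (fun l => if l == k then [set M : op | B (M i j)] else setT); split.
  move=> l; case: eqP => _; last exact: mp_op_sigmaT.
  by apply: sub_sigma_algebra; exists i, j, B.
apply/seteqP; split => a /=.
  by move=> h l _; case: eqP => [->|].
by move/(_ k (ltnSn k)); rewrite eqxx.
Qed.

Lemma mp_op_sigma_preimage {dT} {T : measurableType dT} (f : T -> op) S :
  (forall i j, measurable_fun setT (fun w => f w i j)) -> mp_op_sigma S ->
  measurable (f @^-1` S).
Proof.
move=> mf mS; have m : measurable_fun setT (f : T -> g_sigma_algebraType entry_sets).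
  apply: (@measurability _ _ T (g_sigma_algebraType entry_sets) setT f entry_sets) => //.
  move=> _ [_ [i [j [B [mB ->]]]] <-]; exact: mf.
by rewrite -[X in measurable X]setTI; exact: m.
Qed.

Lemma measurable_to_mseq {dT} {T : measurableType dT} (f : T -> mseq) :
  (forall k i j, measurable_fun setT (fun w => f w k i j)) -> measurable_fun setT f.
Proof.
move=> mf; apply: (@measurability _ _ T mseq setT f cylinders) => //.
move=> _ [_ [m [S [mS ->]]] <-]; rewrite setTI.
have -> : f @^-1` [set a | forall k, (k < m)%N -> S k (a k)] =
    \bigcap_(k in [set k | (k < m)%N]) ((fun w => f w k) @^-1` S k).
  by apply/seteqP; split => w /=; apply.
by apply: bigcap_measurableType => k _; exact: mp_op_sigma_preimage.
Qed.

Lemma measurable_sh n : measurable_fun setT (@sh R d n : mseq -> mseq).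
Proof. by apply: measurable_to_mseq => k i j; exact: measurable_coord. Qed.

Lemma measurable_bigmaxe {dT} {T : measurableType dT} (I : Type) (s : seq I) (f : I -> T -> \bar R) :
  (forall i, measurable_fun setT (f i)) ->
  measurable_fun setT (fun w => \big[maxe/-oo%E]_(i <- s) f i w).
Proof.
move=> mf; elim: s => [|i s IH].
  by under eq_fun do rewrite big_nil; exact: measurable_cst.
under eq_fun do rewrite big_cons; exact: measurable_maxe.
Qed.

Lemma measurable_bigmine {dT} {T : measurableType dT} (I : Type) (s : seq I) (f : I -> T -> \bar R) :
  (forall i, measurable_fun setT (f i)) ->
  measurable_fun setT (fun w => \big[mine/+oo%E]_(i <- s) f i w).
Proof.
move=> mf; elim: s => [|i s IH].
  by under eq_fun do rewrite big_nil; exact: measurable_cst.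
under eq_fun do rewrite big_cons; exact: measurable_mine.
Qed.

Lemma measurable_trj {dT} {T : measurableType dT} (f : T -> nat -> op) (x : T -> 'I_d -> R) n i :
  (forall k i j, measurable_fun setT (fun w => f w k i j)) ->
  (forall i, measurable_fun setT (fun w => x w i)) ->
  measurable_fun setT (fun w => trj (f w) (x w) n i).
Proof.
move=> mf mx; elim: n i => [|n IH] i /=; first exact: mx.
apply: measurableT_comp; first exact: fine_measurable.
apply: measurable_bigmaxe => j; apply: emeasurable_funD => //.
exact/measurable_EFinP.
Qed.

Lemma measurable_vmax {dT} {T : measurableType dT} (x : T -> 'I_d -> R) :
  (forall i, measurable_fun setT (fun w => x w i)) ->
  measurable_fun setT (fun w => vmax i0 (x w)).
Proof.
move=> mx; rewrite /vmax; elim: (index_enum _) => [|j s IH].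
  by under eq_fun do rewrite big_nil; exact: mx.
under eq_fun do rewrite big_cons; exact: measurable_maxr.
Qed.

Lemma measurable_trj_mseq x n i : measurable_fun setT (fun a : mseq => trj a x n i).
Proof.
by apply: (measurable_trj (f := fun a : mseq => a)) => *; [exact: measurable_coord|exact: measurable_cst].
Qed.

Lemma measurable_Xm n : measurable_fun setT (Xm i0 n : mseq -> R).
Proof. by apply: measurable_vmax => i; exact: measurable_trj_mseq. Qed.

Lemma measurable_defect n m : measurable_fun setT (defect i0 n m : mseq -> R).
Proof.
apply: measurable_funB; last exact: measurable_Xm.
apply: measurable_funD; first exact: measurable_Xm.
exact: (measurableT_comp (measurable_Xm m) (measurable_sh n)).
Qed.

Lemma measurable_rk1 n : measurable [set a : mseq | rk1 a n].
Proof.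
(* [g p q a] vanishes exactly when the difference of the two trajectories has equal coordinates; two
   countable intersections then describe the event. *)
pose g p q (a : mseq) : R := \sum_(i < d)
  `|(trj a (ratvec p) n i - trj a (ratvec q) n i) - (trj a (ratvec p) n i0 - trj a (ratvec q) n i0)|.
have mg p q : measurable_fun setT (g p q).
  apply: measurable_sum => i; apply: measurableT_comp => //.
  by apply: measurable_funB; apply: measurable_funB; exact: measurable_trj_mseq.
have -> : [set a : mseq | rk1 a n] = \bigcap_p \bigcap_q (g p q @^-1` [set 0]).
  apply/seteqP; split => a /= h.
    move=> p _ q _; rewrite /= /g big1// => i _.
    by rewrite (h p q i i0) subrr normr0.
  move=> p q i j.
  have /(_ p I q I)/= /eqP := h; rewrite /g psumr_eq0// => /allP h0.
  have eqi l : trj a (ratvec p) n l - trj a (ratvec q) n l =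
      trj a (ratvec p) n i0 - trj a (ratvec q) n i0.
    have := h0 l; rewrite mem_index_enum => /(_ isT)/=.
    by rewrite normr_eq0 subr_eq0 => /eqP.
  by rewrite !eqi.
apply: bigcapT_measurable => p; apply: bigcapT_measurable => q.
by rewrite -[X in measurable X]setTI; exact: mg.
Qed.

Lemma measurable_maxentry {dT} {T : measurableType dT} (f : T -> op) :
  (forall i j, measurable_fun setT (fun w => f w i j)) ->
  measurable_fun setT (fun w => mp_maxentry (f w)).
Proof. by move=> mf; do 2 (apply: measurable_bigmaxe => ?). Qed.

Lemma measurable_minmax {dT} {T : measurableType dT} (f : T -> op) :
  (forall i j, measurable_fun setT (fun w => f w i j)) ->
  measurable_fun setT (fun w => mp_minmax (f w)).
Proof. by move=> mf; apply: measurable_bigmine => ?; apply: measurable_bigmaxe => ?. Qed.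

Lemma measurable_Qb k : measurable_fun setT (fun a : mseq => Qb (a k)).
Proof.
apply: emeasurable_funD; apply: emeasurable_funM.
all: by [apply: measurable_maxentry; exact: measurable_coord|
         apply: measurable_minmax; exact: measurable_coord].
Qed.

Lemma Qb_ge0 (A : op) : (0 <= Qb A)%E.
Proof. by apply: adde_ge0; rewrite -expe2 sqre_ge0. Qed.

End sequence_space.

(** Induction step for the bound [12 * C * sqrt k - 6 * C] when two orthogonal errors are joined at
    cost [C]. With [u], [v], [s] the roots of [p], [r], [p + r], the negative term earns
    [144 * (u + v) >= 192 * s], as the halves are nearly equal; the cost asks for [168 * s], and
    [s >= 1] settles the constants. *)
Lemma balanced_step {R : realType} (p r : nat) (x y C : R) : (0 < p)%N -> (p <= r <= p.+1)%N ->
  0 < C -> 0 <= x -> 0 <= y ->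
  x <= 12 * C * Num.sqrt p%:R - 6 * C -> y <= 12 * C * Num.sqrt r%:R - 6 * C ->
  Num.sqrt (x ^+ 2 + y ^+ 2) + C <= 12 * C * Num.sqrt (p + r)%:R - 6 * C.
Proof.
move=> p0 /andP[pr rp] C0 x0 y0.
set u := Num.sqrt p%:R; set v := Num.sqrt r%:R; set s := Num.sqrt (p + r)%:R.
have u2 : u ^+ 2 = p%:R by rewrite sqr_sqrtr.
have v2 : v ^+ 2 = r%:R by rewrite sqr_sqrtr.
have s2 : s ^+ 2 = u ^+ 2 + v ^+ 2 by rewrite sqr_sqrtr// natrD u2 v2.
have u1 : 1 <= u by rewrite -sqrtr1 ler_wsqrtr// ler1n.
have uv : u <= v by rewrite ler_wsqrtr// ler_nat.
have v2u : v ^+ 2 <= 2 * u ^+ 2 by rewrite u2 v2 -natrM ler_nat; lia.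
have s1 : 1 <= s by rewrite -sqrtr1 ler_wsqrtr// ler1n; lia.
move: u v s u1 uv s1 v2u s2 {u2 v2} => u v s u1 uv s1 v2u s2 hx hy.
have uvs : 4 * s <= 3 * (u + v).
  rewrite -(@ler_pXn2r _ 2)// ?nnegrE; [|lra|lra].
  rewrite !exprMn s2; have := mulr_ge0 (_ : 0 <= v - u) (_ : 0 <= 2 * u - v).
  have : 0 <= v - u by lra.
  have v2' : v <= 2 * u by nra.
  nra.
have B0 : 0 <= 12 * C * s - 7 * C.
  have -> : 12 * C * s - 7 * C = C * (12 * s - 7) by ring.
  by rewrite mulr_ge0 ?(ltW C0)//; lra.
suff : Num.sqrt (x ^+ 2 + y ^+ 2) <= 12 * C * s - 7 * C by lra.
rewrite -(ger0_norm B0) -sqrtr_sqr ler_wsqrtr//.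
have -> : 12 * C * s - 7 * C = C * (12 * s - 7) by ring.
have hx2 : x ^+ 2 <= (C * (12 * u - 6)) ^+ 2 by rewrite ler_sqr ?nnegrE; lra.
have hy2 : y ^+ 2 <= (C * (12 * v - 6)) ^+ 2 by rewrite ler_sqr ?nnegrE; lra.
apply: le_trans (lerD hx2 hy2) _; rewrite !exprMn -mulrDr ler_wpM2l ?sqr_ge0//.
have -> : (12 * u - 6) ^+ 2 + (12 * v - 6) ^+ 2 = 144 * s ^+ 2 - 144 * (u + v) + 72 by rewrite s2; ring.
have -> : (12 * s - 7) ^+ 2 = 144 * s ^+ 2 - 168 * s + 49 by ring.
lra.
Qed.

Lemma lin3_bound {R : realType} (a b c x y : R) : 0 <= a -> 0 <= b -> 0 <= c -> 0 <= x -> 0 <= y ->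
  a * x + b * y + c * y <= (a + b + c) * (x + y).
Proof.
move=> a0 b0 c0 x0 y0.
have := mulr_ge0 a0 y0; have := mulr_ge0 b0 x0; have := mulr_ge0 c0 x0; lra.
Qed.

(** * Dependence on the variance, and Gaussian expectations *)

Section heat_gauss.
Context {R : realType}.

Lemma taylor2_lipschitz (B : R) h : taylor2 B h -> forall x y, `|h x - h y| <= 3 * B * `|x - y|.
Proof.
move=> tB x y; have B0 := taylor2_ge0 tB.
have [h1|h1] := leP `|x - y| 1.
  by have := taylor2_lip tB y h1; rewrite subrKC.
have hB := taylor2_bounded tB.
apply: le_trans (ler_normB _ _) _; have := hB x; have := hB y.
have : B * 1 <= B * `|x - y| by rewrite ler_wpM2l// ltW.
lra.
Qed.

Lemma heat_dist (B : R) h s t : taylor2 B h -> 0 <= s -> 0 <= t -> `|s - t| <= 1 ->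
  `|heat s h 0 - heat t h 0| <= B * (1 + kappa3) * `|s - t|.
Proof.
move=> tB; wlog st : s t / t <= s.
  move=> wl s0 t0 st1; have [ts|/ltW st] := leP t s; first exact: wl.
  by rewrite distrC [`|s - t|]distrC; apply: wl => //; rewrite distrC.
move=> s0 t0; rewrite (ger0_norm (_ : 0 <= s - t)) ?subr_ge0// => st1.
have := @heat_lip R B h t (s - t) tB t0 _ st1 0.
by rewrite subrKC subr_ge0; exact.
Qed.

(** A positive variance calls for the affine substitution; [M] is added to make the integrand
    nonnegative and removed at the end. *)
Lemma gauss_expectE (s2 : R) (g : R -> R) (M : R) : 0 <= s2 -> continuous g ->
  (forall x, `|g x| <= M) -> gauss_expect s2 g = (heat s2 g 0)%:E.
Proof.
move=> s20 cg gM; rewrite /gauss_expect; case: eqP => [->|/eqP s2n]; first by rewrite heat0.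
have a0 : 0 < Num.sqrt s2 by rewrite sqrtr_gt0 lt_def s2n.
have mg : measurable_fun setT g by exact: continuous_measurable_fun.
pose h x := g x + M.
have ch : continuous h by move=> x; apply: cvgD; [exact: cg|exact: cvg_cst].
have h0 x : 0 <= h x by have := gM x; rewrite /h ler_norml; lra.
have := normal_affine 0 a0 ch h0.
have ig := L1_heat s2 0 mg gM.
have -> : (fun z => (h (Num.sqrt s2 * z + 0))%:E) = (fun z => (g (0 + Num.sqrt s2 * z) + M)%:E).
  by apply/funext => z; rewrite /h addr0 add0r.
rewrite (@EFin_Ex _ _ _ (@stdnormal R) (fun z => g (0 + Num.sqrt s2 * z) + M)); last first.
  by apply: L1D => //; exact: L1_cst.
rewrite ExD//; last exact: L1_cst.
rewrite Ex_cst.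
have ip := @integrable_normal_pdf R 0 (Num.sqrt s2).
have mp := @measurable_normal_pdf R 0 (Num.sqrt s2).
have igp : (@lebesgue_measure R).-integrable setT (fun x => (g x * normal_pdf 0 (Num.sqrt s2) x)%:E).
  have iM := integrableZl measurableT M ip.
  apply: le_integrable iM => //.
    by apply/measurable_EFinP; apply: measurable_funM.
  move=> x _; rewrite -EFinM /= lee_fin !normrM ler_wpM2r//.
  by rewrite (le_trans (gM x))// ler_norm.
have -> : (fun y => (h y * normal_pdf 0 (Num.sqrt s2) y)%:E) =
  (fun y => (g y * normal_pdf 0 (Num.sqrt s2) y)%:E + M%:E * (normal_pdf 0 (Num.sqrt s2) y)%:E)%E.
  by apply/funext => y; rewrite -EFinM -EFinD /h mulrDl.
rewrite integralD//; last by apply: integrableZl.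
rewrite integralZl// integral_normal_pdf mule1.
have fin := integrable_fin_num measurableT igp.
by rewrite -(fineK fin) -EFinD => -[] /addIr e; rewrite /heat e.
Qed.

End heat_gauss.

Lemma cvg_squeeze0 {R : realType} (u v : nat -> R) : (forall n, 0 <= u n <= v n) ->
  v @ \oo --> (0 : R) -> u @ \oo --> (0 : R).
Proof.
move=> uv v0; apply: (@squeeze_cvgr _ _ _ _ (fun=> 0) v) => //.
  by apply: nearW.
exact: cvg_cst.
Qed.

(** * The random product *)

Section driving_sequence.
Context {R : realType} {d : nat} (i0 : 'I_d) {dO} {Omega : measurableType dO}
  (P : probability Omega R) (A : nat -> Omega -> @mp_op R d) (X0 : Omega -> 'I_d -> R).
Hypothesis oA : forall n w, is_mp_op (A n w).
Hypothesis mA : forall n i j, measurable_fun setT (fun w => A n w i j).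
Hypothesis iA : mutual_indep P (fun n => if n is k.+1 then sigma_of (A k.+1) mp_op_sigma
                           else sigma_of X0 vec_sigma).
Hypothesis idA : forall n S, (0 < n)%N -> mp_op_sigma S -> P (A n @^-1` S) = P (A 1%N @^-1` S).
Implicit Types (C : set (@mseq R d)).

(** * Stationarity, and independence of past and future *)

Definition shw s w : @mseq R d := fun k => A (s + k).+1 w.

(* Padded with the identity, so that past and future live in the same measurable space. *)
Definition pastw n w : @mseq R d := fun k => if (k < n)%N then A k.+1 w else mp_one.

Lemma okseq_shw s w : okseq (shw s w). Proof. by move=> k; exact: oA. Qed.

Lemma sh_shw n s w : sh n (shw s w) = shw (s + n) w.
Proof. by apply/funext => k; rewrite /sh /shw addnA. Qed.

Lemma measurable_shw s : measurable_fun setT (shw s).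
Proof. by apply: measurable_to_mseq => k i j; exact: mA. Qed.

Lemma measurable_pastw n : measurable_fun setT (pastw n).
Proof.
apply: measurable_to_mseq => k i j; rewrite /pastw; case: (k < n)%N; last exact: measurable_cst.
exact: mA.
Qed.

(** Mutual independence is applied to the indices from [s + 1] to [s + m], and equidistribution
    brings each factor back to [A 1]. The result is free of [s], which is the source of
    stationarity. *)
Lemma cylinder_prob s m (S : nat -> set (@mp_op R d)) : (forall k, mp_op_sigma (S k)) ->
  P [set w | forall k, (k < m)%N -> S k (A (s + k).+1 w)] =
  (\big[*%E/1%E]_(k < m) P (A 1%N @^-1` S k))%E.
Proof.
move=> mS; pose t := [seq (s + k).+1 | k <- iota 0 m].
pose E n := A n @^-1` S (n - s.+1)%N.
have tP n : n \in t -> exists2 k, (k < m)%N & n = (s + k).+1.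
  by move=> /mapP[k]; rewrite mem_iota => km ->; exists k.
have ut : uniq t by rewrite map_inj_uniq ?iota_uniq// => x y; lia.
have FE n : n \in t -> (if n is k.+1 then sigma_of (A k.+1) mp_op_sigma
    else sigma_of X0 vec_sigma) (E n).
  by move=> /tP[k _ ->]; exists (S (s + k - s)%N).
have := iA ut FE.
have -> : [set w | forall n, n \in t -> E n w] =
    [set w | forall k, (k < m)%N -> S k (A (s + k).+1 w)].
  apply/seteqP; split => w /= h.
    move=> k km; have /h : (s + k).+1 \in t by apply: map_f; rewrite mem_iota.
    by rewrite /E /= subSS addKn.
  by move=> n /tP[k km ->]; rewrite /E /= subSS addKn; exact: h.
move=> ->; rewrite /t big_map -{1}[m]subn0 -/(index_iota 0 m) big_mkord.
by apply: eq_bigr => k _; rewrite /E subSS addKn idA.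
Qed.

Lemma shw_law s C : measurable C -> P (shw s @^-1` C) = P (shw 0 @^-1` C).
Proof.
move=> mC.
apply: (pi_system_measure_eq (m1 := image_measure P (measurable_shw s))
  (m2 := image_measure P (measurable_shw 0))
  (@measurable_mseq R d) (@cylinders_setI R d) (@cylindersT R d)) mC.
  by apply: (@le_lt_trans _ _ (P setT)); [exact: lexx|rewrite probability_setT ltry].
move=> _ [m [S [mS ->]]]; rewrite !image_measureE.
by rewrite [LHS](cylinder_prob s m mS) [RHS](cylinder_prob 0 m mS).
Qed.

(** On cylinders, a past event and a future one form together a single cylinder, whose product of
    probabilities splits at [n]. *)
Lemma indep_past_shw n : indep P (pastw n) (shw n).
Proof.
apply: (indep_pi_system (measurable_pastw n) (measurable_shw n)
  (@measurable_mseq R d) (@cylinders_setI R d) (@cylindersT R d)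
  (@measurable_mseq R d) (@cylinders_setI R d) (@cylindersT R d)).
move=> _ _ [m1 [S1 [mS1 ->]]] [m2 [S2 [mS2 ->]]].
(* Constraints at the padded coordinates bear on the constant [mp_one]: either they all hold or the
   event is empty. *)
have [one|] := pselect (forall k, (n <= k < m1)%N -> S1 k mp_one); last first.
  move=> h; have -> : pastw n @^-1` [set a | forall k, (k < m1)%N -> S1 k (a k)] = set0.
    apply/seteqP; split => // w /= h1; apply: h => k /andP[nk km].
    by have := h1 k km; rewrite /pastw ltnNge nk.
  by rewrite set0I measure0 mul0e.
pose S k := if (k < n)%N then (if (k < m1)%N then S1 k else setT) else S2 (k - n)%N.
have mS k : mp_op_sigma (S k).
  by rewrite /S; do 2 (case: ifP => // _); exact: mp_op_sigmaT.
have e1 : pastw n @^-1` [set a | forall k, (k < m1)%N -> S1 k (a k)] =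
    [set w | forall k, (k < n)%N -> S k (A (0 + k).+1 w)].
  apply/seteqP; split => w /= h k.
    by move=> kn; rewrite /S kn; case: ifP => // /h; rewrite /pastw kn.
  move=> km; rewrite /pastw; case: ifP => kn; last by apply: one; rewrite km leqNgt kn.
  by have := h k kn; rewrite /S kn km.
have e2 : shw n @^-1` [set a | forall k, (k < m2)%N -> S2 k (a k)] =
    [set w | forall k, (k < m2)%N -> S2 k (A (n + k).+1 w)] by [].
have e12 : [set w | forall k, (k < n)%N -> S k (A (0 + k).+1 w)] `&`
    [set w | forall k, (k < m2)%N -> S2 k (A (n + k).+1 w)] =
    [set w | forall k, (k < n + m2)%N -> S k (A (0 + k).+1 w)].
  apply/seteqP; split => w /=.
    move=> [h1 h2] k km; have [kn|nk] := ltnP k n; first exact: h1.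
    by rewrite /S ltnNge nk /= -{2}(subnKC nk); apply: h2; lia.
  move=> h; split => k km; first by apply: h; lia.
  have := h (n + k)%N; rewrite /S (_ : (n + k < n)%N = false); last by lia.
  by rewrite addKn; apply; lia.
rewrite e1 e2 e12 (cylinder_prob 0 _ mS) (cylinder_prob 0 _ mS) (cylinder_prob n _ mS2).
rewrite big_split_ord /=; congr (_ * _)%E; apply: eq_bigr => k _.
by rewrite /S (_ : (n + k < n)%N = false) ?addKn//; lia.
Qed.

Lemma shw_ge0_integral s (u : @mseq R d -> \bar R) : measurable_fun setT u ->
  (forall a, 0 <= u a)%E -> (\int[P]_w u (shw s w) = \int[P]_w u (shw 0 w))%E.
Proof.
move=> mu u0.
have e r : (\int[P]_w u (shw r w) = \int[image_measure P (measurable_shw r)]_a u a)%E.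
  by rewrite ge0_integral_pushforward//; exact: measurable_shw.
rewrite !e; apply: eq_measure_integral => C mC _; exact: shw_law.
Qed.

Lemma shw_integral s (u : @mseq R d -> \bar R) : measurable_fun setT u ->
  (\int[P]_w u (shw s w) = \int[P]_w u (shw 0 w))%E.
Proof.
move=> mu; rewrite integralE [RHS]integralE.
have ep r : (\int[P]_w ((fun w => u (shw r w))^\+ w) = \int[P]_w (u^\+ (shw r w)))%E.
  by apply: eq_integral => w _; rewrite !funeposE.
have en r : (\int[P]_w ((fun w => u (shw r w))^\- w) = \int[P]_w (u^\- (shw r w)))%E.
  by apply: eq_integral => w _; rewrite !funenegE.
rewrite !ep !en; congr (_ - _)%E; apply: shw_ge0_integral => //.
  exact: measurable_funepos.
exact: measurable_funeneg.
Qed.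

Lemma shw_Ex s (u : @mseq R d -> R) : measurable_fun setT u ->
  Ex P (fun w => u (shw s w)) = Ex P (fun w => u (shw 0 w)).
Proof.
move=> mu; congr fine; apply: (shw_integral s (u := fun a => (u a)%:E)).
exact/measurable_EFinP.
Qed.

Lemma shw_L1 s (u : @mseq R d -> R) : measurable_fun setT u ->
  L1 P (fun w => u (shw 0 w)) -> L1 P (fun w => u (shw s w)).
Proof.
move=> mu /integrableP[_ h]; apply/integrableP; split.
  by apply/measurable_EFinP; apply: measurableT_comp => //; exact: measurable_shw.
rewrite (shw_ge0_integral s (u := fun a => `|(u a)%:E|%E))//.
by apply: measurableT_comp => //; exact/measurable_EFinP.
Qed.

Lemma shw_L2 s (u : @mseq R d -> R) : measurable_fun setT u ->
  L2 P (fun w => u (shw 0 w)) -> L2 P (fun w => u (shw s w)).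
Proof.
move=> mu [_ i2]; split; first by apply: measurableT_comp => //; exact: measurable_shw.
by apply: (shw_L1 s (u := fun a => u a ^+ 2)) => //; exact: measurable_funX.
Qed.

Lemma shw_nrm s (u : @mseq R d -> R) : measurable_fun setT u ->
  nrm P (fun w => u (shw s w)) = nrm P (fun w => u (shw 0 w)).
Proof.
move=> mu; congr Num.sqrt; apply: (shw_Ex s (u := fun a => u a ^+ 2)).
exact: measurable_funX.
Qed.

Lemma L2_of_integral (Y : Omega -> R) (c : R) : 0 <= c -> measurable_fun setT Y ->
  (\int[P]_w ((Y w ^+ 2)%:E) <= c%:E)%E -> L2 P Y /\ nrm P Y <= Num.sqrt c.
Proof.
move=> c0 mY h; have i2 : L1 P (fun w => Y w ^+ 2).
  apply/integrableP; split; first by apply/measurable_EFinP; exact: measurable_funX.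
  under eq_integral do rewrite /= ger0_norm ?sqr_ge0//.
  exact: le_lt_trans h (ltry _).
split; first by split.
by rewrite /nrm ler_sqrt// -lee_fin -EFin_Ex.
Qed.

Hypothesis fQ : (\int[P]_w Qb (A 1%N w) < +oo)%E.

Definition EQb : R := fine (\int[P]_w Qb (A 1%N w))%E.

Lemma EQb_ge0 : 0 <= EQb.
Proof. by apply: fine_ge0; apply: integral_ge0 => w _; exact: Qb_ge0. Qed.

Lemma EQbE k : (\int[P]_w Qb (shw k w 0%N) = EQb%:E)%E.
Proof.
rewrite (shw_ge0_integral k (u := fun a => Qb (a 0%N))); last 2 first.
- exact: (measurable_Qb 0).
- by move=> a; exact: Qb_ge0.
rewrite /EQb fineK// ge0_fin_numE//.
by apply: integral_ge0 => w _; exact: Qb_ge0.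
Qed.

(** * The time needed to reach rank 1 *)

Definition nrk1 k : set (@mseq R d) := [set a | ~ rk1 a k].

Lemma measurable_nrk1 k : measurable (nrk1 k).
Proof. by apply: measurableC; exact: (measurable_rk1 i0 k). Qed.

Definition nrk1_prob k : R := fine (P (shw 0 @^-1` nrk1 k)).

Lemma measurable_shw_nrk1 s k : measurable (shw s @^-1` nrk1 k).
Proof. by apply: preimage_measurable; [exact: measurable_shw|exact: measurable_nrk1]. Qed.

Lemma nrk1_probE s k : P (shw s @^-1` nrk1 k) = (nrk1_prob k)%:E.
Proof.
rewrite shw_law; last exact: measurable_nrk1.
by rewrite /nrk1_prob fineK//; apply: fin_num_measure; exact: measurable_shw_nrk1.
Qed.

Lemma nrk1_prob_ge0 k : 0 <= nrk1_prob k.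
Proof. by rewrite -lee_fin -(nrk1_probE 0); exact: measure_ge0. Qed.

Lemma nrk1_prob_le1 k : nrk1_prob k <= 1.
Proof. by rewrite -lee_fin -(nrk1_probE 0); apply: probability_le1; exact: measurable_shw_nrk1. Qed.

Lemma nrk1_prob_addl k l : nrk1_prob (k + l) <= nrk1_prob k.
Proof.
rewrite -lee_fin -!(nrk1_probE 0); apply: le_measure; rewrite ?inE; [exact: measurable_shw_nrk1..|].
by move=> w /= h hk; apply: h; apply: rk1_addl => //; exact: okseq_shw.
Qed.

(** If the product of [k + l] operators lacks rank 1, so do the first [k] and the following [l], and
    these two events are independent. *)
Lemma nrk1_prob_add k l : nrk1_prob (k + l) <= nrk1_prob k * nrk1_prob l.
Proof.
have e : shw 0 @^-1` nrk1 k = pastw k @^-1` nrk1 k.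
  apply/seteqP; split => w /= h hk; apply: h; apply: rk1_ext hk => j jk;
    by rewrite /shw /pastw jk.
rewrite -lee_fin EFinM -(nrk1_probE 0) -(nrk1_probE 0 k) -(nrk1_probE k) e.
rewrite -(indep_past_shw k (measurable_nrk1 k) (measurable_nrk1 l)) -e.
apply: le_measure; rewrite ?inE.
- exact: measurable_shw_nrk1.
- by apply: measurableI; exact: measurable_shw_nrk1.
- move=> w /= h; split => hk; apply: h.
    by apply: rk1_addl => //; exact: okseq_shw.
  by apply: (rk1_addr i0); [exact: okseq_shw|rewrite sh_shw].
Qed.

Lemma mp_prod_ok n w : is_mp_op (mp_prod A n w).
Proof. by elim: n => [|n IH] /=; [exact: is_mp_op_one|exact: is_mp_op_mul]. Qed.

Lemma mp_apply_prod n w x : mp_apply (mp_prod A n w) x = trj (shw 0 w) x n.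
Proof.
elim: n => [|n IH] /=; first by apply/funext => i; rewrite mp_apply_one.
by apply/funext => i; rewrite mp_apply_mul// ?IH//; exact: mp_prod_ok.
Qed.

Lemma mp_trajE n w : mp_traj A X0 n w = trj (shw 0 w) (X0 w) n.
Proof. by elim: n => //= n ->. Qed.

Lemma mp_rank1E n w : mp_rank1 (mp_prod A n w) <-> rk1 (shw 0 w) n.
Proof.
rewrite (rk1P i0); last exact: okseq_shw.
by split => h x y; have [c hc] := h x y; exists c => i; have := hc i; rewrite !mp_apply_prod.
Qed.

Lemma mp_maxentry_prod n w : mp_maxentry (mp_prod A n w) = (Xm i0 n (shw 0 w))%:E.
Proof. by rewrite (mp_maxentryE i0) ?mp_apply_prod//; exact: mp_prod_ok. Qed.

Hypothesis loss : exists N, (0 < P [set w | mp_rank1 (mp_prod A N w)])%E.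

Lemma nrk1_prob_lt1 : exists2 N, (0 < N)%N & nrk1_prob N < 1.
Proof.
have [N] := loss.
have -> : [set w | mp_rank1 (mp_prod A N w)] = ~` (shw 0 @^-1` nrk1 N).
  apply/seteqP; split => w /=; first by move/mp_rank1E => h; exact.
  by move=> h; apply/mp_rank1E; exact: contrapT.
rewrite probability_setC; last exact: measurable_shw_nrk1.
rewrite nrk1_probE -EFinB lte_fin subr_gt0 => qN; exists N.+1 => //.
by apply: le_lt_trans qN; rewrite -addn1; exact: nrk1_prob_addl.
Qed.

(** Submultiplicativity gives [S <= N + r * S] for the partial sums, with [r < 1], so no decay rate
    has to be written out. Square roots are summed because [L^2] norms will be. *)
Lemma sum_sqrt_nrk1_prob : exists2 C : R, 0 <= C & forall m, \sum_(k < m) Num.sqrt (nrk1_prob k) <= C.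
Proof.
have [N N0 qN] := nrk1_prob_lt1; set r := Num.sqrt (nrk1_prob N).
have r0 : 0 <= r by exact: sqrtr_ge0.
have r1 : r < 1 by rewrite -sqrtr1 ltr_sqrt.
exists (N%:R / (1 - r)); first by rewrite divr_ge0// subr_ge0 ltW.
move=> m; rewrite ler_pdivlMr ?subr_gt0//.
set S := \sum_(k < m) _.
have S0 : 0 <= S by apply: sumr_ge0 => k _; exact: sqrtr_ge0.
have h1 : S <= \sum_(k < N + m) Num.sqrt (nrk1_prob k).
  rewrite addnC big_split_ord /= lerDl; apply: sumr_ge0 => k _; exact: sqrtr_ge0.
have h2 : \sum_(k < N + m) Num.sqrt (nrk1_prob k) <= N%:R + r * S.
  rewrite big_split_ord /=; apply: lerD.
    apply: (@le_trans _ _ (\sum_(i < N) 1)); last by rewrite sumr_const card_ord.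
    by apply: ler_sum => i _; rewrite -sqrtr1 ler_wsqrtr ?nrk1_prob_le1.
  rewrite mulr_sumr; apply: ler_sum => i _; rewrite -sqrtrM ?nrk1_prob_ge0//.
  by rewrite ler_wsqrtr// nrk1_prob_add.
lra.
Qed.

(** * Second moments of the largest entry and of the defect *)

Lemma measurable_shw_comp s (u : @mseq R d -> R) : measurable_fun setT u ->
  measurable_fun setT (fun w => u (shw s w)).
Proof. by move=> mu; apply: measurableT_comp => //; exact: measurable_shw. Qed.

Lemma L2_Xm n : L2 P (fun w => Xm i0 n (shw 0 w)).
Proof.
elim: n => [|n IH].
  by under [X in L2 P X]eq_fun do rewrite Xm0; exact: L2_cst.
have mX k := measurable_shw_comp 0 (measurable_Xm i0 k).
have h := @L2_of_integral (fun w => Xm i0 n.+1 (shw 0 w) - Xm i0 n (shw 0 w)) EQb EQb_ge0.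
have [iD _] : L2 P (fun w => Xm i0 n.+1 (shw 0 w) - Xm i0 n (shw 0 w)) /\
    nrm P (fun w => Xm i0 n.+1 (shw 0 w) - Xm i0 n (shw 0 w)) <= Num.sqrt EQb.
  apply: h; first exact: measurable_funB.
  rewrite -(EQbE n); apply: ge0_le_integral => //.
  - by move=> w _; rewrite lee_fin sqr_ge0.
  - by apply/measurable_EFinP; apply: measurable_funX; exact: measurable_funB.
  - by apply: (measurableT_comp (measurable_Qb 0)); exact: measurable_shw.
  - move=> w _; have := Xm_increment_le i0 n (okseq_shw 0 w).
    by rewrite /shw addn0.
have := L2D iD IH; congr (L2 P _); apply/funext => w; by rewrite subrK.
Qed.

(* The defect moves only if the first [m] matrices after time [n] do not have rank 1,
   an event independent of the matrix which bounds the move. *)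
Lemma nrm_defect_step n m :
  L2 P (fun w => defect i0 n m.+1 (shw 0 w) - defect i0 n m (shw 0 w)) /\
  nrm P (fun w => defect i0 n m.+1 (shw 0 w) - defect i0 n m (shw 0 w)) <=
    Num.sqrt (4 * EQb) * Num.sqrt (nrk1_prob m).
Proof.
have mD k := measurable_shw_comp 0 (measurable_defect i0 n k).
rewrite -sqrtrM ?mulr_ge0 ?EQb_ge0//; apply: L2_of_integral.
- by rewrite !mulr_ge0 ?EQb_ge0 ?nrk1_prob_ge0.
- exact: measurable_funB.
pose u (a : @mseq R d) : \bar R := (\1_(nrk1 m) (sh n a))%:E.
pose v (a : @mseq R d) : \bar R := (4%:E * Qb (a 0%N))%E.
have mu : measurable_fun setT u.
  apply/measurable_EFinP.
  have mi : measurable_fun setT (\1_(nrk1 m) : @mseq R d -> R).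
    by apply: measurable_indic; exact: measurable_nrk1.
  exact: (measurableT_comp mi (@measurable_sh R d n)).
have mv : measurable_fun setT v by apply: emeasurable_funM => //; exact: (measurable_Qb 0).
have u0 a : (0 <= u a)%E by rewrite lee_fin.
have v0 a : (0 <= v a)%E by rewrite mule_ge0// Qb_ge0.
have := indep_ge0_integral (measurable_pastw (n + m)) (measurable_shw (n + m))
  (indep_past_shw (n + m)) mu mv u0 v0.
(* The event reads only coordinates below [n + m], where [pastw (n + m)] is not padded. *)
have uE w : u (pastw (n + m) w) = (\1_(nrk1 m) (shw n w))%:E.
  rewrite /u !indicE; congr ((nat_of_bool _)%:R%:E); apply/idP/idP => /set_mem h; apply/mem_set => hk;
  apply: h; apply: rk1_ext hk => j jm; rewrite /sh /pastw /shw.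
  - by rewrite ltn_add2l jm.
  - by rewrite ltn_add2l jm.
under [X in (_ = X * _)%E -> _]eq_integral do rewrite uE.
under [X in (X = _)%E -> _]eq_integral do rewrite uE.
have -> : (\int[P]_w (\1_(nrk1 m) (shw n w))%:E = (nrk1_prob m)%:E)%E.
  rewrite -(nrk1_probE n m) -[in RHS](setIT (shw n @^-1` _)) -integral_indic//.
  exact: measurable_shw_nrk1.
rewrite ge0_integralZl//; last 2 first.
- by apply: (measurableT_comp (measurable_Qb 0)); exact: measurable_shw.
- by move=> w _; exact: Qb_ge0.
rewrite EQbE -!EFinM mulrC => <-.
apply: ge0_le_integral => //.
- by move=> w _; rewrite lee_fin sqr_ge0.
- by apply/measurable_EFinP; apply: measurable_funX; exact: measurable_funB.
- apply: emeasurable_funM.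
    apply/measurable_EFinP; apply: (measurable_shw_comp n (u := \1_(nrk1 m))).
    by apply: measurable_indic; exact: measurable_nrk1.
  by apply: (measurableT_comp mv); exact: measurable_shw.
- move=> w _; have [h|h] := pselect (rk1 (shw n w) m).
    rewrite (defect_stable i0 (okseq_shw 0 w)) ?sh_shw// subrr expr0n/= mule_ge0//.
  rewrite indicE mem_set// mul1e; apply: le_trans (defect_increment_le i0 n m (okseq_shw 0 w)) _.
  by rewrite /v /shw addn0 add0n.
Qed.

Lemma nrm_defect : exists2 C : R, 0 < C & forall n m,
  L2 P (fun w => defect i0 n m (shw 0 w)) /\
  nrm P (fun w => defect i0 n m (shw 0 w)) <= C.
Proof.
have [C0 C00 hC] := sum_sqrt_nrk1_prob.
(* The [+ 1] makes the constant strictly positive, as [balanced_step] requires. *)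
exists (Num.sqrt (4 * EQb) * C0 + 1).
  by rewrite ltr_wpDl// mulr_ge0// sqrtr_ge0.
move=> n m.
have [] : L2 P (fun w => defect i0 n m (shw 0 w)) /\
  nrm P (fun w => defect i0 n m (shw 0 w)) <= Num.sqrt (4 * EQb) * \sum_(k < m) Num.sqrt (nrk1_prob k).
  elim: m => [|m [IH1 IH2]].
    have -> : (fun w => defect i0 n 0 (shw 0 w)) = (fun=> 0 : R).
      by apply/funext => w; rewrite defect0.
    by rewrite big_ord0 mulr0 nrm_cst normr0; split => //; exact: L2_cst.
  have [s1 s2] := nrm_defect_step n m.
  have -> : (fun w => defect i0 n m.+1 (shw 0 w)) = (fun w => defect i0 n m (shw 0 w) +
      (defect i0 n m.+1 (shw 0 w) - defect i0 n m (shw 0 w))).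
    by apply/funext => w; rewrite addrC subrK.
  split; first exact: L2D.
  by rewrite big_ord_recr /= mulrDr; apply: le_trans (nrmD IH1 s1) _; exact: lerD.
move=> i h; split => //; apply: le_trans h _.
apply: le_trans (_ : Num.sqrt (4 * EQb) * C0 <= _); last by rewrite lerDl.
by rewrite ler_wpM2l// sqrtr_ge0.
Qed.

(** * Functions of finitely many operators, and the cutting into blocks *)

Definition depends_on n (u : @mseq R d -> R) :=
  forall a b : @mseq R d, (forall k, (k < n)%N -> a k = b k) -> u a = u b.

Lemma depends_past n u w : depends_on n u -> u (pastw n w) = u (shw 0 w).
Proof. by apply => k kn; rewrite /pastw /shw kn. Qed.

Lemma indep_prefix n (u v : @mseq R d -> R) : depends_on n u ->
  measurable_fun setT u -> measurable_fun setT v ->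
  L1 P (fun w => u (shw 0 w)) -> L1 P (fun w => v (shw n w)) ->
  Ex P (fun w => u (shw 0 w) * v (shw n w)) =
  Ex P (fun w => u (shw 0 w)) * Ex P (fun w => v (shw n w)).
Proof.
move=> du mu mv iu iv.
have e : (fun w => u (shw 0 w)) = u \o pastw n by apply/funext => w; rewrite /= depends_past.
rewrite e -(indep_Ex (measurable_pastw n) (measurable_shw n) (indep_past_shw n) mu mv)//.
  by congr Ex; apply/funext => w; rewrite depends_past.
by rewrite -e.
Qed.

Lemma nrm_add_indep n (u v : @mseq R d -> R) : depends_on n u ->
  measurable_fun setT u -> measurable_fun setT v ->
  L2 P (fun w => u (shw 0 w)) -> L2 P (fun w => v (shw n w)) ->
  Ex P (fun w => v (shw n w)) = 0 ->
  nrm P (fun w => u (shw 0 w) + v (shw n w)) ^+ 2 =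
  nrm P (fun w => u (shw 0 w)) ^+ 2 + nrm P (fun w => v (shw n w)) ^+ 2.
Proof.
move=> du mu mv iu iv v0; apply: nrm_pythagoras => //.
by rewrite indep_prefix//; [rewrite v0 mulr0|exact: L2_L1|exact: L2_L1].
Qed.

Definition mean n : R := Ex P (fun w => Xm i0 n (shw 0 w)).

Lemma L2_Xm_shw s n : L2 P (fun w => Xm i0 n (shw s w)).
Proof. exact: (shw_L2 s (measurable_Xm i0 n) (L2_Xm n)). Qed.

Lemma Ex_Xm_shw s n : Ex P (fun w => Xm i0 n (shw s w)) = mean n.
Proof. exact: (shw_Ex s (measurable_Xm i0 n)). Qed.

(* the error made by cutting a product of length [k * b] into blocks of length [b] *)
Definition theta b k (a : @mseq R d) : R :=
  Xm i0 (k * b) a - \sum_(j < k) Xm i0 b (sh (j * b) a).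

Lemma measurable_block_sum b k : measurable_fun setT
  (fun a : @mseq R d => \sum_(j < k) Xm i0 b (sh (j * b) a)).
Proof.
apply: measurable_sum => j.
exact: (measurableT_comp (measurable_Xm i0 b) (@measurable_sh R d (j * b))).
Qed.

Lemma measurable_theta b k : measurable_fun setT (theta b k).
Proof. by apply: measurable_funB; [exact: measurable_Xm|exact: measurable_block_sum]. Qed.

Lemma block_sum_depends b k : depends_on (k * b)
  (fun a => \sum_(j < k) Xm i0 b (sh (j * b) a)).
Proof.
move=> a c ac; apply: eq_bigr => j _; apply: Xm_ext => l lb; apply: ac.
by have := ltn_ord j; nia.
Qed.

Lemma theta_depends b k : depends_on (k * b) (theta b k).
Proof.
by move=> a c ac; rewrite /theta (Xm_ext i0 ac) (block_sum_depends ac).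
Qed.

Lemma L2_block_sum s b k : L2 P (fun w => \sum_(j < k) Xm i0 b (sh (j * b) (shw s w))).
Proof.
apply: (@L2_sum _ _ _ P k (fun j w => Xm i0 b (sh (j * b) (shw s w)))) => j.
by under [X in L2 P X]eq_fun do rewrite sh_shw; exact: L2_Xm_shw.
Qed.

Lemma L2_theta s b k : L2 P (fun w => theta b k (shw s w)).
Proof. by apply: L2B; [exact: L2_Xm_shw|exact: L2_block_sum]. Qed.

(** Gluing two runs of blocks creates exactly one defect, which is what makes the recursion on
    halves possible. *)
Lemma theta_add b k l a : theta b (k + l) a =
  theta b k a + theta b l (sh (k * b) a) - defect i0 (k * b) (l * b) a.
Proof.
rewrite /theta /defect mulnDl big_split_ord /=.
have -> : \sum_(i < l) Xm i0 b (sh ((k + i) * b) a) =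
    \sum_(j < l) Xm i0 b (sh (j * b) (sh (k * b) a)).
  apply: eq_bigr => j _; congr Xm; apply/funext => m.
  by rewrite /sh mulnDl !addnA.
by ring.
Qed.

Lemma theta1 b a : theta b 1 a = 0.
Proof.
by rewrite /theta big_ord1 mul0n mul1n (_ : sh 0 a = a) ?subrr.
Qed.

Lemma Ex_add3 (X Y Z : Omega -> R) : L2 P X -> L2 P Y -> L2 P Z ->
  ctr P (fun w => X w + Y w - Z w) = (fun w => ctr P X w + ctr P Y w - ctr P Z w).
Proof.
move=> /L2_L1 iX /L2_L1 iY /L2_L1 iZ; apply/funext => w.
by rewrite /ctr (ExB (L1D iX iY) iZ) (ExD iX iY); ring.
Qed.

(* Strong induction on [k], splitting the blocks into two halves: the two errors are
   independent, and the slack [- 6 * C] absorbs the defect created by the gluing. *)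
Lemma nrm_theta : exists2 K : R, 0 <= K & forall b k,
  nrm P (ctr P (fun w => theta b k (shw 0 w))) <= K * Num.sqrt k%:R.
Proof.
have [C C0 hC] := nrm_defect.
suff key b k : (0 < k)%N ->
    nrm P (ctr P (fun w => theta b k (shw 0 w))) <= 12 * C * Num.sqrt k%:R - 6 * C.
  exists (12 * C); first by rewrite mulr_ge0// ltW.
  move=> b [|k]; last by apply: le_trans (key b k.+1 _) _; rewrite // gerBl mulr_ge0// ltW.
  have -> : (fun w => theta b 0 (shw 0 w)) = (fun=> 0).
    by apply/funext => w; rewrite /theta big_ord0 Xm0 subr0.
  rewrite /ctr Ex_cst; under [X in nrm P X]eq_fun do rewrite subr0.
  by rewrite nrm_cst normr0 sqrtr0 mulr0.
elim/ltn_ind: k => k IH k0.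
have [->|k1] := eqVneq k 1%N.
  have -> : (fun w => theta b 1 (shw 0 w)) = (fun=> 0).
    by apply/funext => w; rewrite theta1.
  rewrite /ctr Ex_cst; under [X in nrm P X]eq_fun do rewrite subr0.
  by rewrite nrm_cst normr0 sqrtr1; lra.
pose p := (k %/ 2)%N; pose r := (k - p)%N.
have kpr : k = (p + r)%N by rewrite /p /r; lia.
have p0 : (0 < p)%N by rewrite /p; lia.
have pr : (p <= r <= p.+1)%N by rewrite /r /p; lia.
have hp := IH p ltac:(lia) p0; have hr := IH r ltac:(lia) ltac:(lia).
rewrite kpr; apply: le_trans (balanced_step p0 pr C0 (nrm_ge0 _ _) (nrm_ge0 _ _) hp hr).
have [iD nD] := hC (p * b)%N (r * b)%N.
have i1 := L2_theta 0 b p; have i2 := L2_theta (p * b) b r.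
have -> : (fun w => theta b (p + r) (shw 0 w)) =
   (fun w => theta b p (shw 0 w) + theta b r (shw (p * b) w) - defect i0 (p * b) (r * b) (shw 0 w)).
  by apply/funext => w; rewrite theta_add sh_shw.
rewrite Ex_add3//.
apply: le_trans (nrmB (L2D (L2_ctr i1) (L2_ctr i2)) (L2_ctr iD)) _.
apply: lerD; last exact: le_trans (nrm_ctr iD) nD.
rewrite -(ger0_norm (nrm_ge0 _ _)) -sqrtr_sqr ler_wsqrtr//.
(* The induction hypothesis concerns blocks from time 0; stationarity moves it to the second
   half. *)
have shE : nrm P (ctr P (fun w => theta b r (shw (p * b) w))) =
    nrm P (ctr P (fun w => theta b r (shw 0 w))).
  rewrite /ctr (shw_Ex (p * b) (measurable_theta b r)).
  apply: (shw_nrm (p * b) (u := fun a => theta b r a - Ex P (fun w => theta b r (shw 0 w)))).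
  by apply: measurable_funB; [exact: measurable_theta|exact: measurable_cst].
rewrite -shE le_eqVlt; apply/orP; left; apply/eqP.
apply: (@nrm_add_indep (p * b) (fun a => theta b p a - Ex P (fun w => theta b p (shw 0 w)))
  (fun a => theta b r a - Ex P (fun w => theta b r (shw (p * b) w)))).
- by move=> a c ac; rewrite (theta_depends ac).
- by apply: measurable_funB; [exact: measurable_theta|exact: measurable_cst].
- by apply: measurable_funB; [exact: measurable_theta|exact: measurable_cst].
- exact: L2_ctr.
- exact: L2_ctr.
- by apply: Ex_ctr; exact: L2_L1.
Qed.

Definition Yb b (j : nat) w : R := Xm i0 b (shw (j * b) w) - mean b.

Lemma L2_Yb b j : L2 P (Yb b j).
Proof. by apply: L2B; [exact: L2_Xm_shw|exact: L2_cst]. Qed.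

Lemma Ex_Yb b j : Ex P (Yb b j) = 0.
Proof.
rewrite /Yb ExB; [|exact: L2_L1 (L2_Xm_shw _ _)|exact: L1_cst].
by rewrite Ex_Xm_shw Ex_cst subrr.
Qed.

Lemma Yb_sumE b k w : \sum_(j < k) Yb b j w =
  \sum_(j < k) Xm i0 b (sh (j * b) (shw 0 w)) - k%:R * mean b.
Proof.
by rewrite /Yb sumrB sumr_const card_ord mulr_natl.
Qed.

Definition var b : R := nrm P (Yb b 0) ^+ 2.

Lemma Ex_comp_Yb b j (f : R -> R) : measurable_fun setT f ->
  Ex P (fun w => f (Yb b j w)) = Ex P (fun w => f (Yb b 0 w)).
Proof.
move=> mf; rewrite /Yb mul0n.
apply: (shw_Ex (j * b) (u := fun a => f (Xm i0 b a - mean b))).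
by apply: measurableT_comp => //; apply: measurable_funB; [exact: measurable_Xm|exact: measurable_cst].
Qed.

(** These are the identities required by [lindeberg_sum]: the earlier blocks read only the first
    [j * b] operators, the block [Yb b j] only later ones. *)
Lemma Yb_orth b j (f : R -> R) M : measurable_fun setT f -> (forall x, `|f x| <= M) ->
  Ex P (fun w => f (\sum_(i < j) Yb b i w) * Yb b j w) = 0 /\
  Ex P (fun w => f (\sum_(i < j) Yb b i w) * Yb b j w ^+ 2) =
    var b * Ex P (fun w => f (\sum_(i < j) Yb b i w)).
Proof.
move=> mf fM.
pose u (a : @mseq R d) := f (\sum_(j < j) Xm i0 b (sh (j * b) a) - j%:R * mean b).
pose v (a : @mseq R d) := Xm i0 b a - mean b.
have mu : measurable_fun setT u.
  apply: measurableT_comp => //; apply: measurable_funB; [exact: measurable_block_sum|exact: measurable_cst].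
have mv : measurable_fun setT v by apply: measurable_funB; [exact: measurable_Xm|exact: measurable_cst].
have du : depends_on (j * b) u by move=> a c ac; rewrite /u (block_sum_depends ac).
have uE w : f (\sum_(i < j) Yb b i w) = u (shw 0 w) by rewrite Yb_sumE.
have iu : L1 P (fun w => u (shw 0 w)).
  by apply: (@L1_bounded _ _ _ _ _ M); [exact: (measurable_shw_comp 0 mu)|move=> w; exact: fM].
have [_ iv2] := L2_Yb b j; have iv := L2_L1 (L2_Yb b j).
split.
  under [X in Ex P X]eq_fun do rewrite uE.
  by rewrite (indep_prefix du mu mv iu iv) [X in _ * X]Ex_Yb mulr0.
under [X in Ex P X]eq_fun do rewrite uE.
under [X in _ = _ * Ex P X]eq_fun do rewrite uE.
have mv2 : measurable_fun setT (fun a => v a ^+ 2) by exact: measurable_funX.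
rewrite (indep_prefix du mu mv2 iu iv2) mulrC; congr (_ * _).
rewrite /var nrmE; apply: (Ex_comp_Yb b j (f := fun x => x ^+ 2)).
exact: measurable_funX.
Qed.

Lemma nrm_sum_Yb b k : nrm P (fun w => \sum_(j < k) Yb b j w) ^+ 2 = k%:R * var b.
Proof.
elim: k => [|k IH].
  under [X in nrm P X]eq_fun do rewrite big_ord0.
  by rewrite nrm_cst normr0 expr0n mul0r.
under [X in nrm P X]eq_fun do rewrite big_ord_recr.
have iS : L2 P (fun w => \sum_(j < k) Yb b j w) by apply: L2_sum => j; exact: L2_Yb.
rewrite nrm_pythagoras//; last 2 first.
- exact: L2_Yb.
- have iu : (fun w => \sum_(j < k) Yb b j w) =
    (fun w => \sum_(j < k) Xm i0 b (sh (j * b) (shw 0 w)) - k%:R * mean b).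
    by apply/funext => w; rewrite Yb_sumE.
  under [X in Ex P X]eq_fun do rewrite Yb_sumE.
  have m1 : measurable_fun setT (fun a : @mseq R d =>
      \sum_(j < k) Xm i0 b (sh (j * b) a) - k%:R * mean b).
    by apply: measurable_funB; [exact: measurable_block_sum|exact: measurable_cst].
  have m2 : measurable_fun setT (fun a : @mseq R d => Xm i0 b a - mean b).
    by apply: measurable_funB; [exact: measurable_Xm|exact: measurable_cst].
  have := indep_prefix (n := k * b) _ m1 m2 _ (L2_L1 (L2_Yb b k)).
  have e0 : Ex P (fun w => Xm i0 b (shw (k * b) w) - mean b) = 0 := Ex_Yb b k.
  rewrite e0 mulr0; apply.
    by move=> a c ac; rewrite (block_sum_depends ac).
  by rewrite -iu; exact: L2_L1.
rewrite IH -natr1 mulrDl mul1r; congr (_ + _).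
by rewrite /var !nrmE; apply: (Ex_comp_Yb b k (f := fun x => x ^+ 2)); exact: measurable_funX.
Qed.

Definition Sc n w : R := Xm i0 n (shw 0 w) - mean n.

Lemma L2_Sc n : L2 P (Sc n).
Proof. by apply: L2B; [exact: L2_Xm_shw|exact: L2_cst]. Qed.

Lemma ctr_Xm s n : ctr P (fun w => Xm i0 n (shw s w)) = (fun w => Xm i0 n (shw s w) - mean n).
Proof. by rewrite /ctr Ex_Xm_shw. Qed.

Lemma Sc_blocks b k w : Sc (k * b) w =
  \sum_(j < k) Yb b j w + ctr P (fun w => theta b k (shw 0 w)) w.
Proof.
have e : Ex P (fun w => theta b k (shw 0 w)) = mean (k * b) - k%:R * mean b.
  rewrite /theta ExB; [|exact: L2_L1 (L2_Xm_shw _ _)|exact: L2_L1 (L2_block_sum _ _ _)].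
  rewrite Ex_Xm_shw; congr (_ - _).
  rewrite (Ex_sum k (X := fun j w => Xm i0 b (sh (j * b) (shw 0 w)))); last first.
    by move=> j; under [X in L1 P X]eq_fun do rewrite sh_shw; exact: L2_L1 (L2_Xm_shw _ _).
  rewrite (eq_bigr (fun=> mean b)) ?sumr_const ?card_ord ?mulr_natl// => j _.
  by under [X in Ex P X]eq_fun do rewrite sh_shw; exact: Ex_Xm_shw.
by rewrite Yb_sumE /ctr e /theta /Sc; ring.
Qed.

(** Blocks of length 1: both the sum of the blocks and the cutting error are then of order
    [sqrt n]. *)
Lemma nrm_Sc : exists2 K : R, 0 <= K & forall n, nrm P (Sc n) <= K * Num.sqrt n%:R.
Proof.
have [K K0 hK] := nrm_theta; exists (nrm P (Yb 1 0) + K); first by rewrite addr_ge0// nrm_ge0.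
move=> n.
have -> : Sc n = (fun w => \sum_(j < n) Yb 1 j w + ctr P (fun w => theta 1 n (shw 0 w)) w).
  by apply/funext => w; rewrite -Sc_blocks muln1.
apply: le_trans (nrmD _ _) _.
- by apply: L2_sum => j; exact: L2_Yb.
- by apply: L2_ctr; exact: L2_theta.
rewrite mulrDl; apply: lerD; last exact: hK.
rewrite -(@ler_pXn2r _ 2)// ?nnegrE ?mulr_ge0 ?nrm_ge0 ?sqrtr_ge0//.
by rewrite nrm_sum_Yb exprMn (sqr_sqrtr (ler0n R n)) mulrC.
Qed.

(** Three errors: the cutting of the complete blocks, of order [sqrt (n %/ b)]; the incomplete last
    block, shorter than [b]; one defect between them. Divided by [sqrt n], only the first survives
    as [n] grows. *)
Lemma block_approx : exists2 K : R, 0 <= K & forall b n, (0 < b)%N ->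
  nrm P (fun w => Sc n w - \sum_(j < n %/ b) Yb b j w) <=
    K * (Num.sqrt (n %/ b)%:R + Num.sqrt b%:R).
Proof.
have [K1 K10 h1] := nrm_theta; have [K2 K20 h2] := nrm_Sc; have [C C0 h3] := nrm_defect.
exists (K1 + K2 + C); first by rewrite !addr_ge0// ltW.
move=> b n b0; pose k := (n %/ b)%N; pose r := (n %% b)%N.
have nE : n = (k * b + r)%N by rewrite -divn_eq.
have [iD nD] := h3 (k * b)%N r.
have i1 := L2_theta 0 b k; have i2 := L2_Xm_shw (k * b) r.
have e : (fun w => Sc n w - \sum_(j < k) Yb b j w) = (fun w => ctr P (fun w => theta b k (shw 0 w)) w
   + ctr P (fun w => Xm i0 r (shw (k * b) w)) w - ctr P (fun w => defect i0 (k * b) r (shw 0 w)) w).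
  have eD : Ex P (fun w => defect i0 (k * b) r (shw 0 w)) = mean (k * b) + mean r - mean n.
    rewrite /defect; under [X in Ex P X]eq_fun do rewrite sh_shw add0n.
    rewrite ExB; [|by apply: L1D; exact: L2_L1 (L2_Xm_shw _ _)|exact: L2_L1 (L2_Xm_shw _ _)].
    rewrite ExD; [|exact: L2_L1 (L2_Xm_shw _ _)|exact: L2_L1 (L2_Xm_shw _ _)].
    by rewrite !Ex_Xm_shw -nE.
  apply/funext => w; have h := Sc_blocks b k w.
  have c1 : ctr P (fun w => defect i0 (k * b) r (shw 0 w)) w =
      defect i0 (k * b) r (shw 0 w) - (mean (k * b) + mean r - mean n) by rewrite -eD.
  have c2 : ctr P (fun w => Xm i0 r (shw (k * b) w)) w = Xm i0 r (shw (k * b) w) - mean r.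
    by rewrite ctr_Xm.
  have hd : defect i0 (k * b) r (shw 0 w) =
      Xm i0 (k * b) (shw 0 w) + Xm i0 r (shw (k * b) w) - Xm i0 n (shw 0 w).
    by rewrite /defect sh_shw add0n -nE.
  by rewrite c1 c2 hd; move: h; rewrite /Sc => h; lra.
rewrite e; apply: le_trans (nrmB (L2D (L2_ctr i1) (L2_ctr i2)) (L2_ctr iD)) _.
apply: le_trans (lerD (nrmD (L2_ctr i1) (L2_ctr i2)) (lexx _)) _.
have b1 : 1 <= Num.sqrt (b%:R : R) by rewrite -[leLHS]sqrtr1 ler_wsqrtr// ler1n.
have f1 := h1 b k.
have f2 : nrm P (ctr P (fun w => Xm i0 r (shw (k * b) w))) <= K2 * Num.sqrt b%:R.
  rewrite ctr_Xm (shw_nrm (k * b) (u := fun a => Xm i0 r a - mean r)); last first.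
    by apply: measurable_funB; [exact: measurable_Xm|exact: measurable_cst].
  apply: le_trans (h2 r) _; rewrite ler_wpM2l// ler_wsqrtr// ler_nat.
  by rewrite ltnW// ltn_mod.
have f3 := le_trans (nrm_ctr iD) nD.
have f4 : C <= C * Num.sqrt b%:R by rewrite ler_peMr// ltW.
have f5 : 0 <= Num.sqrt ((n %/ b)%:R : R) by exact: sqrtr_ge0.
apply: le_trans (lerD (lerD f1 f2) (le_trans f3 f4)) _.
by apply: lin3_bound; rewrite ?sqrtr_ge0// ltW.
Qed.

(** Every gluing shifts the mean by that of a defect, at most [C] in absolute value. The linear
    growth in [k] is harmless, since [k] will be divided out. *)
Lemma mean_mul : exists2 C : R, 0 <= C &
  forall b k, `|mean (k * b) - k%:R * mean b| <= C * k%:R.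
Proof.
have [C C0 hC] := nrm_defect; exists C; first exact: ltW.
move=> b; elim=> [|k IH].
  rewrite mul0n !mul0r mulr0 subr0 /mean.
  under [X in Ex P X]eq_fun do rewrite Xm0.
  by rewrite Ex_cst normr0.
have [iD nD] := hC (k * b)%N b.
have e : mean (k.+1 * b) = mean (k * b) + mean b - Ex P (fun w => defect i0 (k * b) b (shw 0 w)).
  rewrite /defect; under [X in _ - Ex P X]eq_fun do rewrite sh_shw add0n.
  rewrite ExB; [|by apply: L1D; exact: L2_L1 (L2_Xm_shw _ _)|exact: L2_L1 (L2_Xm_shw _ _)].
  rewrite ExD; [|exact: L2_L1 (L2_Xm_shw _ _)|exact: L2_L1 (L2_Xm_shw _ _)].
  by rewrite !Ex_Xm_shw mulSn addnC; ring.
rewrite e -natr1.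
set D := Ex P _; have hD : `|D| <= C by apply: le_trans (Ex_le_nrm iD) nD.
have -> : mean (k * b) + mean b - D - (k%:R + 1) * mean b = (mean (k * b) - k%:R * mean b) - D by ring.
by apply: le_trans (ler_normB _ _) _; rewrite mulrDr mulr1; exact: lerD.
Qed.

(** * Identification of the mean growth with the Lyapunov exponent *)

Variable gamma : R.
Hypothesis lyap : {ae P, forall w, forall i,
  (fun n => (n%:R)^-1 * mp_traj A X0 n w i) @ \oo --> gamma}.

Lemma cvg_cst_div (c : R) : (fun n => (n%:R)^-1 * c) @ \oo --> (0 : R).
Proof. by rewrite -(mul0r c); apply: cvgMl; exact: cvg_invn. Qed.

(** Nonexpansiveness bounds the effect of the initial vector uniformly in [n], so [Xm] inherits the
    growth rate of the trajectory from [X0]. *)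
Lemma Xm_traj_close w n : `|Xm i0 n (shw 0 w) - vmax i0 (mp_traj A X0 n w)| <= dist1 (fun=> 0) (X0 w).
Proof.
have h i := trj_nonexpansive (fun=> 0) (X0 w) n i (okseq_shw 0 w).
rewrite mp_trajE ler_norml; apply/andP; split.
  rewrite lerBrDl -lerBrDr opprK; apply: vmax_le_shift => i.
  by have := h i; rewrite ler_norml => /andP[]; lra.
rewrite lerBlDl; apply: vmax_le_shift => i.
by have := h i; rewrite ler_norml => /andP[]; lra.
Qed.

Lemma Xm_lyap : {ae P, forall w, (fun n => (n%:R)^-1 * Xm i0 n (shw 0 w)) @ \oo --> gamma}.
Proof.
apply: filterS lyap => w h; apply/cvgrPdist_le => e e0.
have e20 : 0 < e / 2 by rewrite divr_gt0.
have h1 : \forall n \near \oo, forall i, `|gamma - n%:R^-1 * mp_traj A X0 n w i| <= e / 2.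
  by apply: filter_forall => i; move/cvgrPdist_le: (h i); apply.
have /cvgrPdist_le/(_ _ e20) h2 := cvg_cst_div (dist1 (fun=> 0) (X0 w)).
near=> n.
have n0 : (0 < n)%N by near: n; exists 1%N.
have nn : 0 < (n%:R : R)^-1 by rewrite invr_gt0 ltr0n.
have g1 : forall i, `|gamma - n%:R^-1 * mp_traj A X0 n w i| <= e / 2 by near: n.
have g2 : `|0 - n%:R^-1 * dist1 (fun=> 0) (X0 w)| <= e / 2 by near: n.
have g3 : `|gamma - n%:R^-1 * vmax i0 (mp_traj A X0 n w)| <= e / 2.
  rewrite ler_norml; apply/andP; split.
    rewrite lerBrDl -lerBrDr opprK mulrC ler_pdivrMr ?ltr0n//.
    apply: vmax_le => i; rewrite -ler_pdivrMr ?ltr0n// mulrC.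
    by have := g1 i; rewrite ler_norml => /andP[]; lra.
  apply: le_trans (_ : gamma - n%:R^-1 * mp_traj A X0 n w i0 <= _).
    by rewrite lerB// ler_pM2l// le_vmax.
  by have := g1 i0; rewrite ler_norml => /andP[].
have g4 : `|n%:R^-1 * (vmax i0 (mp_traj A X0 n w) - Xm i0 n (shw 0 w))| <= e / 2.
  rewrite normrM (ger0_norm (ltW nn)) distrC; apply: le_trans g2.
  by rewrite sub0r normrN [leRHS]ger0_norm ?mulr_ge0 ?dist1_ge0 ?(ltW nn)// ler_pM2l// Xm_traj_close.
rewrite (_ : gamma - _ = (gamma - n%:R^-1 * vmax i0 (mp_traj A X0 n w)) +
  n%:R^-1 * (vmax i0 (mp_traj A X0 n w) - Xm i0 n (shw 0 w))); last by ring.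
by apply: le_trans (ler_normD _ _) _; lra.
Unshelve. all: by end_near. Qed.

Lemma cvg_nrm_Sc_div : (fun n => (n%:R)^-1 * nrm P (Sc n)) @ \oo --> (0 : R).
Proof.
have [K K0 hK] := nrm_Sc.
apply: (@cvg_squeeze0 _ _ (fun n => K * (Num.sqrt n%:R)^-1)).
  move=> n; rewrite mulr_ge0 ?invr_ge0 ?nrm_ge0//=.
  have [->|n0] := posnP n; first by rewrite invr0 mul0r mulr_ge0// invr_ge0 sqrtr_ge0.
  have s0 : 0 < Num.sqrt (n%:R : R) by rewrite sqrtr_gt0 ltr0n.
  rewrite mulrC ler_pdivrMr ?ltr0n//; apply: le_trans (hK n) _.
  have e : (Num.sqrt n%:R)^-1 * n%:R = Num.sqrt (n%:R : R).
    by rewrite -{2}(@sqr_sqrtr R n%:R)// expr2 mulKf ?gt_eqF.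
  by rewrite -mulrA e.
by rewrite -(mulr0 K); apply: cvgMr; exact: cvg_invsqrtn.
Qed.

Lemma min1_le_add (x y : R) : 0 <= y -> Num.min 1 (x + y) <= Num.min 1 x + y.
Proof. by move=> y0; have [h|h] := leP 1 x; have [h'|h'] := leP 1 (x + y); lra. Qed.

Lemma cvg_min1 (u : nat -> R) (l : R) :
  (fun n => Num.min 1 `|l - u n|) @ \oo --> (0 : R) -> u @ \oo --> l.
Proof.
move=> h; apply/cvgrPdist_le => e e0.
have e1 : 0 < Num.min (1 / 2) e by rewrite lt_min e0 andbT divr_gt0.
move/cvgrPdist_le: h => /(_ _ e1); apply: filterS => n.
have m0 : 0 <= Num.min 1 `|l - u n| by rewrite le_min ler01 normr_ge0.
rewrite sub0r normrN (ger0_norm m0) le_min => /andP[].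
by case: (leP 1 `|l - u n|) => h1 h2 h3; lra.
Qed.

(** [X_n / n] tends to [gamma] almost surely and is close to its mean in [L^2]. Both closeness
    statements are measured by the truncated distance [Num.min 1], which needs no domination beyond
    the constant 1 and still separates constants. *)
Lemma cvg_mean : (fun n => (n%:R)^-1 * mean n) @ \oo --> gamma.
Proof.
apply: cvg_min1.
have mX n : measurable_fun setT (fun w => (n%:R)^-1 * Xm i0 n (shw 0 w)).
  by apply: measurable_funM => //; exact: (measurable_shw_comp 0 (measurable_Xm i0 n)).
have mM n : measurable_fun setT (fun w => Num.min 1 `|(n%:R)^-1 * Xm i0 n (shw 0 w) - gamma|).
  apply: measurable_minr => //; apply: measurableT_comp => //.
  by apply: measurable_funB; [exact: mX|exact: measurable_cst].
have M1 n w : `|Num.min 1 `|(n%:R)^-1 * Xm i0 n (shw 0 w) - gamma| | <= 1.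
  by rewrite ger0_norm ?le_min ?ler01//= ge_min lexx.
have c1 : (fun n => Ex P (fun w => Num.min 1 `|(n%:R)^-1 * Xm i0 n (shw 0 w) - gamma|)) @ \oo --> (0 : R).
  apply: (@cvg_Ex_dominated _ _ _ P _ (fun=> 1)) => //; first exact: L1_cst.
  apply: filterS Xm_lyap => w hw.
  apply: (@cvg_squeeze0 _ _ (fun n => `|(n%:R)^-1 * Xm i0 n (shw 0 w) - gamma|)).
    by move=> n; rewrite le_min ler01 normr_ge0 ge_min lexx orbT.
  apply/norm_cvg0P; apply/cvgrPdist_le => e e0.
  move/cvgrPdist_le: hw => /(_ _ e0); apply: filterS => n.
  by rewrite sub0r normrN distrC.
have c2 := cvg_nrm_Sc_div.
apply: (@cvg_squeeze0 _ _ (fun n =>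
  Ex P (fun w => Num.min 1 `|(n%:R)^-1 * Xm i0 n (shw 0 w) - gamma|) + (n%:R)^-1 * nrm P (Sc n))).
  move=> n; rewrite le_min ler01 normr_ge0/=.
  have n0 : 0 <= (n%:R : R)^-1 by rewrite invr_ge0.
  have iS := L2_L1 (L2_Sc n).
  have i1 : L1 P (fun w => Num.min 1 `|(n%:R)^-1 * Xm i0 n (shw 0 w) - gamma|).
    by apply: (@L1_bounded _ _ _ _ _ 1).
  apply: le_trans (_ : Ex P (fun w => Num.min 1 `|(n%:R)^-1 * Xm i0 n (shw 0 w) - gamma| +
     (n%:R)^-1 * `|Sc n w|) <= _); last first.
    rewrite ExD//; last by apply: L1Z; exact: L1_abs.
    by rewrite lerD2l ExZ ?ler_wpM2l ?Ex_abs_le_nrm//; [exact: L2_Sc|exact: L1_abs].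
  rewrite -[leLHS](Ex_cst P); apply: Ex_le; first exact: L1_cst.
    by apply: L1D => //; apply: L1Z; exact: L1_abs.
  move=> w; apply: le_trans (min1_le_add _ _); last by rewrite mulr_ge0.
  rewrite le_min !ge_min lexx /=; apply/orP; right.
  rewrite -[n%:R^-1 in X in _ <= _ + X]ger0_norm// -normrM /Sc.
  rewrite (_ : gamma - _ = (n%:R^-1 * (Xm i0 n (shw 0 w) - mean n)) - (n%:R^-1 * Xm i0 n (shw 0 w) - gamma)); last by ring.
  by rewrite [leRHS]addrC; exact: ler_normB.
by rewrite -[X in _ --> X](addr0 0); apply: cvgD.
Qed.

(** [mean_mul] divided by [k], with [k] tending to infinity: [mean (k * b) / k] tends to
    [b * gamma], while the bound stays [C]. *)
Lemma mean_close : exists2 C : R, 0 <= C & forall n, `|mean n - n%:R * gamma| <= C.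
Proof.
have [C C0 hC] := mean_mul; exists C => // b.
have [->|b0] := posnP b.
  rewrite mul0r subr0 /mean; under [X in Ex P X]eq_fun do rewrite Xm0.
  by rewrite Ex_cst normr0.
apply/ler_addgt0Pr => e e0.
have br : 0 < (b%:R : R) by rewrite ltr0n.
have [N _ hN] : \forall n \near \oo, `|gamma - (n%:R)^-1 * mean n| <= e / b%:R.
  by move/cvgrPdist_le: cvg_mean; apply; rewrite divr_gt0.
have := hN (N.+1 * b)%N; rewrite /= => /(_ ltac:(nia)) h1.
have kr : 0 < (N.+1%:R : R) by rewrite ltr0n.
have h2 := hC b N.+1.
have e1 : mean b - b%:R * gamma = - (N.+1%:R^-1 * (mean (N.+1 * b) - N.+1%:R * mean b)) -
    b%:R * (gamma - (N.+1 * b)%:R^-1 * mean (N.+1 * b)).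
  by rewrite natrM; field; rewrite !gt_eqF.
rewrite e1; apply: le_trans (ler_normB _ _) _; rewrite normrN !normrM.
apply: lerD.
  by rewrite ger0_norm ?invr_ge0 ?(ltW kr)// mulrC ler_pdivrMr.
by rewrite (ger0_norm (ltW br)) mulrC -ler_pdivlMr.
Qed.

(** * The limit variance *)

Definition sn n : R := nrm P (Sc n) / Num.sqrt n%:R.

Lemma Yb0 b : Yb b 0 = Sc b.
Proof. by apply/funext => w; rewrite /Yb /Sc mul0n. Qed.

Lemma varE b : var b = nrm P (Sc b) ^+ 2.
Proof. by rewrite /var Yb0. Qed.

Lemma nrm_sum_YbE b k : nrm P (fun w => \sum_(j < k) Yb b j w) = Num.sqrt k%:R * nrm P (Sc b).
Proof.
rewrite -[LHS](ger0_norm (nrm_ge0 _ _)) -sqrtr_sqr nrm_sum_Yb varE sqrtrM// sqrtr_sqr.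
by rewrite ger0_norm// nrm_ge0.
Qed.

Lemma sqrt_divn_le b n : (0 < b)%N -> (0 < n)%N ->
  Num.sqrt (n %/ b)%:R / Num.sqrt n%:R <= (Num.sqrt b%:R)^-1 :> R.
Proof.
move=> b0 n0; rewrite ler_pdivrMr ?sqrtr_gt0 ?ltr0n// mulrC ler_pdivlMr ?sqrtr_gt0 ?ltr0n//.
by rewrite -sqrtrM// ler_wsqrtr// -natrM ler_nat leq_divM.
Qed.

Lemma sqrt_divn_ge b n : (0 < b)%N -> (0 < n)%N ->
  (Num.sqrt b%:R)^-1 <= Num.sqrt (n %/ b)%:R / Num.sqrt n%:R + (Num.sqrt n%:R)^-1 :> R.
Proof.
move=> b0 n0; have sn0 : 0 < Num.sqrt (n%:R : R) by rewrite sqrtr_gt0 ltr0n.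
have sb0 : 0 < Num.sqrt (b%:R : R) by rewrite sqrtr_gt0 ltr0n.
rewrite -[X in _ + X]mul1r -mulrDl ler_pdivlMr// mulrC ler_pdivrMr//.
have k0 : 0 <= Num.sqrt ((n %/ b)%:R : R) by exact: sqrtr_ge0.
rewrite -(@ler_pXn2r _ 2)// ?nnegrE ?mulr_ge0 ?addr_ge0 ?(ltW sn0) ?(ltW sb0)//.
rewrite exprMn !sqr_sqrtr//; apply: le_trans (_ : ((n %/ b)%:R + 1) * b%:R <= _).
  by rewrite natr1 -natrM ler_nat; apply: ltnW; rewrite mulnC mulnS {1}(divn_eq n b) mulnC addnC ltn_add2r ltn_mod.
rewrite ler_wpM2r// sqrrD1 sqr_sqrtr//; have := k0; move: (Num.sqrt _) => x x0.
rewrite mulr2n; lra.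
Qed.

(** [block_approx] compares [Sc n] with [n %/ b] orthogonal blocks, whose sum has norm
    [sqrt (n %/ b)] times that of one block. [K] is common to all [b]; [c] depends on [b], but its
    term vanishes as [n] grows. *)
Lemma sn_close : exists2 K : R, 0 <= K & forall b, (0 < b)%N -> exists2 c : R, 0 <= c &
  forall n, (0 < n)%N -> `|sn n - sn b| <= K / Num.sqrt b%:R + c / Num.sqrt n%:R.
Proof.
have [K K0 hK] := block_approx; exists K => // b b0.
exists (K * Num.sqrt b%:R + nrm P (Sc b)); first by rewrite addr_ge0 ?nrm_ge0// mulr_ge0// sqrtr_ge0.
move=> n n0; have sn0 : 0 < Num.sqrt (n%:R : R) by rewrite sqrtr_gt0 ltr0n.
have iS : L2 P (fun w => \sum_(j < n %/ b) Yb b j w) by apply: L2_sum => j; exact: L2_Yb.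
have h1 : `|nrm P (Sc n) - Num.sqrt (n %/ b)%:R * nrm P (Sc b)| <=
    K * (Num.sqrt (n %/ b)%:R + Num.sqrt b%:R).
  apply: le_trans (hK b n b0); rewrite -nrm_sum_YbE ler_norml; apply/andP; split.
    rewrite lerBrDl -lerBrDr opprK.
    have := nrmB (L2_Sc n) (L2B (L2_Sc n) iS).
    congr (nrm P _ <= _); apply/funext => w; by rewrite opprB addrC subrK.
  rewrite lerBlDl; have := nrmD iS (L2B (L2_Sc n) iS).
  by congr (nrm P _ <= _); apply/funext => w; rewrite addrC subrK.
have tb0 := nrm_ge0 P (Sc b).
have g1 := sqrt_divn_le b0 n0; have g2 := sqrt_divn_ge b0 n0.
rewrite /sn; set tn := nrm P (Sc n) in h1 *; set tb := nrm P (Sc b) in h1 tb0 *.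
set k := Num.sqrt (n %/ b)%:R in h1 g1 g2 *; set q := Num.sqrt n%:R in sn0 g1 g2 *.
set s := Num.sqrt b%:R in h1 g1 g2 *.
have -> : tn / q - tb / s = (tn - k * tb) / q - (s^-1 - k / q) * tb by ring.
apply: le_trans (ler_normB _ _) _.
have a1 : `|(tn - k * tb) / q| <= K / s + K * s / q.
  rewrite normrM normfV (ger0_norm (ltW sn0)).
  apply: le_trans (_ : K * (k + s) / q <= _); first by rewrite ler_wpM2r// invr_ge0 ltW.
  by rewrite mulrDr mulrDl lerD2r -mulrA ler_wpM2l.
have a2 : `|(s^-1 - k / q) * tb| <= tb / q.
  rewrite normrM ger0_norm ?subr_ge0// (ger0_norm tb0) mulrC ler_wpM2l//; lra.
by apply: le_trans (lerD a1 a2) _; rewrite mulrDl; lra.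
Qed.

Lemma cvg_sn : exists sigma : R, sn @ \oo --> sigma.
Proof.
have [K K0 hK] := sn_close.
suff : cvg (sn @ \oo) by move=> h; exists (lim (sn @ \oo)).
apply/cauchy_cvgP/cauchy_exP => e e0.
have e20 : 0 < e / 2 by rewrite divr_gt0.
(* [b] is fixed before [n]: all late terms then lie near the single value [sn b]. *)
have [b b0 hb] : exists2 b : nat, (0 < b)%N & K / Num.sqrt b%:R < e / 2.
  have h : (fun n : nat => K * (Num.sqrt n%:R)^-1) @ \oo --> (0 : R).
    by rewrite -(mulr0 K); apply: cvgMr; exact: cvg_invsqrtn.
  move/cvgrPdist_lt: h => /(_ _ e20) [N _ hN]; exists N.+1 => //.
  have := hN N.+1 (leqnSn N); rewrite /= sub0r normrN.
  by rewrite ger0_norm// mulr_ge0// invr_ge0 sqrtr_ge0.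
have [c c0 hc] := hK b b0.
exists (sn b).
have hc0 : (fun n : nat => c * (Num.sqrt n%:R)^-1) @ \oo --> (0 : R).
  by rewrite -(mulr0 c); apply: cvgMr; exact: cvg_invsqrtn.
move/cvgrPdist_lt: hc0 => /(_ _ e20) hc0.
have hn : \forall n \near \oo, ball (sn b) e (sn n).
  near=> n.
  have n0 : (0 < n)%N by near: n; exists 1%N.
  have h2 : `|0 - c * (Num.sqrt n%:R)^-1| < e / 2 by near: n.
  rewrite /ball /= distrC; apply: le_lt_trans (hc n n0) _.
  move: h2; rewrite sub0r normrN ger0_norm; first by lra.
  by rewrite mulr_ge0// invr_ge0 sqrtr_ge0.
exact: hn.
Unshelve. all: by end_near. Qed.

Lemma var_div b : (b%:R)^-1 * var b = sn b ^+ 2.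
Proof. rewrite /sn expr_div_n varE (@sqr_sqrtr _ b%:R) ?ler0n//; exact: mulrC. Qed.

Lemma nrm_Xm_gamma n :
  Ex P (fun w => (Xm i0 n (shw 0 w) - n%:R * gamma) ^+ 2) = var n + (mean n - n%:R * gamma) ^+ 2.
Proof.
have h : Ex P (Sc n) = 0 by rewrite -Yb0 Ex_Yb.
rewrite varE -(nrm_shift _ (L2_Sc n) h) nrmE; congr Ex; apply/funext => w.
by rewrite /Sc; congr (_ ^+ 2); ring.
Qed.

(** Centring at [n * gamma] instead of the mean adds the squared bias, at most [C ^+ 2], which the
    division by [n] removes. *)
Lemma cvg_variance (sigma : R) : sn @ \oo --> sigma ->
  (fun n => (n%:R)^-1 * Ex P (fun w => (Xm i0 n (shw 0 w) - n%:R * gamma) ^+ 2)) @ \oo --> sigma ^+ 2.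
Proof.
move=> hs; have [C C0 hC] := mean_close.
have -> : (fun n => (n%:R)^-1 * Ex P (fun w => (Xm i0 n (shw 0 w) - n%:R * gamma) ^+ 2)) =
   (fun n => sn n * sn n + (n%:R)^-1 * (mean n - n%:R * gamma) ^+ 2).
  by apply/funext => n; rewrite nrm_Xm_gamma mulrDr var_div expr2.
rewrite -[sigma ^+ 2]addr0 expr2; apply: cvgD; first exact: cvgM.
apply: (@cvg_squeeze0 _ _ (fun n => (n%:R)^-1 * C ^+ 2)); last exact: cvg_cst_div.
move=> n; rewrite mulr_ge0 ?invr_ge0 ?sqr_ge0//= ler_wpM2l ?invr_ge0//.
by rewrite -[leLHS]real_normK ?num_real// lerXn2r ?nnegrE.
Qed.

(** * Central limit theorem for the largest entry *)

Definition Zn n w : R := (Xm i0 n (shw 0 w) - n%:R * gamma) / Num.sqrt n%:R.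

Lemma measurable_Zn n : measurable_fun setT (Zn n).
Proof.
apply: measurable_funM; last exact: measurable_cst.
by apply: measurable_funB; [exact: (measurable_shw_comp 0 (measurable_Xm i0 n))|exact: measurable_cst].
Qed.

(** [Zn] is first replaced by the normalized sum of blocks, at the price of the Lipschitz constant
    [3 * B] times an [L^1] distance; then the blocks by Gaussian variables, with an error vanishing
    in [n] for fixed [b]. [K] depends neither on [b] nor on [h], so [b] may be chosen before [n]. *)
Lemma clt_bound : exists2 K : R, 0 <= K & forall (B : R) h b, taylor2 B h -> (0 < b)%N ->
  exists2 u : nat -> R, u @ \oo --> (0 : R) & forall n, (0 < n)%N ->
  `|Ex P (fun w => h (Zn n w)) - heat ((n %/ b)%:R * (var b / n%:R)) h 0| <=
    3 * B * (K / Num.sqrt b%:R) + u n.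
Proof.
have [K K0 hK] := block_approx; have [C C0 hC] := mean_close.
exists K => // B h b tB b0; have B0 := taylor2_ge0 tB.
have hB := taylor2_bounded tB; have mh := taylor2_measurable tB.
pose e n := Ex P (fun w => trunc3 (Yb b 0 w / Num.sqrt n%:R)).
have v0 : 0 <= var b by rewrite varE sqr_ge0.
exists (fun n => 3 * B * ((K * Num.sqrt b%:R + C) * (Num.sqrt n%:R)^-1) +
    B * (n%:R * e n + var b * Num.sqrt (var b) * kappa3 * (Num.sqrt n%:R)^-1)).
  have z := @cvg_invsqrtn R.
  rewrite -[X in _ --> X](addr0 0); apply: cvgD.
    rewrite -(mulr0 (3 * B)); apply: cvgMr.
    by rewrite -(mulr0 (K * Num.sqrt b%:R + C)); apply: cvgMr.
  rewrite -(mulr0 B); apply: cvgMr; rewrite -[X in _ --> X](addr0 0); apply: cvgD; last first.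
    by rewrite -(mulr0 (var b * Num.sqrt (var b) * kappa3)); apply: cvgMr.
  have -> : (fun n => n%:R * e n) = (fun n => Ex P (fun w => n%:R * trunc3 (Yb b 0 w / Num.sqrt n%:R))).
    apply/funext => n; rewrite ExZ//; have := L1_trunc3 (L2Z (Num.sqrt n%:R)^-1 (L2_Yb b 0)).
    by congr (L1 P _); apply/funext => w; rewrite mulrC.
  exact: cvg_trunc3 (L2_Yb b 0).
move=> n n0; have q0 : 0 < Num.sqrt (n%:R : R) by rewrite sqrtr_gt0 ltr0n.
set k := (n %/ b)%N; set q := Num.sqrt n%:R in q0 *.
pose W w := \sum_(j < k) Yb b j w / q.
have WE w : W w = (\sum_(j < k) Yb b j w) / q by rewrite /W mulr_suml.
have iS : L2 P (fun w => \sum_(j < k) Yb b j w) by apply: L2_sum => j; exact: L2_Yb.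
have mW : measurable_fun setT W.
  have -> : W = (fun w => (\sum_(j < k) Yb b j w) / q) by apply/funext.
  by case: iS => mS _; apply: measurable_funM; [exact: mS|exact: measurable_cst].
have ihZ : L1 P (fun w => h (Zn n w)).
  by apply: (@L1_bounded _ _ _ _ _ B) => //; apply: measurableT_comp => //; exact: measurable_Zn.
have ihW : L1 P (fun w => h (W w)).
  by apply: (@L1_bounded _ _ _ _ _ B) => //; apply: measurableT_comp.
have iD := L2B (L2_Sc n) iS.
have s1 : `|Ex P (fun w => h (Zn n w)) - Ex P (fun w => h (W w))| <=
    3 * B * (K / Num.sqrt b%:R + (K * Num.sqrt b%:R + C) * q^-1).
  rewrite -ExB//; apply: le_trans (Ex_abs (L1B ihZ ihW)) _.
  have iSc : L1 P (fun w => q^-1 * `|Sc n w - \sum_(j < k) Yb b j w| + q^-1 * C).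
    by apply: L1D; [apply: L1Z; apply: L1_abs; exact: L2_L1|exact: L1_cst].
  apply: le_trans (_ : Ex P (fun w => 3 * B *
    (q^-1 * `|Sc n w - \sum_(j < k) Yb b j w| + q^-1 * C)) <= _).
    apply: Ex_le; [exact: L1_abs (L1B ihZ ihW)|exact: L1Z|move=> w].
    apply: le_trans (taylor2_lipschitz tB _ _) _; rewrite ler_wpM2l ?mulr_ge0//.
    rewrite WE /Zn -/q -mulrBl normrM normfV (ger0_norm (ltW q0)) mulrC -mulrDr.
    rewrite ler_wpM2l ?invr_ge0 ?(ltW q0)//.
    rewrite (_ : _ - _ = (Sc n w - \sum_(j < k) Yb b j w) + (mean n - n%:R * gamma)); last by rewrite /Sc; ring.
    by apply: le_trans (ler_normD _ _) _; rewrite lerD2l.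
  rewrite ExZ// ler_wpM2l ?mulr_ge0//.
  rewrite ExD; [|by apply: L1Z; apply: L1_abs; exact: L2_L1|exact: L1_cst].
  rewrite Ex_cst ExZ; last by apply: L1_abs; exact: L2_L1.
  have h1 := le_trans (Ex_abs_le_nrm iD) (hK b n b0).
  have q1 : 0 <= q^-1 by rewrite invr_ge0 ltW.
  have h2 := sqrt_divn_le b0 n0.
  apply: le_trans (lerD (ler_wpM2l q1 h1) (lexx _)) _.
  have h3 : K * (Num.sqrt k%:R / q) <= K * (Num.sqrt b%:R)^-1 by rewrite ler_wpM2l.
  have -> : q^-1 * (K * (Num.sqrt (n %/ b)%:R + Num.sqrt b%:R)) + q^-1 * C =
    K * (Num.sqrt k%:R / q) + (K * Num.sqrt b%:R + C) * q^-1 by rewrite /k; ring.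
  by rewrite lerD2r.
have L2Y j : L2 P (fun w => Yb b j w / q).
  by have := L2Z q^-1 (L2_Yb b j); congr (L2 P _); apply/funext => w; rewrite mulrC.
have qq : q ^+ 2 = n%:R by rewrite sqr_sqrtr.
have s2 : `|Ex P (fun w => h (W w)) - heat (k%:R * (var b / n%:R)) h 0| <=
    k%:R * (B * (e n + var b / n%:R * Num.sqrt (var b / n%:R) * kappa3)).
  apply: (@lindeberg_sum _ _ _ P (fun j w => Yb b j w / q)) => //.
  - by rewrite divr_ge0.
  - move=> j f M mf fM.
    have mfq : measurable_fun setT (fun x : measurableTypeR R => f (x / q)).
      by apply: measurableT_comp => //; exact: measurable_funM.
    have [r1 r2] := Yb_orth b j mfq (fun x => fM (x / q)).
    have mS : measurable_fun setT (fun w => \sum_(i < j) Yb b i w).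
      by have [] : L2 P (fun w => \sum_(i < j) Yb b i w) by apply: L2_sum => i; exact: L2_Yb.
    have i1 := L1_comp_mul mfq (fun x => fM (x / q)) mS (L2_L1 (L2_Yb b j)).
    have i2 := L1_comp_mul mfq (fun x => fM (x / q)) mS (proj2 (L2_Yb b j)).
    have eW : (fun w => f (\sum_(i < j) Yb b i w / q)) = (fun w => f ((\sum_(i < j) Yb b i w) / q)).
      by apply/funext => w; rewrite mulr_suml.
    split.
      have -> : (fun w => f (\sum_(i < j) Yb b i w / q) * (Yb b j w / q)) =
          (fun w => q^-1 * (f ((\sum_(i < j) Yb b i w) / q) * Yb b j w)).
        by apply/funext => w; rewrite mulr_suml; ring.
      by rewrite (@ExZ _ _ _ P q^-1 _ i1) r1 mulr0.
    have -> : (fun w => f (\sum_(i < j) Yb b i w / q) * (Yb b j w / q) ^+ 2) =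
        (fun w => (q ^+ 2)^-1 * (f ((\sum_(i < j) Yb b i w) / q) * Yb b j w ^+ 2)).
      by apply/funext => w; rewrite mulr_suml expr_div_n; ring.
    by rewrite (@ExZ _ _ _ P (q ^+ 2)^-1 _ i2) r2 eW qq; ring.
  - move=> j; rewrite /e le_eqVlt; apply/orP; left; apply/eqP.
    apply: (Ex_comp_Yb b j (f := fun x => trunc3 (x / q))).
    by apply: measurableT_comp; [exact: measurable_trunc3|exact: measurable_funM].
apply: le_trans (_ : `|Ex P (fun w => h (Zn n w)) - Ex P (fun w => h (W w))| +
    `|Ex P (fun w => h (W w)) - heat (k%:R * (var b / n%:R)) h 0| <= _).
  by apply: le_trans (ler_normD _ _); rewrite addrA subrK.
apply: le_trans (lerD s1 s2) _; rewrite mulrDr -!addrA lerD2l lerD2l.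
rewrite mulrCA ler_wpM2l//.
have kn : (k%:R : R) <= n%:R by rewrite ler_nat leq_div.
have e0 : 0 <= e n by apply: Ex_ge0 => w; exact: trunc3_ge0.
apply: le_trans (_ : n%:R * (e n + var b / n%:R * Num.sqrt (var b / n%:R) * kappa3) <= _).
  rewrite ler_wpM2r// addr_ge0// mulr_ge0 ?kappa3_ge0// mulr_ge0 ?sqrtr_ge0// divr_ge0//.
rewrite mulrDr lerD2l sqrtrM// sqrtrV// -/q le_eqVlt; apply/orP; left; apply/eqP.
by rewrite -qq; field; rewrite gt_eqF.
Qed.

Lemma divn_mul_dist (v : R) b n : 0 <= v -> (0 < b)%N -> (0 < n)%N ->
  `|(n %/ b)%:R * (v / n%:R) - (b%:R)^-1 * v| <= (n%:R)^-1 * v.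
Proof.
move=> v0 b0 n0; have nr : 0 < (n%:R : R) by rewrite ltr0n.
have br : 0 < (b%:R : R) by rewrite ltr0n.
have h1 : ((n %/ b)%:R : R) <= n%:R / b%:R.
  by rewrite ler_pdivlMr// -natrM ler_nat leq_divM.
have h2 : n%:R / b%:R <= (n %/ b)%:R + 1 :> R.
  by rewrite ler_pdivrMr// natr1 -natrM ler_nat ltnW// ltn_ceil.
have -> : (n %/ b)%:R * (v / n%:R) - (b%:R)^-1 * v =
    (n%:R)^-1 * v * ((n %/ b)%:R - n%:R / b%:R) by field; rewrite !gt_eqF.
have c0 : 0 <= (n%:R)^-1 * v by rewrite mulr_ge0// invr_ge0 ltW.
rewrite normrM (ger0_norm c0) -[leRHS]mulr1 ler_wpM2l// ler_norml; lra.
Qed.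

(** With [b] large, the block error is at most [e / 4] and [sn b ^+ 2] is close to [sigma ^+ 2];
    then [n] makes [u n] small and the variance of the Gaussian sum close to [sn b ^+ 2]. The
    tolerance [dl] converts closeness of variances into [e / 4], and is at most 1 for
    [heat_dist]. *)
Lemma clt (sigma : R) : sn @ \oo --> sigma -> forall (B : R) h, taylor2 B h ->
  (fun n => Ex P (fun w => h (Zn n w))) @ \oo --> heat (sigma ^+ 2) h 0.
Proof.
move=> hs B h tB; have [K K0 hK] := clt_bound; have B0 := taylor2_ge0 tB.
set L := B * (1 + kappa3); have L0 : 0 <= L.
  by rewrite mulr_ge0// addr_ge0// kappa3_ge0.
apply/cvgrPdist_le => e e0.
have e40 : 0 < e / 4 by rewrite divr_gt0.
pose dl := Num.min 1 (e / 4 / (L + 1)).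
have L10 : 0 < L + 1 by rewrite ltr_wpDl.
have dl0 : 0 < dl by rewrite lt_min ltr01/= divr_gt0.
have dl1 : dl <= 1 by rewrite ge_min lexx.
have dl2 : L * dl <= e / 4.
  have : dl <= e / 4 / (L + 1) by rewrite ge_min lexx orbT.
  rewrite ler_pdivlMr// mulrDr mulr1 mulrC; lra.
have dl20 : 0 < dl / 2 by rewrite divr_gt0.
have [b [b0 hb1 hb2]] : exists b : nat,
    [/\ (0 < b)%N, 3 * B * (K / Num.sqrt b%:R) <= e / 4 & `|sigma ^+ 2 - sn b ^+ 2| <= dl / 2].
  have c1 : (fun n : nat => 3 * B * (K * (Num.sqrt n%:R)^-1)) @ \oo --> (0 : R).
    rewrite -(mulr0 (3 * B)); apply: cvgMr.
    by rewrite -(mulr0 K); apply: cvgMr; exact: cvg_invsqrtn.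
  have c2 : (fun n => sn n ^+ 2) @ \oo --> sigma ^+ 2.
    by rewrite expr2; under eq_fun do rewrite expr2; exact: cvgM.
  move/cvgrPdist_le: c1 => /(_ _ e40) c1; move/cvgrPdist_le: c2 => /(_ _ dl20) c2.
  have [N _ hN] := filterI c1 c2; have [h1 h2] := hN N.+1 (leqnSn N).
  exists N.+1; split => //; move: h1; rewrite sub0r normrN => /(le_trans _); apply.
  exact: ler_norm.
have [u u0 hu] := hK B h b tB b0.
move/cvgrPdist_le: u0 => /(_ _ e40) u0.
have v0 : 0 <= var b by rewrite varE sqr_ge0.
have := cvg_cst_div (var b); move/cvgrPdist_le => /(_ _ dl20) hv.
near=> n.
have n0 : (0 < n)%N by near: n; exists 1%N.
have un : `|0 - u n| <= e / 4 by near: n.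
have vn : `|0 - (n%:R)^-1 * var b| <= dl / 2 by near: n.
have {}vn : (n%:R)^-1 * var b <= dl / 2.
  by move: vn; rewrite sub0r normrN; apply: le_trans; exact: ler_norm.
have {}un : u n <= e / 4.
  by move: un; rewrite sub0r normrN; apply: le_trans; exact: ler_norm.
set t := (n %/ b)%:R * (var b / n%:R).
have st : `|sigma ^+ 2 - t| <= dl.
  have h1 := divn_mul_dist v0 b0 n0; rewrite var_div -/t in h1.
  have -> : sigma ^+ 2 - t = (sigma ^+ 2 - sn b ^+ 2) - (t - sn b ^+ 2) by ring.
  by apply: le_trans (ler_normB _ _) _; lra.
have t0 : 0 <= t by rewrite mulr_ge0// divr_ge0.
have h2 := heat_dist tB (sqr_ge0 sigma) t0 (le_trans st dl1).
have h3 : `|Ex P (fun w => h (Zn n w)) - heat t h 0| <= e / 4 + e / 4.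
  by apply: le_trans (hu n n0) _; rewrite lerD.
have h4 : `|heat (sigma ^+ 2) h 0 - heat t h 0| <= e / 4.
  by apply: le_trans h2 _; apply: le_trans dl2; rewrite -/L ler_wpM2l.
have -> : heat (sigma ^+ 2) h 0 - Ex P (fun w => h (Zn n w)) =
  (heat (sigma ^+ 2) h 0 - heat t h 0) - (Ex P (fun w => h (Zn n w)) - heat t h 0) by ring.
by apply: le_trans (ler_normB _ _) _; lra.
Unshelve. all: by end_near. Qed.

(** * From the largest entry to all coordinates of the trajectory *)

Definition gap n (a : @mseq R d) : R := \sum_(i < d) (Xm i0 n a - trj a (fun=> 0) n i).

Lemma gap_ge0 n a : 0 <= gap n a.
Proof. by apply: sumr_ge0 => i _; rewrite subr_ge0 le_vmax. Qed.

Lemma measurable_gap n : measurable_fun setT (gap n).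
Proof.
apply: measurable_sum => i; apply: measurable_funB; first exact: measurable_Xm.
exact: measurable_trj_mseq.
Qed.

Lemma gap_stable n m a : okseq a -> rk1 (sh n a) m -> gap (n + m) a = gap m (sh n a).
Proof.
move=> oa /(rk1P i0 _ (okseq_sh n oa))/(_ (trj a (fun=> 0) n) (fun=> 0))[c hc].
apply: eq_bigr => i _; rewrite /Xm trj_add (vmax_shift i0 hc) hc; ring.
Qed.

(** The square roots are nonincreasing with bounded partial sums, so the [n]-th is at most
    [C / n.+1]; a probability is at most its square root. *)
Lemma cvg_nrk1_prob : nrk1_prob @ \oo --> (0 : R).
Proof.
have [C C0 hC] := sum_sqrt_nrk1_prob.
apply: (@cvg_squeeze0 _ _ (fun n => C * harmonic n)).
  move=> n; rewrite nrk1_prob_ge0 /= ler_pdivlMr ?ltr0n//.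
  apply: le_trans (hC n.+1); apply: le_trans (_ : \sum_(k < n.+1) Num.sqrt (nrk1_prob n) <= _).
    rewrite sumr_const card_ord -[leRHS]mulr_natr ler_wpM2r//.
    have := nrk1_prob_ge0 n; have := nrk1_prob_le1 n => h1 h0; rewrite -[leLHS]sqr_sqrtr// expr2 ler_piMl ?sqrtr_ge0//.
    by rewrite -[leRHS]sqrtr1 ler_wsqrtr.
  apply: ler_sum => k _; apply: ler_wsqrtr.
  by rewrite -[in leLHS](subnKC (_ : k <= n)%N) ?nrk1_prob_addl// -ltnS.
by rewrite -(mulr0 C); apply: cvgMr; exact: cvg_harmonic.
Qed.

Lemma min1_add (x y : R) : 0 <= x -> 0 <= y -> Num.min 1 (x + y) <= Num.min 1 x + Num.min 1 y.
Proof.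
by move=> x0 y0; have [h|h] := leP 1 x; have [h'|h'] := leP 1 y; have [g|g] := leP 1 (x + y); lra.
Qed.

Lemma measurable_min1_div (u : Omega -> R) n : measurable_fun setT u ->
  measurable_fun setT (fun w => Num.min 1 (u w / Num.sqrt n%:R)).
Proof.
move=> mu; apply: measurable_minr; first exact: measurable_cst.
by apply: measurable_funM; [exact: mu|exact: measurable_cst].
Qed.

Lemma min1_div_bounded (x : R) n : 0 <= x -> `|Num.min 1 (x / Num.sqrt n%:R)| <= 1.
Proof.
by move=> x0; rewrite ger0_norm ?le_min ?ler01 ?divr_ge0 ?sqrtr_ge0//= ge_min lexx.
Qed.

Lemma cvg_min1_div (u : Omega -> R) : measurable_fun setT u -> (forall w, 0 <= u w) ->
  (fun n => Ex P (fun w => Num.min 1 (u w / Num.sqrt n%:R))) @ \oo --> (0 : R).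
Proof.
move=> mu u0; apply: (@cvg_Ex_dominated _ _ _ P _ (fun=> 1)).
- by move=> n; exact: measurable_min1_div.
- exact: L1_cst.
- by move=> n w; exact: min1_div_bounded.
apply: aeW => w; apply: (@cvg_squeeze0 _ _ (fun n => u w * (Num.sqrt n%:R)^-1)).
  by move=> n; rewrite le_min ler01 divr_ge0 ?sqrtr_ge0//= ge_min lexx orbT.
by rewrite -(mulr0 (u w)); apply: cvgMr; exact: cvg_invsqrtn.
Qed.

(** Outside an event of probability at most [e / 2], the last [m] operators have rank 1 and the gap
    is distributed as [gap m], a fixed variable that [sqrt n] sends to 0. *)
Lemma cvg_gap :
  (fun n => Ex P (fun w => Num.min 1 (gap n (shw 0 w) / Num.sqrt n%:R))) @ \oo --> (0 : R).
Proof.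
have mg n s : measurable_fun setT (fun w => gap n (shw s w)).
  exact: (measurable_shw_comp s (measurable_gap n)).
have ig n s k : L1 P (fun w => Num.min 1 (gap n (shw s w) / Num.sqrt k%:R)).
  apply: (@L1_bounded _ _ _ _ _ 1); first exact: measurable_min1_div.
  by move=> w; apply: min1_div_bounded; exact: gap_ge0.
apply/cvgrPdist_le => e e0; have e20 : 0 < e / 2 by rewrite divr_gt0.
have [m hm] : exists m, nrk1_prob m <= e / 2.
  move/cvgrPdist_le: cvg_nrk1_prob => /(_ _ e20)[N _ hN]; exists N.
  by have := hN N (leqnn N); rewrite /= sub0r normrN ger0_norm ?nrk1_prob_ge0.
have h := cvg_min1_div (mg m 0) (fun w => gap_ge0 m (shw 0 w)).
move/cvgrPdist_le: h => /(_ _ e20) h.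
near=> n.
have mn : (m <= n)%N by near: n; exists m.
have h1 : `|0 - Ex P (fun w => Num.min 1 (gap m (shw 0 w) / Num.sqrt n%:R))| <= e / 2 by near: n.
have {}h1 : Ex P (fun w => Num.min 1 (gap m (shw 0 w) / Num.sqrt n%:R)) <= e / 2.
  by move: h1; rewrite sub0r normrN; apply: le_trans; exact: ler_norm.
set l := (n - m)%N.
have ge w s k j : 0 <= Num.min 1 (gap k (shw s w) / Num.sqrt j%:R).
  by rewrite le_min ler01 divr_ge0 ?sqrtr_ge0 ?gap_ge0.
rewrite sub0r normrN ger0_norm; last by apply: Ex_ge0.
have mi : measurable_fun setT (fun w => \1_(nrk1 m) (shw l w) : R).
  by apply: (measurable_shw_comp l); apply: measurable_indic; exact: measurable_nrk1.
have ii : L1 P (fun w => \1_(nrk1 m) (shw l w)).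
  apply: (@L1_bounded _ _ _ _ _ 1) => // w.
  by rewrite indicE; case: (_ \in _); rewrite ?normr1 ?normr0.
apply: le_trans (_ : Ex P (fun w => \1_(nrk1 m) (shw l w) +
    Num.min 1 (gap m (shw l w) / Num.sqrt n%:R)) <= _).
  apply: Ex_le => //; first exact: L1D.
  move=> w; rewrite indicE; have [r|r] := boolP (shw l w \in nrk1 m).
    by apply: le_trans (_ : 1 <= _); [rewrite ge_min lexx|rewrite lerDl].
  have r1 : rk1 (sh l (shw 0 w)) m.
    by rewrite sh_shw add0n; apply: contrapT => h2; move/negP: r; apply; exact/mem_set.
  have := gap_stable (okseq_shw 0 w) r1; rewrite subnK// sh_shw add0n => ->.
  by rewrite add0r.
rewrite ExD//.
have -> : Ex P (fun w => \1_(nrk1 m) (shw l w)) = nrk1_prob m.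
  apply: EFin_inj; rewrite -EFin_Ex// -(nrk1_probE l m) -[in RHS](setIT (shw l @^-1` _)) -integral_indic//.
  exact: measurable_shw_nrk1.
have -> : Ex P (fun w => Num.min 1 (gap m (shw l w) / Num.sqrt n%:R)) =
    Ex P (fun w => Num.min 1 (gap m (shw 0 w) / Num.sqrt n%:R)).
  apply: (shw_Ex l (u := fun a => Num.min 1 (gap m a / Num.sqrt n%:R))).
  apply: measurable_minr; first exact: measurable_cst.
  by apply: measurable_funM; [exact: measurable_gap|exact: measurable_cst].
lra.
Unshelve. all: by end_near. Qed.

Hypothesis mX0 : forall i, measurable_fun setT (fun w => X0 w i).

Definition Xn n w : 'I_d -> R := fun i => (mp_traj A X0 n w i - n%:R * gamma) / Num.sqrt n%:R.

Lemma measurable_Xn n i : measurable_fun setT (fun w => Xn n w i).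
Proof.
apply: measurable_funM; last exact: measurable_cst.
apply: measurable_funB; last exact: measurable_cst.
under eq_fun do rewrite mp_trajE.
apply: measurable_trj => // k i' j; exact: mA.
Qed.

Lemma Xn_Zn_dist n w : dist1 (Xn n w) (fun=> Zn n w) <=
  d%:R * dist1 (X0 w) (fun=> 0) / Num.sqrt n%:R + gap n (shw 0 w) / Num.sqrt n%:R.
Proof.
rewrite -mulrDl /dist1 -/(dist1 (X0 w) (fun=> 0)).
have -> : \sum_(i < d) `|Xn n w i - Zn n w| =
    (\sum_(i < d) `|mp_traj A X0 n w i - Xm i0 n (shw 0 w)|) / Num.sqrt n%:R.
  rewrite mulr_suml; apply: eq_bigr => i _.
  rewrite /Xn /Zn -mulrBl normrM normfV (ger0_norm (sqrtr_ge0 _)); congr (`|_| / _); ring.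
rewrite ler_wpM2r ?invr_ge0 ?sqrtr_ge0//.
have -> : d%:R * dist1 (X0 w) (fun=> 0) = \sum_(i < d) dist1 (X0 w) (fun=> 0).
  by rewrite sumr_const card_ord mulr_natl.
rewrite /gap -big_split; apply: ler_sum => i _ /=.
rewrite mp_trajE; have h := trj_nonexpansive (X0 w) (fun=> 0) n i (okseq_shw 0 w).
rewrite -[X in _ <= _ + X]ger0_norm ?subr_ge0 ?le_vmax//.
rewrite (_ : trj _ (X0 w) n i - _ = (trj (shw 0 w) (X0 w) n i - trj (shw 0 w) (fun=> 0) n i) -
  (Xm i0 n (shw 0 w) - trj (shw 0 w) (fun=> 0) n i)); last by ring.
by apply: le_trans (ler_normB _ _) _; rewrite lerD2r.
Qed.

Lemma cvg_Xn_Zn :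
  (fun n => Ex P (fun w => Num.min 1 (dist1 (Xn n w) (fun=> Zn n w)))) @ \oo --> (0 : R).
Proof.
pose D w := d%:R * dist1 (X0 w) (fun=> 0).
have D0 w : 0 <= D w by rewrite mulr_ge0// dist1_ge0.
have mD : measurable_fun setT D.
  apply: measurable_funM; first exact: measurable_cst.
  by apply: measurable_dist1 => // i; exact: measurable_cst.
have mg n : measurable_fun setT (fun w => gap n (shw 0 w)).
  exact: (measurable_shw_comp 0 (measurable_gap n)).
have mx n : measurable_fun setT (fun w => Num.min 1 (dist1 (Xn n w) (fun=> Zn n w))).
  apply: measurable_minr; first exact: measurable_cst.
  by apply: measurable_dist1 => i; [exact: measurable_Xn|exact: measurable_Zn].
apply: (@cvg_squeeze0 _ _ (fun n => Ex P (fun w => Num.min 1 (D w / Num.sqrt n%:R)) +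
  Ex P (fun w => Num.min 1 (gap n (shw 0 w) / Num.sqrt n%:R)))); last first.
  rewrite -[X in _ --> X](addr0 0); apply: cvgD; [exact: cvg_min1_div|exact: cvg_gap].
move=> n; rewrite Ex_ge0 /=; last by move=> w; rewrite le_min ler01 dist1_ge0.
have i1 : L1 P (fun w => Num.min 1 (D w / Num.sqrt n%:R)).
  apply: (@L1_bounded _ _ _ _ _ 1); first exact: measurable_min1_div.
  by move=> w; exact: min1_div_bounded.
have i2 : L1 P (fun w => Num.min 1 (gap n (shw 0 w) / Num.sqrt n%:R)).
  apply: (@L1_bounded _ _ _ _ _ 1); first exact: measurable_min1_div.
  by move=> w; apply: min1_div_bounded; exact: gap_ge0.
rewrite -ExD//; apply: Ex_le; last first.
- move=> w; apply: le_trans (min1_add _ _); first last.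
  + by rewrite divr_ge0 ?sqrtr_ge0 ?gap_ge0.
  + by rewrite divr_ge0 ?sqrtr_ge0.
  by rewrite le_min !ge_min lexx /= Xn_Zn_dist orbT.
- exact: L1D.
apply: (@L1_bounded _ _ _ _ _ 1) => // w.
by rewrite ger0_norm ?le_min ?ler01 ?dist1_ge0// ge_min lexx.
Qed.

Lemma weak_cvg_Xn (sigma : R) (F : ('I_d -> R) -> R) M : sn @ \oo --> sigma ->
  (forall x, `|F x| <= M) -> continuous1 F ->
  (fun n => Ex P (fun w => F (Xn n w))) @ \oo --> heat (sigma ^+ 2) (fun z => F (fun=> z)) 0.
Proof.
move=> hs FM cF.
have cZ := clt hs.
exact: (@weak_cvg_continuous1 _ _ _ P Zn _ measurable_Zn cZ d Xn measurable_Xn cvg_Xn_Zn F M FM cF).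
Qed.
End driving_sequence.

Theorem theorem2p7 (R : realType) (d : nat) (dO : measure_display)
    (Omega : measurableType dO) (P : probability Omega R)
    (A : nat -> Omega -> @mp_op R d) (X0 : Omega -> 'I_d -> R) (gamma : R) :
  (0 < d)%N ->
  (* each A(n) is a random (max,+) operator *)
  (forall n w, is_mp_op (A n w)) ->
  (forall n i j, measurable_fun setT (fun w => A n w i j)) ->
  (forall i, measurable_fun setT (fun w => X0 w i)) ->
  (* X0, A(1), A(2), ... are mutually independent *)
  mutual_indep P (fun n => if n is k.+1 then sigma_of (A k.+1) mp_op_sigma
                           else sigma_of X0 vec_sigma) ->
  (* the A(n), n >= 1, are identically distributed *)
  (forall n S, (0 < n)%N -> mp_op_sigma S -> P (A n @^-1` S) = P (A 1%N @^-1` S)) ->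
  (* memory loss property *)
  (exists N, (0 < P [set w | mp_rank1 (mp_prod A N w)])%E) ->
  (* finite second moments *)
  (\int[P]_w (mp_maxentry (A 1%N w) * mp_maxentry (A 1%N w)) < +oo)%E ->
  (\int[P]_w (mp_minmax (A 1%N w) * mp_minmax (A 1%N w)) < +oo)%E ->
  (* gamma is the Lyapunov exponent *)
  {ae P, forall w, forall i,
     (fun n => (n%:R)^-1 * mp_traj A X0 n w i) @ \oo --> gamma} ->
  exists sigma2 : R, 0 <= sigma2 /\
    (* (i) weak convergence to (Z,...,Z), Z ~ N(0, sigma2) *)
    (forall f : 'rV[R]_d -> R, continuous f ->
       (exists M : R, forall v, `|f v| <= M) ->
       (fun n : nat => (\int[P]_w
           (f (\row_i ((mp_traj A X0 n w i - n%:R * gamma) / Num.sqrt n%:R)))%:E)%E)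
         @ \oo --> gauss_expect sigma2 (fun z => f (const_mx z))) /\
    (* (ii) variance formula *)
    ((fun n : nat => ((n%:R)^-1)%:E *
        \int[P]_w ((mp_maxentry (mp_prod A n w) - (n%:R * gamma)%:E) *
                   (mp_maxentry (mp_prod A n w) - (n%:R * gamma)%:E)))%E
       @ \oo --> sigma2%:E).
Proof.
move=> d0 oA mA mX0 iA idA loss fM fm lyap.
have i0 : 'I_d := Ordinal d0.
have sq0 (x : \bar R) : (0 <= x * x)%E.
  by case: x => [r| |]; rewrite ?mulyy ?mulNyNy ?leey// -EFinM lee_fin -expr2 sqr_ge0.
have mQM := measurable_maxentry (mA 1%N); have mQm := measurable_minmax (mA 1%N).
have fQ : (\int[P]_w Qb (A 1%N w) < +oo)%E.
  rewrite ge0_integralD//; first by rewrite lte_add_pinfty.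
  - by apply: emeasurable_funM; exact: mQM.
  - by apply: emeasurable_funM; exact: mQm.
have [sigma hs] := cvg_sn i0 oA mA iA idA fQ loss.
(* [sigma] is the limit of the normalized deviations of [Xm]. Formula (ii) determines [sigma ^+ 2]
   from [A] and [gamma], so it does not vary with [X0]. *)
exists (sigma ^+ 2); split; first exact: sqr_ge0.
split=> [f cf [M fB]|].
  have cg : continuous (fun z : R => f (const_mx z)).
    move=> z; apply: continuous_comp; last exact: cf.
    move=> V /nbhs_ballP[e e0 h]; apply/nbhs_ballP; exists e => // y zy.
    by apply: h; split => // i j; rewrite !mxE.
  rewrite (gauss_expectE (sqr_ge0 sigma) cg (fun z => fB (const_mx z))).
  have c1 := continuous1_row cf.
  have := weak_cvg_Xn oA mA iA idA fQ loss lyap mX0 hs (fun x => fB (\row_i x i)) c1.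
  have -> : (fun z : R => f (\row_(i < d) (fun=> z) i)) = (fun z => f (const_mx z)).
    by apply/funext => z; congr f; apply/rowP => i; rewrite !mxE.
  have -> : (fun n : nat => (\int[P]_w
      (f (\row_i ((mp_traj A X0 n w i - n%:R * gamma) / Num.sqrt n%:R)))%:E)%E) =
      EFin \o (fun n => Ex P (fun w => f (\row_i Xn A X0 gamma n w i))).
    apply/funext => n; rewrite /= -EFin_Ex//; apply: (@L1_bounded _ _ _ _ _ M); last by move=> w; exact: fB.
    apply: (measurable_continuous1 (fun x => fB (\row_i x i)) c1) => i.
    exact: measurable_Xn.
  by move=> h; apply: cvg_EFin => //; exact: nearW.
have h := cvg_variance oA mA iA idA fQ loss lyap hs.
have -> : (fun n : nat => ((n%:R)^-1)%:E *
        \int[P]_w ((mp_maxentry (mp_prod A n w) - (n%:R * gamma)%:E) *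
                   (mp_maxentry (mp_prod A n w) - (n%:R * gamma)%:E)))%E =
    EFin \o (fun n => (n%:R)^-1 * Ex P (fun w => (Xm i0 n (shw A 0 w) - n%:R * gamma) ^+ 2)).
  apply/funext => n; rewrite /= EFinM; congr (_ * _)%E; rewrite -EFin_Ex.
    by apply: eq_integral => w _; rewrite (mp_maxentry_prod i0)// -EFinB -EFinM expr2.
  by have [] := L2B (L2_Xm i0 oA mA iA idA fQ n) (L2_cst P (n%:R * gamma)).
by apply: cvg_EFin => //; exact: nearW.
Qed.
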